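(* For any constant $\epsilon\in(0,1)$, there exists an $\widetilde{O}(n^{2/3}+D)$-round randomized $\mathsf{CONGEST}$ algorithm that solves $(1+\epsilon)$-Apx-RPaths in weighted directed graphs with high probability.
   Context: Let $G=(V,E)$ be a directed graph with $n=|V|$ whose edge weights are positive integers bounded by a polynomial in $n$; the length of a path is the sum of its edge weights. $G$ is also the communication network (communication over each edge in both directions); $D$ is the diameter of the underlying undirected unweighted graph. In the $\mathsf{CONGEST}$ model, computation proceeds in synchronous rounds; in each round every vertex may send an $O(\log n)$-bit message to each neighbour; vertices have unique $O(\log n)$-bit identifiers and unlimited local computation. ''With high probability'' means with probability $1-1/\operatorname{poly}(n)$; $\widetilde{O}$ hides polylogarithmic factors. Input: vertices $s,t$ and a shortest $s$-$t$ path $P=(s=v_0,\dots,v_{h_{st}}=t)$ with $h_{st}$ edges; initially the endpoints of each edge of $P$ know it belongs to $P$, $s$ knows it is the source, $t$ knows it is the target. $|st\diamond e|$ is the length of a shortest $s$-$t$ path in $G$ avoiding the edge $e$. The $(1+\epsilon)$-Apx-RPaths problem asks that, for each edge $e$ of $P$, its first endpoint computes a value $x$ with $|st\diamond e|\le x\le(1+\epsilon)|st\diamond e|$. *)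

(* Defs.v *)
From HB Require Import structures.
From mathcomp Require Import all_boot all_order all_algebra.
From mathcomp Require Import reals.
Set Implicit Arguments. Unset Strict Implicit. Unset Printing Implicit Defensive.
Import Order.TTheory GRing.Theory Num.Theory.

(* A directed graph on vertex set 'I_n: edge relation E, weights w u v
   (only meaningful when E u v). *)

Definition adj n (E : rel 'I_n) : rel 'I_n := fun u v => E u v || E v u.

Definition within n (E : rel 'I_n) (k : nat) (u v : 'I_n) : Prop :=
  exists q : seq 'I_n, [/\ path (adj E) u q, last u q = v & size q <= k].

Definition is_diameter n (E : rel 'I_n) (D : nat) : Prop :=
  (forall u v, within E D u v) /\
  (forall D', (forall u v, within E D' u v) -> D <= D').

Definition weight n (w : 'I_n -> 'I_n -> nat) (x : 'I_n) (p : seq 'I_n) : nat :=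
  \sum_(e <- zip (x :: p) p) w e.1 e.2.

Definition shortest_path n (E : rel 'I_n) (w : 'I_n -> 'I_n -> nat)
    (s t : 'I_n) (p : seq 'I_n) : Prop :=
  [/\ path E s p, last s p = t &
      forall q, path E s q -> last s q = t -> weight w s p <= weight w s q].

Definition onP n (P : seq 'I_n) (u v : 'I_n) : bool :=
  has (fun i => (nth u P i == u) && (nth v P i.+1 == v)) (iota 0 (size P).-1).

Definition Eminus n (E : rel 'I_n) (a b : 'I_n) : rel 'I_n :=
  fun u v => E u v && ~~ ((u == a) && (v == b)).

Definition is_rdist n (E : rel 'I_n) (w : 'I_n -> 'I_n -> nat)
    (s t a b : 'I_n) (L : nat) : Prop :=
  (exists q, [/\ path (Eminus E a b) s q, last s q = t & weight w s q = L]) /\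
  (forall q, path (Eminus E a b) s q -> last s q = t -> L <= weight w s q).

Definition no_rpath n (E : rel 'I_n) (s t a b : 'I_n) : Prop :=
  forall q, path (Eminus E a b) s q -> last s q <> t.

(* Initial knowledge of a vertex about an incident (communication) edge to
   a neighbour u: the directed edges between them with their weights, and
   whether these directed edges belong to P. *)
Record NbrInfo := {
  out_w : option nat;
  in_w : option nat;
  out_onP : bool;
  in_onP : bool }.

(* Initial local input of a vertex: its identifier, whether it is s / t,
   and for every identifier j, the info on the neighbour with identifier j
   (None if no neighbour has identifier j). *)
Record LocalInput := {
  li_id : nat;
  li_is_s : bool;
  li_is_t : bool;
  li_nbr : nat -> option NbrInfo }.

(* A randomized CONGEST algorithm (n is known to all vertices; local
   computation is unrestricted).  For each n: a state type, the number of
   private random bits of each vertex, the initial state, the message sent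
   to the neighbour with a given identifier, the state update from the
   messages received (indexed by sender identifier), a termination flag and
   the output (None = infinity) associated with the neighbour with a given
   identifier. *)
Record Alg := {
  a_St : nat -> Type;
  a_rbits : nat -> nat;
  a_init : forall n, LocalInput -> (a_rbits n).-tuple bool -> a_St n;
  a_msg : forall n, a_St n -> nat -> nat;
  a_upd : forall n, a_St n -> (nat -> nat) -> a_St n;
  a_halted : forall n, a_St n -> bool;
  a_out : forall n, a_St n -> nat -> option nat }.

Definition local n (E : rel 'I_n) (w : 'I_n -> 'I_n -> nat) (id : 'I_n -> nat)
    (s t : 'I_n) (P : seq 'I_n) (v : 'I_n) : LocalInput :=
  {| li_id := id v; li_is_s := v == s; li_is_t := v == t;
     li_nbr := fun j =>
       if [pick u | adj E v u && (id u == j)] is Some u then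
         Some {| out_w := if E v u then Some (w v u) else None;
                 in_w := if E u v then Some (w u v) else None;
                 out_onP := onP P v u; in_onP := onP P u v |}
       else None |}.

(* Synchronous execution; messages carry B*log2 n bits, i.e. are values
   modulo n^B. *)
Fixpoint run (A : Alg) n (B : nat) (E : rel 'I_n) (id : 'I_n -> nat)
    (li : 'I_n -> LocalInput) (r : {ffun 'I_n -> (a_rbits A n).-tuple bool})
    (T : nat) : 'I_n -> a_St A n :=
  match T with
  | 0 => fun v => a_init (li v) (r v)
  | T'.+1 =>
      let prev := run B E id li r T' in
      fun v => a_upd (prev v) (fun j =>
        if [pick u | adj E v u && (id u == j)] is Some u
        then a_msg (prev u) (id v) %% n ^ B else 0)
  end.

Definition cbrt_sq (n : nat) : nat :=
  find (fun m => n ^ 2 <= m ^ 3) (iota 0 (n ^ 2).+1).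

Definition correct_out (R : realType) (eps : R) n (E : rel 'I_n)
    (w : 'I_n -> 'I_n -> nat) (s t v u : 'I_n) (o : option nat) : Prop :=
  match o with
  | Some x => exists L, [/\ is_rdist E w s t v u L, L <= x &
                           (x%:R <= (1 + eps) * L%:R)%R]
  | None => no_rpath E s t v u
  end.

Definition success (R : realType) (eps : R) (A : Alg) n (B : nat)
    (E : rel 'I_n) (w : 'I_n -> 'I_n -> nat) (id : 'I_n -> nat)
    (s t : 'I_n) (p : seq 'I_n) (Tmax : nat)
    (r : {ffun 'I_n -> (a_rbits A n).-tuple bool}) : Prop :=
  let st := run B E id (local E w id s t (s :: p)) r in
  forall v, exists T0, [/\ T0 <= Tmax, a_halted (st T0 v),
    (forall T, T < T0 -> ~~ a_halted (st T v)) &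
    forall u, onP (s :: p) v u -> correct_out eps E w s t v u (a_out (st T0 v) (id u))].

(* Main.v *)
(** A replacement path for the edge [e = (v_i, v_{i+1})] of [P] can be taken of the form
    [P[s..v_a] . delta . P[v_b..t]] with [a <= i < b], where [delta] uses no edge of [P].
    Each vertex becomes a landmark with probability about [n^{-2/3}], so that with high probability
    there are about [n^{1/3}] landmarks, and every stretch of about [n^{2/3}] hops of [P] or of a
    (fixed, cheapest) detour [delta] contains one.

    Weights are rounded up to multiples of [2^i], for every scale [i]; a walk with few hops then has,
    for the right scale, a rounded length of about [n^{2/3}] and a small relative error.  Per scale,
    every vertex learns its rounded distances to all landmarks (the source detection of Lenzen and
    Peleg, which pipelines the pairs (distance, source) in lexicographic order) and, for every
    rounded length [l], the furthest vertex of [P] that it reaches off [P] within length [l]; rejoining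
    [P] further is cheaper and bypasses more edges, so only the furthest one matters.

    The landmarks cut [P] into segments.  Prefix minima of the values of the starting points [v_a] are
    pipelined along the segments, and their totals at segment ends, together with the distances
    between landmarks, are broadcast: about [n^{2/3}] items.  If [v_a] and [v_b] both lie outside the
    segment of [e], or if [delta] is long and runs through landmarks, these items suffice; if [v_a]
    lies in the segment of [e], its prefix minima do, and if [v_b] does, the mirror image of the whole
    computation (run on the reversed graph) does.

    Vertices are only positioned on [P] after a first broadcast, of the distances along [P] between
    consecutive landmarks.  The schedule depends on the diameter only through the eccentricity of [s],
    which is computed beforehand and becomes known everywhere in the same round. *)

Require Import Defs.
From HB Require Import structures.
From mathcomp Require Import all_boot all_order all_algebra.
From mathcomp Require Import boolp reals zify.
Set Implicit Arguments. Unset Strict Implicit. Unset Printing Implicit Defensive.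

(** * Networks and local computability *)

(** Fixing a target landmark or a rejoining threshold, called a tag, instead of a pair of endpoints
    is what makes the detours manageable: for a fixed tag the best leaving vertex is a prefix
    minimum along [P], whatever the edge. There are about [n^{1/3}] boundaries and about as many
    tags worth broadcasting, hence about [n^{2/3}] totals. The thresholds inside the segment of the
    edge are too many to be broadcast. The forward scan handles them only if the detour also leaves
    [P] inside that segment, and this is the reason for the mirrored run. The sampling rate balances
    the length of the stretches against the square of the number of landmarks. Local computation
    being free, a protocol amounts to a function of the history of a vertex, so only round counts
    and message sizes have to be controlled. *)

Definition lmin (top : nat) (s : seq nat) : nat := foldr minn top s.

Lemma lmin_le top s x : x \in s -> lmin top s <= x.
Proof.
elim: s => //= y s IH; rewrite inE => /orP [/eqP ->|/IH H]; first exact: geq_minl.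
by apply: leq_trans H; apply: geq_minr.
Qed.

Lemma lmin_top top s : lmin top s <= top.
Proof. by elim: s => //= y s IH; apply: leq_trans (geq_minr _ _) IH. Qed.

Lemma lmin_mem top s : lmin top s < top -> lmin top s \in s.
Proof.
elim: s => [|y s IH] /=; first by rewrite ltnn.
rewrite inE /minn; case: (ltnP y (foldr minn top s)) => [_ _|_ /IH ->]; first by rewrite eqxx.
by rewrite orbT.
Qed.

Section Network.
Variable n : nat.

(** The landmark bits belong to the instance: the protocols are analysed for one fixed outcome of
    the sampling. *)
Record inst := Inst {
  gE : rel 'I_n; gw : 'I_n -> 'I_n -> nat; gid : 'I_n -> nat;
  gs : 'I_n; gt : 'I_n; gp : seq 'I_n; glm : 'I_n -> bool }.

Definition loc (I : inst) := local (gE I) (gw I) (gid I) (gs I) (gt I) (gs I :: gp I).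
Arguments loc : simpl never.

Definition link (I : inst) (v u : 'I_n) : NbrInfo :=
  {| out_w := if gE I v u then Some (gw I v u) else None;
     in_w := if gE I u v then Some (gw I u v) else None;
     out_onP := onP (gs I :: gp I) v u; in_onP := onP (gs I :: gp I) u v |}.

Definition inbox (I : inst) Y (f : 'I_n -> Y) (v : 'I_n) (j : nat) : option (NbrInfo * Y) :=
  if [pick u | adj (gE I) v u && (gid I u == j)] is Some u then Some (link I v u, f u) else None.

(* Since local computation is free, the state of a vertex is its whole history: input, landmark bit, and per round the number received from each sender, indexed by identifier. *)
Definition View : Type := (LocalInput * bool * seq (nat -> nat))%type.

Fixpoint view (pi : View -> nat) (I : inst) (B T : nat) (v : 'I_n) : View :=
  if T is T'.+1 then
    let pv := view pi I B T' v in
    (pv.1, rcons pv.2 (fun j =>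
      if [pick u | adj (gE I) v u && (gid I u == j)] is Some u
      then pi (view pi I B T' u) %% n ^ B else 0))
  else (loc I v, glm I v, [::]).

Lemma viewS pi I B T v : view pi I B T.+1 v =
  ((view pi I B T v).1, rcons (view pi I B T v).2 (fun j =>
      if [pick u | adj (gE I) v u && (gid I u == j)] is Some u
      then pi (view pi I B T u) %% n ^ B else 0)).
Proof. by []. Qed.

Lemma view_fst pi I B T v : (view pi I B T v).1 = (loc I v, glm I v).
Proof. by elim: T. Qed.

Lemma view_size pi I B T v : size (view pi I B T v).2 = T.
Proof. by elim: T => //= T IH; rewrite size_rcons IH. Qed.

Lemma view_take pi I B T T' v : T' <= T -> take T' (view pi I B T v).2 = (view pi I B T' v).2.
Proof.
elim: T => [|T IH]; first by rewrite leqn0 => /eqP ->.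
rewrite leq_eqVlt => /orP [/eqP ->|]; first by rewrite -{1}(view_size pi I B T.+1 v) take_size.
rewrite ltnS => H /=; rewrite -cats1 takel_cat ?view_size //; exact: IH.
Qed.

(** Views up to time [T] depend only on messages sent before [T]; this allows a protocol to be
    prolonged without disturbing its past. *)
Lemma view_ext pi pi' I B T T' :
  (forall T'' u, T'' < T -> pi (view pi I B T'' u) = pi' (view pi I B T'' u)) ->
  T' <= T -> forall v, view pi' I B T' v = view pi I B T' v.
Proof.
move=> H; elim: T' => [//|T' IH] HT v /=.
rewrite IH 1?ltnW //; congr (_, rcons _ _).
apply: funext => j; case: pickP => // u _.
by rewrite IH 1?ltnW // -H.
Qed.

Lemma loc_nbr I v j : li_nbr (loc I v) j =
  if [pick u | adj (gE I) v u && (gid I u == j)] is Some u then Some (link I v u) else None.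
Proof. by rewrite /loc /local /=; case: pickP. Qed.

(** * Values computable by broadcasts, uniformly over a class of instances *)

Section Computable.
Variable Q : inst -> Prop.
Variable B : nat.

(* Every protocol here is a broadcast: [pi] gives one number, sent to all neighbours. *)
Definition computable (T : nat) (X : Type) (val : inst -> 'I_n -> X) : Prop :=
  exists (pi : View -> nat) (out : View -> X),
    forall I, Q I -> forall v, out (view pi I B T v) = val I v.

Lemma comp_map T X Y (val : inst -> 'I_n -> X) (g : X -> Y) (val' : inst -> 'I_n -> Y) :
  computable T val -> (forall I, Q I -> forall v, g (val I v) = val' I v) -> computable T val'.
Proof.
move=> [pi [out H]] E; exists pi, (g \o out) => I QI v /=; by rewrite H // E.
Qed.

Lemma comp_local : computable 0 (fun I v => (loc I v, glm I v)).
Proof. by exists (fun=> 0), fst. Qed.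

(** The size of the history is the round number: the new protocol imitates the old one for [T]
    rounds and then sends [m] of the computed value. *)
Lemma comp_exch T X (val : inst -> 'I_n -> X) (m : X -> nat) :
  computable T val -> (forall I, Q I -> forall v, m (val I v) < n ^ B) ->
  computable T.+1 (fun I v => (val I v, inbox I (fun u => m (val I u)) v)).
Proof.
move=> [pi [out H]] Hm.
pose pi' (V : View) := if size V.2 < T then pi V else m (out V).
have E I T' v : T' <= T -> view pi' I B T' v = view pi I B T' v.
  move=> HT; apply: (@view_ext pi pi' I B T) => // T'' u HT''.
  by rewrite /pi' view_size HT''.
have Ep V : size V.2 = T -> pi' V = m (out V) by rewrite /pi' => ->; rewrite ltnn.
exists pi', (fun V => (out (V.1, take T V.2),
  fun j => if li_nbr V.1.1 j is Some f then Some (f, nth (fun=> 0) V.2 T j) else None)).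
move=> I QI v; congr (_, _).
  rewrite view_fst (view_take _ _ _ _ (leqnSn T)) E // -(view_fst pi I B T v).
  by rewrite -surjective_pairing H.
apply: funext => j; cbv beta; rewrite view_fst loc_nbr /inbox viewS.
rewrite nth_rcons view_size ltnn eqxx; case: pickP => // u _.
by rewrite Ep ?view_size // E // H // modn_small // Hm.
Qed.

Lemma comp_loc T X (val : inst -> 'I_n -> X) :
  computable T val -> computable T (fun I v => (val I v, loc I v)).
Proof.
move=> [pi [out H]]; exists pi, (fun V => (out V, V.1.1)) => I QI v.
by rewrite H // view_fst.
Qed.

(** A list is sent one number per round; the common length [L] tells every receiver when it is
    complete. *)
Lemma comp_exchL L T X (val : inst -> 'I_n -> X) (m : X -> seq nat) :
  computable T val ->
  (forall I, Q I -> forall v, size (m (val I v)) = L /\ all (fun x => x < n ^ B) (m (val I v))) ->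
  computable (T + L) (fun I v => (val I v, inbox I (fun u => m (val I u)) v)).
Proof.
move=> C Hm.
suff K k : k <= L ->
    computable (T + k) (fun I v => (val I v, inbox I (fun u => take k (m (val I u))) v)).
  apply: (@comp_map _ _ _ _ id _ (K L (leqnn L))) => I QI v; congr (_, _).
  apply: funext => j; rewrite /inbox; case: pickP => // u _.
  by rewrite -(Hm I QI u).1 take_size.
elim: k => [_|k IH Hk].
  rewrite addn0.
  apply: (@comp_map _ _ _ _ (fun x => (x.1,
    fun j => omap (fun f => (f, [::])) (li_nbr x.2 j))) _ (comp_loc C)) => I QI v.
  congr (_, _); apply: funext => j; rewrite /inbox loc_nbr.
  by case: pickP => // u _ /=; rewrite take0.
rewrite addnS.
have B0 : forall I, Q I -> forall v, nth 0 (m (val I v)) k < n ^ B.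
  move=> I QI v; case: (Hm I QI v) => S /allP; apply; apply: mem_nth; by rewrite S.
have := comp_exch (m := fun x => nth 0 (m x.1) k) (IH (ltnW Hk)) B0.
move=> C'; apply: (@comp_map _ _ _ _ (fun x => (x.1.1, fun j =>
   if x.1.2 j is Some y then if x.2 j is Some z then Some (y.1, rcons y.2 z.2) else None
   else None)) _ C') => I QI v /=.
congr (_, _); apply: funext => j; rewrite /inbox; case: pickP => // u _ /=.
by rewrite -take_nth // (Hm I QI u).1.
Qed.

Section Phase.
Variables (Y St : Type).
Variables (init : Y -> St) (m : Y -> St -> seq nat)
  (upd : Y -> St -> (nat -> option (NbrInfo * seq nat)) -> St).

Fixpoint prun (I : inst) (xi : 'I_n -> Y) (k : nat) (v : 'I_n) : St :=
  if k is k'.+1 then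
    upd (xi v) (prun I xi k' v) (inbox I (fun u => m (xi u) (prun I xi k' u)) v)
  else init (xi v).

Lemma comp_phase L K T X (val : inst -> 'I_n -> X) (proj : X -> Y) :
  computable T val ->
  (forall I, Q I -> forall k v, k < K ->
     let s := m (proj (val I v)) (prun I (fun u => proj (val I u)) k v) in
     size s = L /\ all (fun x => x < n ^ B) s) ->
  computable (T + K * L) (fun I v => (val I v, prun I (fun u => proj (val I u)) K v)).
Proof.
move=> C Hm.
suff P k : k <= K ->
    computable (T + k * L) (fun I v => (val I v, prun I (fun u => proj (val I u)) k v)) by exact: P.
elim: k => [_|k IH Hk].
  rewrite addn0.
  by apply: (@comp_map _ _ _ _ (fun x => (x, init (proj x))) _ C).
rewrite mulSn [L + _]addnC addnA.
have := @comp_exchL L _ _ _ (fun x => m (proj x.1) x.2) (IH (ltnW Hk)).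
move=> /(_ (fun I QI v => Hm I QI k v Hk)) C'.
by apply: (@comp_map _ _ _ _ (fun x => (x.1.1, upd (proj x.1.1) x.1.2 x.2)) _ C').
Qed.

(* Unlike in [comp_phase], the protocol does not depend on the number of rounds. *)
Definition sview (y : LocalInput * bool -> Y) (V : View) : St :=
  foldl (fun s h => upd (y V.1) s (fun j =>
    if li_nbr V.1.1 j is Some f then Some (f, [:: h j]) else None)) (init (y V.1)) V.2.

Lemma sview_rcons y a hs h : sview y (a, rcons hs h) =
  upd (y a) (sview y (a, hs)) (fun j => if li_nbr a.1 j is Some f then Some (f, [:: h j]) else None).
Proof. by rewrite /sview /= foldl_rcons. Qed.

Lemma sviewP (y : LocalInput * bool -> Y) I :
  let xi := fun v => y (loc I v, glm I v) in
  (forall k v, size (m (xi v) (prun I xi k v)) = 1 /\ head 0 (m (xi v) (prun I xi k v)) < n ^ B) ->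
  forall k v, sview y (view (fun V => head 0 (m (y V.1) (sview y V))) I B k v) = prun I xi k v.
Proof.
move=> xi H; elim=> [//|k IH] v.
rewrite viewS sview_rcons -surjective_pairing IH view_fst.
rewrite [prun _ _ _ _]/=; congr upd; apply: funext => j.
rewrite /inbox loc_nbr; case: pickP => // u _; congr (Some (_, _)).
rewrite IH view_fst; case: (H k u); rewrite /xi.
case: (m _ _) => [|x [|]] //= _ Hx; by rewrite modn_small.
Qed.
End Phase.
End Computable.

Section Inboxes.
Variable (N : nat).

(** An inbox is a function on all of [nat]; the bound [N] on identifiers turns it into a finite
    list. *)
Definition nlist Y A (ib : nat -> option (NbrInfo * Y)) (f : NbrInfo -> Y -> seq A) : seq A :=
  flatten [seq (if ib j is Some y then f y.1 y.2 else [::]) | j <- iota 0 N].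

Lemma nlistP I Y (A : eqType) (ms : 'I_n -> Y) (f : NbrInfo -> Y -> seq A) v x :
  injective (gid I) -> (forall v, gid I v < N) ->
  x \in nlist (inbox I ms v) f <-> exists2 u, adj (gE I) v u & x \in f (link I v u) (ms u).
Proof.
move=> inj lt; split.
  move=> /flatten_mapP [j _]; rewrite /inbox; case: pickP => // u /andP [a _] H; by exists u.
move=> [u a H]; apply/flatten_mapP; exists (gid I u); first by rewrite mem_iota /= lt.
rewrite /inbox; case: pickP => [u' /andP [_ /eqP /inj ->] //|/(_ u)]; by rewrite a eqxx.
Qed.
End Inboxes.
End Network.

(** * Random landmarks *)

Section Sampling.
Variables (n a : nat).
Local Notation M := (2 ^ a).
Local Notation V := 'I_n.
Local Notation omega := {ffun V -> a.-tuple bool}.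

(** An event of probability [1 / 2 ^ a] on [a] fair bits. *)
Definition selected (x : a.-tuple bool) : bool := x == [tuple of nseq a false].

Lemma sum_selected (c0 c1 : nat) :
  \sum_(x : a.-tuple bool) (if selected x then c1 else c0) = c1 + (M - 1) * c0.
Proof.
rewrite (bigD1 [tuple of nseq a false]) //= /selected eqxx; congr (_ + _).
rewrite (eq_bigr (fun=> c0)); last by move=> x /negPf ->.
rewrite sum_nat_const; congr (_ * _).
by rewrite cardC1 card_tuple card_bool subn1.
Qed.

Lemma card_omega : #|{: omega}| = M ^ n.
Proof. by rewrite card_ffun card_tuple card_bool card_ord. Qed.

(** Independence by counting: the indicator of avoiding [Q] is a product over the vertices, so its
    sum over all outcomes factors. *)
Lemma card_avoid (Q : {set V}) :
  #|[set r : omega | [forall v in Q, ~~ selected (r v)]]| = (M - 1) ^ #|Q| * M ^ (n - #|Q|).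
Proof.
rewrite -sum1_card.
have -> : \sum_(r in [set r : omega | [forall v in Q, ~~ selected (r v)]]) 1 =
   \sum_(r : omega) \prod_(v : V) (if selected (r v) then (v \notin Q : nat) else 1).
  rewrite big_mkcond; apply: eq_bigr => r _; rewrite inE.
  case: ifP => [/forall_inP H|/negbT].
    rewrite big1 // => v _; case: ifP => // S; case: (boolP (v \in Q)) => // /H.
    by rewrite S.
  rewrite negb_forall_in => /exists_inP [v vQ]; rewrite negbK => S.
  by rewrite (bigD1 v) //= S vQ.
rewrite -(bigA_distr_bigA (fun (v : V) (x : a.-tuple bool) =>
   if selected x then (v \notin Q : nat) else 1)).
rewrite (eq_bigr (fun v => if v \in Q then M - 1 else M)); last first.
  move=> v _; rewrite sum_selected muln1; case: (v \in Q) => //=.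
  by rewrite subnKC // expn_gt0.
rewrite (bigID (fun v => v \in Q)) /=; congr (_ * _).
  by rewrite (eq_bigr (fun=> M - 1)) ?prod_nat_const // => v ->.
rewrite (eq_bigr (fun=> M)) ?prod_nat_const => [|v /negPf -> //].
congr (_ ^ _); have E : #|Q| + #|[predC Q]| = n by rewrite cardC card_ord.
have -> : n - #|Q| = #|[predC Q]| by lia.
by apply: eq_card => v; rewrite !inE.
Qed.

(** Exponential Markov inequality: [(M + 1) ^ n] is the sum over all outcomes of 2 to the number of
    selected vertices. *)
Lemma card_many (k : nat) :
  #|[set r : omega | k <= #|[set v | selected (r v)]|]| * 2 ^ k <= (M + 1) ^ n.
Proof.
have -> : (M + 1) ^ n = \sum_(r : omega) 2 ^ #|[set v | selected (r v)]|.
  rewrite [RHS](eq_bigr (fun r : omega => \prod_(v : V) (if selected (r v) then 2 else 1))); last first.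
    move=> r _; rewrite -big_mkcond /= -prod_nat_const; apply: eq_bigl => v; by rewrite inE.
  rewrite -(bigA_distr_bigA (fun (v : V) (x : a.-tuple bool) => if selected x then 2 else 1)).
  rewrite (eq_bigr (fun=> M + 1)) ?prod_nat_const ?card_ord // => v _.
  by rewrite sum_selected muln1; have := expn_gt0 2 a; lia.
set A := [set r : omega | _].
rewrite -sum_nat_const; apply: (@leq_trans (\sum_(r in A) 2 ^ #|[set v | selected (r v)]|)).
  by apply: leq_sum => r; rewrite inE => H; apply: leq_pexp2l H.
rewrite [leqRHS](bigID (fun r => r \in A)) /=.
exact: leq_addr.
Qed.

End Sampling.

Lemma bernoulli_sub x k : 0 < x -> x ^ k + k * x ^ (k - 1) <= (x + 1) ^ k.
Proof.
move=> x0; elim: k => [|k IH]; first by rewrite !expn0 mul0n.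
rewrite subn1 /= !expnS.
case: k IH => [|k IH]; first by rewrite !expn0; lia.
have {IH} : (x + 1) * (x ^ k.+1 + k.+1 * x ^ k) <= (x + 1) * (x + 1) ^ k.+1.
  by rewrite leq_pmul2l ?addn1 //; move: IH; rewrite subn1 addn1.
apply: leq_trans; rewrite expnS; nia.
Qed.

(** That is, [(1 - 1/M)^M <= 1/2]: the first two terms in the expansion of [((M - 1) + 1)^M] are
    [(M - 1)^M] and [M (M - 1)^(M - 1)], the latter no smaller than the former. *)
Lemma half_pow M : 0 < M -> 2 * (M - 1) ^ M <= M ^ M.
Proof.
case: M => [//|[|M]] _ //.
have := @bernoulli_sub M.+1 M.+2 isT.
rewrite !subn1 /= addn1 => H; apply: leq_trans H.
by rewrite mul2n -addnn leq_add2l expnS leq_mul2r ltnW ?orbT.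
Qed.

(* [(1 - 1/(M+1)) ^ (M/2) >= 1/2] by Bernoulli, then square. *)
Lemma four_pow b : (b.*2 + 1) ^ b.*2 <= 4 * b.*2 ^ b.*2.
Proof.
case: b => [//|b]; set c := b.+1.
have H : (c.*2 + 1) ^ c <= 2 * c.*2 ^ c.
  have K k : k <= c -> (c.*2 + 1 - k) * (c.*2 + 1) ^ k <= c.*2 ^ k * (c.*2 + 1).
    elim: k => [|k IH] Hk; first by rewrite !expn0 subn0; lia.
    have {}IH := IH (ltnW Hk).
    rewrite !expnS; move: IH; set X := _ ^ k; set Y := _ ^ k => IH.
    have E : (c.*2 + 1 - k.+1) * (c.*2 + 1) <= c.*2 * (c.*2 + 1 - k).
      have [z Ez] : exists z, c = k + z.+1 by exists (c - k.+1); lia.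
      have -> : c.*2 + 1 - k.+1 = k + z.*2 + 2 by lia.
      have -> : c.*2 + 1 - k = k + z.*2 + 3 by lia.
      by rewrite Ez; nia.
    rewrite mulnA; apply: leq_trans (leq_mul E (leqnn X)) _.
    by rewrite -!mulnA leq_mul2l IH orbT.
  have := K c (leqnn c).
  have -> : c.*2 + 1 - c = c + 1 by lia.
  rewrite [leqRHS]mulnC => H.
  have H2 : (c.*2 + 1) * (c.*2 + 1) ^ c <= (c.*2 + 1) * (2 * c.*2 ^ c) by nia.
  by move: H2; rewrite leq_pmul2l // addn1.
rewrite -!addnn !expnD !addnn.
have := leq_mul H H; nia.
Qed.

(** * High-probability properties of the sample *)

Section Hitting.
Variables (n a d : nat).
Hypothesis n2 : 1 < n.
Hypothesis a0 : 0 < a.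
Local Notation M := (2 ^ a).
Local Notation lg := (up_log 2 n).
Local Notation K0 := (2 * (n %/ M + 1) + d.+1 * lg).

Lemma pow_lg : n <= 2 ^ lg. Proof. exact: up_logP. Qed.

Lemma M_gt1 : 1 < M.
Proof. by rewrite -{1}(expn0 2) ltn_exp2l. Qed.

(** In [K0], the summand [2 * (n %/ M + 1)] pays for [(1 + 1/M)^n <= 4^(n %/ M + 1)], which comes
    from [four_pow]; the summand [d.+1 * lg] leaves the failure probability [n^-(d+1)]. *)
Lemma many_bound :
  #|[set r : {ffun 'I_n -> a.-tuple bool} | K0 <= #|[set v | selected (r v)]|]| * n ^ d.+1 <= M ^ n.
Proof.
set X := #|_|.
have M1 := M_gt1.
set u := n %/ M + 1.
have H1 : (M + 1) ^ n <= 4 ^ u * M ^ n.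
  have nu : n <= M * u by rewrite /u mulnDr muln1 {1}(divn_eq n M) mulnC leq_add2l ltnW // ltn_mod ltnW.
  have : (M + 1) ^ (M * u) <= 4 ^ u * M ^ (M * u).
    rewrite !expnM -expnMn leq_exp2r /u ?addn1 // -addn1.
    have -> : M = (2 ^ a.-1).*2 by rewrite -mul2n -expnS prednK.
    exact: four_pow.
  rewrite -(subnKC nu) (expnD (M + 1)) (expnD M) => H.
  have : (M + 1) ^ n * M ^ (M * u - n) <= (4 ^ u * M ^ n) * M ^ (M * u - n).
    rewrite -mulnA; apply: leq_trans H.
    rewrite leq_mul2l; case: (M * u - n) => [|z]; first by rewrite !expn0 orbT.
    by rewrite leq_exp2r ?leq_addr ?orbT.
  by rewrite leq_pmul2r // expn_gt0 ltnW.
have H2 := card_many n a K0; rewrite -/X in H2.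
have H3 : X * 2 ^ K0 <= 4 ^ u * M ^ n by apply: leq_trans H1.
rewrite -/u expnD (expnM 2 2 u) mulnA -[2 ^ 2]/4 in H3.
have H4 : X * 2 ^ (d.+1 * lg) <= M ^ n.
  by move: H3; rewrite -mulnA mulnCA leq_pmul2l // expn_gt0.
apply: leq_trans H4; rewrite leq_mul2l mulnC expnM leq_exp2r //.
by rewrite pow_lg orbT.
Qed.

(** By [half_pow], each of the [(d + 4) * lg] blocks of [M] vertices that make up [Q] is missed with
    probability at most 1/2. *)
Lemma avoid_bound (Q : {set 'I_n}) : #|Q| = (d + 4) * M * lg ->
  #|[set r : {ffun 'I_n -> a.-tuple bool} | [forall v in Q, ~~ selected (r v)]]| * n ^ (d + 4) <= M ^ n.
Proof.
move=> cQ; rewrite card_avoid.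
have M1 := M_gt1.
have Qn : #|Q| <= n by have := max_card Q; rewrite card_ord.
have H : (M - 1) ^ #|Q| * n ^ (d + 4) <= M ^ #|Q|.
  have -> : #|Q| = M * (lg * (d + 4)) by rewrite cQ; lia.
  rewrite !(expnM _ M).
  apply: (@leq_trans ((2 * (M - 1) ^ M) ^ (lg * (d + 4)))).
    rewrite expnMn mulnC leq_mul2r (expnM 2 lg) leq_exp2r ?pow_lg ?orbT //.
    by rewrite addn4.
  case: (posnP (lg * (d + 4))) => [->|p]; first by rewrite !expn0.
  by rewrite leq_exp2r // half_pow // ltnW.
have -> : M ^ n = M ^ #|Q| * M ^ (n - #|Q|) by rewrite -expnD subnKC.
rewrite mulnAC leq_mul2r H orbT //.
Qed.

(** Union bound: the at most [n^2 + n <= n^3] sets contribute [n^3 * n^-(d+4)], an excess of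
    landmarks [n^-(d+1)], and [2 * n^-(d+1) <= n^-d]. *)
Lemma hitting (F : seq {set 'I_n}) :
  size F <= n ^ 2 + n -> (forall Q, Q \in F -> #|Q| = (d + 4) * M * lg) ->
  exists Good : {set {ffun 'I_n -> a.-tuple bool}},
    #|~: Good| * n ^ d <= #|{ffun 'I_n -> a.-tuple bool}| /\
    forall r, r \in Good -> #|[set v | selected (r v)]| <= K0 /\
      forall Q, Q \in F -> exists2 v, v \in Q & selected (r v).
Proof.
move=> sF cF.
pose many := [set r : {ffun 'I_n -> a.-tuple bool} | K0 <= #|[set v | selected (r v)]|].
pose av (Q : {set 'I_n}) := [set r : {ffun 'I_n -> a.-tuple bool} | [forall v in Q, ~~ selected (r v)]].
exists (~: (many :|: \bigcup_(Q <- F) av Q)); split; last first.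
  move=> r; rewrite !inE negb_or -ltnNge => /andP [/ltnW -> H]; split=> // Q QF.
  have : r \notin av Q.
    by apply: contra H => H; rewrite (big_rem Q) //= inE H.
  by rewrite inE negb_forall_in => /exists_inP [v vQ]; rewrite negbK; exists v.
rewrite setCK card_omega.
have c1 : #|\bigcup_(Q <- F) av Q| * n ^ (d + 4) <= size F * M ^ n.
  elim: F cF {sF} => [_|Q F IH cF]; first by rewrite big_nil cards0.
  rewrite big_cons /= mulSn.
  apply: (@leq_trans ((#|av Q| + #|\bigcup_(Q <- F) av Q|) * n ^ (d + 4))).
    by rewrite leq_mul2r leq_card_setU orbT.
  rewrite mulnDl leq_add ?avoid_bound ?cF ?mem_head // IH // => Q' H.
  by apply: cF; rewrite inE H orbT.
have c2 : #|many :|: \bigcup_(Q <- F) av Q| <= #|many| + #|\bigcup_(Q <- F) av Q| by rewrite leq_card_setU.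
have c3 := many_bound; rewrite -/many in c3.
set x := #|_ :|: _| in c2 *; set y := #|many| in c2 c3; set z := #|\bigcup_(_ <- _) _| in c1 c2.
set T := M ^ n in c1 c3 *.
have c4 : z * n ^ d.+1 <= T.
  have : z * n ^ d.+1 * n ^ 3 <= T * n ^ 3.
    rewrite -mulnA -expnD addSnnS; apply: leq_trans c1 _; rewrite mulnC leq_mul2l.
    apply/orP; right; apply: leq_trans sF _; rewrite !expnS expn0; nia.
  by rewrite leq_pmul2r // expn_gt0 ltnW.
have : n * (x * n ^ d) <= n * T.
  move: c3 c4; rewrite !expnS; move: (n ^ d) => nd c3 c4.
  have : x * (n * nd) <= (y + z) * (n * nd) by rewrite leq_mul2r c2 orbT.
  nia.
by rewrite leq_pmul2l // ltnW.
Qed.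
End Hitting.

(** * Replacement paths *)

Section Walks.
Variable n : nat.
Implicit Types (e : rel 'I_n) (w : 'I_n -> 'I_n -> nat) (u v x : 'I_n) (q : seq 'I_n).

Lemma weight_nil w u : weight w u [::] = 0.
Proof. by rewrite /weight /= big_nil. Qed.

Lemma weight_cons w u x q : weight w u (x :: q) = w u x + weight w x q.
Proof. by rewrite /weight /= big_cons. Qed.

Lemma weight_cat w u q1 q2 : weight w u (q1 ++ q2) = weight w u q1 + weight w (last u q1) q2.
Proof.
elim: q1 u => [|x q IH] u /=; first by rewrite weight_nil.
by rewrite !weight_cons IH addnA.
Qed.

(** Since [c] is only an upper bound, estimates can be composed and relaxed freely. *)
Definition conn e w u v (c : nat) : Prop :=
  exists q, [/\ path e u q, last u q = v & weight w u q <= c].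

Lemma conn_refl e w u c : conn e w u u c.
Proof. by exists [::]; rewrite weight_nil. Qed.

Lemma conn_trans e w v u x c1 c2 : conn e w u v c1 -> conn e w v x c2 -> conn e w u x (c1 + c2).
Proof.
move=> [q1 [P1 L1 W1]] [q2 [P2 L2 W2]]; exists (q1 ++ q2).
by rewrite cat_path last_cat P1 L1 weight_cat L1 leq_add.
Qed.

Lemma conn_edge e w u v : e u v -> conn e w u v (w u v).
Proof. by move=> H; exists [:: v]; rewrite /= H weight_cons weight_nil addn0. Qed.

Lemma conn_le e w u v c1 c2 : c1 <= c2 -> conn e w u v c1 -> conn e w u v c2.
Proof. by move=> H [q [P L W]]; exists q; split=> //; apply: leq_trans W H. Qed.

Lemma conn_sub e e' w u v c : subrel e e' -> conn e w u v c -> conn e' w u v c.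
Proof. by move=> H [q [P L W]]; exists q; split=> //; apply: sub_path P. Qed.

Lemma min_walk e w u v : (exists q, path e u q /\ last u q = v) ->
  exists q, [/\ path e u q, last u q = v &
    forall q', path e u q' -> last u q' = v -> weight w u q <= weight w u q'].
Proof.
move=> [q0 [P0 L0]].
have ex : exists c, `[< exists q, [/\ path e u q, last u q = v & weight w u q = c] >].
  by exists (weight w u q0); apply/asboolP; exists q0.
case: (ex_minnP ex) => c /asboolP [q [P L W]] Hm.
exists q; split=> // q' P' L'; rewrite W; apply: Hm; apply/asboolP; by exists q'.
Qed.

(** A return to [u] would close a cycle of positive weight, and removing it gives a lighter walk
    with the same end. *)
Lemma min_uniq e w u q : (forall x y, e x y -> 0 < w x y) -> path e u q ->
  (forall q', path e u q' -> last u q' = last u q -> weight w u q <= weight w u q') ->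
  uniq (u :: q).
Proof.
move=> pos; elim: q u => [//|x q IH] u /= /andP [ux Pq] Hm.
apply/andP; split; last first.
  apply: IH => // q' P' L'; have := Hm (x :: q'); rewrite /= ux P' !weight_cons leq_add2l.
  by apply.
apply/negP => uq.
have [p1 [p2 E]] : exists p1 p2, x :: q = p1 ++ u :: p2.
  by case/splitPr: uq => p1 p2; exists p1, p2.
have Px : path e u (x :: q) by rewrite /= ux.
have Lx : last u p2 = last x q by rewrite -[RHS]/(last u (x :: q)) E last_cat.
rewrite E cat_path /= in Px; case/and3P: Px => P1 l1 P2.
have H := Hm p2 P2 Lx; rewrite E weight_cat weight_cons in H.
have := pos _ _ l1; lia.
Qed.

Lemma rev_walk e e' w w' u q : (forall x y, e x y -> e' y x /\ w' y x = w x y) -> path e u q ->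
  exists q', [/\ path e' (last u q) q', last (last u q) q' = u,
    size q' = size q, weight w' (last u q) q' = weight w u q &
    (forall x, x \in u :: q -> x \in last u q :: q')].
Proof.
move=> He; elim: q u => [|x q IH] u /=; first by move=> _; exists [::]; rewrite !weight_nil.
move=> /andP [ux /IH [q' [P L S W In]]]; have [He' Ew] := He _ _ ux.
exists (rcons q' u); rewrite rcons_path P L He' last_rcons size_rcons S -cats1 weight_cat L W.
rewrite !weight_cons weight_nil Ew addn0 addnC; split=> // y.
rewrite inE => /orP [/eqP ->|]; first by rewrite cats1 inE mem_rcons mem_head orbT.
by move=> /In; rewrite cats1 !inE mem_rcons inE => /orP [->|->]; rewrite ?orbT.
Qed.

Definition cdiv (a b : nat) : nat := (a + b.-1) %/ b.

Lemma cdiv_bounds a b : 0 < b -> a <= b * cdiv a b <= a + b.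
Proof.
move=> b0; rewrite /cdiv mulnC; have := divn_eq (a + b.-1) b; have := ltn_pmod (a + b.-1) b0.
move: (_ %% _) (_ %/ _ * _) => r x. lia.
Qed.

Lemma cdiv_gt0 a b : 0 < a -> 0 < b -> 0 < cdiv a b.
Proof. by move=> a0 b0; rewrite /cdiv divn_gt0 //; lia. Qed.

Definition rw w b : 'I_n -> 'I_n -> nat := fun x y => cdiv (w x y) b.

Lemma rw_bounds w b u q : 0 < b ->
  weight w u q <= b * weight (rw w b) u q <= weight w u q + b * size q.
Proof.
move=> b0; elim: q u => [|x q IH] u /=; first by rewrite !weight_nil ?muln0.
rewrite !weight_cons mulnDr mulnS; have := IH x; have := cdiv_bounds (w u x) b0; rewrite -/(rw w b u x).
lia.
Qed.

Lemma rw1 w u q : weight (rw w 1) u q = weight w u q.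
Proof.
elim: q u => [|x q IH] u; first by rewrite !weight_nil.
by rewrite !weight_cons IH /rw /cdiv divn1 addn0.
Qed.

(** Take [2^i] about [W / (k h)]. Rounding adds at most [2^i] per hop, hence at most
    [2^i * h <= W / k] in total, and the rounded length is at most [(2 k + 1) h]. Walks with
    [W < k * h] are left unrounded, with [i = 0]. *)
Lemma scale w u q k h S : 0 < k -> size q <= h -> weight w u q < 2 ^ S ->
  exists2 i, i < S.+1 & weight (rw w (2 ^ i)) u q <= (k.*2 + 1) * h /\
    k * (2 ^ i * weight (rw w (2 ^ i)) u q) <= k.+1 * weight w u q.
Proof.
move=> k0 sq wS; set W := weight w u q in wS *.
have [lt|ge] := ltnP W (k * h).
  exists 0 => //; rewrite expn0 rw1 -/W mul1n leq_mul2r leqnSn orbT; split=> //.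
  apply: leq_trans (ltnW lt) _; rewrite leq_mul2r; apply/orP; right; rewrite -addnn -addnA; exact: leq_addr.
have [h0|h0] := posnP h.
  have q0 : q = [::] by apply/nilP; rewrite /nilp -leqn0 -h0.
  by exists 0 => //; rewrite /W q0 !weight_nil !muln0.
have kh : 0 < k * h by rewrite muln_gt0 k0.
pose i := trunc_log 2 (W %/ (k * h)).
have d0 : 0 < W %/ (k * h) by rewrite divn_gt0.
have /andP [l1 l2] := trunc_log_bounds (isT : 1 < 2) d0; rewrite -/i in l1 l2.
have i1 : 2 ^ i * (k * h) <= W by rewrite -leq_divRL.
have i2 : W < 2 ^ i.+1 * (k * h) by rewrite -ltn_divLR.
have p0 : 0 < 2 ^ i by rewrite expn_gt0.
exists i.
  rewrite ltnS -(leq_exp2l (m := 2)) //; apply: leq_trans (ltnW wS).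
  by apply: leq_trans i1; rewrite leq_pmulr.
have := rw_bounds w u q p0; rewrite -/W; set R := weight _ _ q.
have := leq_mul (leqnn (2 ^ i)) sq.
rewrite expnS in i2; move: (2 ^ i) p0 i1 i2 => b p0 i1 i2 bq /andP [_ r].
have r' : b * R <= W + b * h by lia.
split; last by nia.
have : b * R < b * ((k.*2 + 1) * h + 1) by nia.
by rewrite ltn_pmul2l // addn1 ltnS.
Qed.
End Walks.

(** * Replacement paths as detours off a shortest path *)

Section PathGraph.
Variables (n : nat) (E : rel 'I_n) (w : 'I_n -> 'I_n -> nat) (s t : 'I_n) (p : seq 'I_n).
Hypothesis wpos : forall u v, E u v -> 0 < w u v.
Hypothesis SP : shortest_path E w s t p.
Local Notation P := (s :: p).

Definition vt i := nth s P i.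
Definition pre a := weight w s (take a p).
Definition suf b := weight w (vt b) (drop b p).
Arguments vt : simpl never.
Arguments pre : simpl never.
Arguments suf : simpl never.
Definition offP : rel 'I_n := fun u v => E u v && ~~ onP P u v.

Lemma last_take a : a <= size p -> last s (take a p) = vt a.
Proof.
rewrite /vt; case: a => [|a] H; first by rewrite take0.
by rewrite (take_nth s H) last_rcons.
Qed.

Lemma vt_last : vt (size p) = t.
Proof. by rewrite -last_take // take_size; case: SP. Qed.

Lemma pre_suf a : a <= size p -> pre a + suf a = weight w s p.
Proof. by move=> H; rewrite /pre /suf -(last_take H) -weight_cat cat_take_drop. Qed.

Lemma path_take a : path E s (take a p).
Proof. by have [H _ _] := SP; rewrite -(cat_take_drop a p) cat_path in H; case/andP: H. Qed.

Lemma path_drop a : a <= size p -> path E (vt a) (drop a p).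
Proof.
move=> Ha; have [H _ _] := SP; rewrite -(cat_take_drop a p) cat_path last_take // in H.
by case/andP: H.
Qed.

Lemma last_drop a : a <= size p -> last (vt a) (drop a p) = t.
Proof.
by move=> Ha; have [_ H _] := SP; rewrite -(last_take Ha) -last_cat cat_take_drop.
Qed.

Lemma pre_min a c : a <= size p -> conn E w s (vt a) c -> pre a <= c.
Proof.
move=> Ha [q [Pq Lq Wq]]; apply: leq_trans Wq.
have [_ _ /(_ (q ++ drop a p))] := SP.
rewrite cat_path last_cat Pq Lq path_drop // last_drop // weight_cat Lq => /(_ isT erefl).
by rewrite -(pre_suf Ha) leq_add2r.
Qed.

Lemma suf_min b c : b <= size p -> conn E w (vt b) t c -> suf b <= c.
Proof.
move=> Hb [q [Pq Lq Wq]]; apply: leq_trans Wq.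
have [_ _ /(_ (take b p ++ q))] := SP.
rewrite cat_path last_cat path_take last_take // Pq Lq weight_cat last_take // => /(_ isT erefl).
by rewrite -(pre_suf Hb) leq_add2l.
Qed.

Lemma shortest_uniq : uniq P.
Proof. by have [H L M] := SP; apply: (min_uniq wpos H) => q Pq Lq; apply: M; rewrite // Lq. Qed.

Lemma vt_inj i j : i <= size p -> j <= size p -> vt i = vt j -> i = j.
Proof. by move=> Hi Hj /eqP; rewrite /vt nth_uniq ?shortest_uniq // => /eqP. Qed.

Lemma vt_edge i : i < size p -> E (vt i) (vt i.+1).
Proof.
move=> Hi; have [H _ _] := SP; move/(pathP s): H => /(_ i Hi).
by rewrite /vt.
Qed.

Lemma onPP u v : reflect (exists2 i, i < size p & u = vt i /\ v = vt i.+1) (onP P u v).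
Proof.
apply: (iffP hasP) => [[i]|[i Hi [-> ->]]].
  rewrite mem_iota /= add0n => Hi /andP [/eqP e1 /eqP e2]; exists i => //.
  by split; [rewrite -{1}e1|rewrite -{1}e2]; apply: set_nth_default; rewrite /=; lia.
exists i; first by rewrite mem_iota.
apply/andP; split; apply/eqP; apply: set_nth_default; by rewrite /=; lia.
Qed.

Lemma pre_S a : a < size p -> pre a.+1 = pre a + w (vt a) (vt a.+1).
Proof.
move=> Ha; rewrite /pre (take_nth s Ha) -cats1 weight_cat last_take 1?ltnW //.
by rewrite weight_cons weight_nil addn0.
Qed.

Lemma suf_S b : b < size p -> suf b = w (vt b) (vt b.+1) + suf b.+1.
Proof. by move=> Hb; have := pre_suf Hb; have := pre_suf (ltnW Hb); rewrite pre_S //; lia. Qed.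

Lemma Eminus_vt i j : i < size p -> j < size p -> i != j -> Eminus E (vt i) (vt i.+1) (vt j) (vt j.+1).
Proof.
move=> Hi Hj ij; rewrite /Eminus vt_edge //=; apply/negP => /andP [/eqP e _].
by rewrite (vt_inj (ltnW Hj) (ltnW Hi) e) eqxx in ij.
Qed.

Lemma offP_Eminus i : i < size p -> subrel offP (Eminus E (vt i) (vt i.+1)).
Proof.
move=> Hi u v /andP [uv nP]; rewrite /Eminus uv; apply: contra nP => /andP [/eqP -> /eqP ->].
by apply/onPP; exists i.
Qed.

Lemma conn_prefix i a : i < size p -> a <= i -> conn (Eminus E (vt i) (vt i.+1)) w s (vt a) (pre a).
Proof.
move=> Hi; elim: a => [|a IH] Ha; first exact: conn_refl.
rewrite pre_S; last by lia.
apply: conn_trans (IH (ltnW Ha)) _; apply: conn_edge; apply: Eminus_vt; lia.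
Qed.

Lemma conn_suffix i b : i < b -> b <= size p -> conn (Eminus E (vt i) (vt i.+1)) w (vt b) t (suf b).
Proof.
move=> ib Hb; rewrite -(subKn Hb); move: (leq_subr b (size p)).
have : i < size p - (size p - b) by rewrite subKn.
elim: (size p - b) => [|k IH] H1 H2.
  by rewrite subn0 vt_last; apply: conn_refl.
rewrite suf_S; last by lia.
have -> : (size p - k.+1).+1 = size p - k by lia.
apply: conn_trans (IH _ _); try lia.
have -> : size p - k = (size p - k.+1).+1 by lia.
by apply: conn_edge; apply: Eminus_vt; lia.
Qed.

Lemma pre0 : pre 0 = 0. Proof. by rewrite /pre take0 weight_nil. Qed.

Lemma detour_sound i a b c : a <= i < b -> b <= size p ->
  conn offP w (vt a) (vt b) c -> conn (Eminus E (vt i) (vt i.+1)) w s t (pre a + c + suf b).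
Proof.
move=> /andP [ai ib] Hb H; have Hi : i < size p by lia.
apply: conn_trans (conn_suffix ib Hb); apply: conn_trans (conn_prefix Hi ai) _.
by apply: conn_sub H; apply: offP_Eminus.
Qed.

(* Invariant: the walk up to [x] is dominated by [P] up to [vt a], followed by a walk off [P]. *)
Lemma detour_exists i q : i < size p -> path (Eminus E (vt i) (vt i.+1)) s q -> last s q = t ->
  exists a b c, [/\ a <= i < b, b <= size p, conn offP w (vt a) (vt b) c &
    pre a + c + suf b <= weight w s q].
Proof.
move=> Hi.
suff K x a c : path (Eminus E (vt i) (vt i.+1)) x q -> last x q = t -> a <= i ->
    conn offP w (vt a) x c ->
    exists a' b c', [/\ a' <= i < b, b <= size p, conn offP w (vt a') (vt b) c' &
      pre a' + c' + suf b <= pre a + c + weight w x q].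
  move=> Pq Lq; have [a [b [c H]]] := K s 0 0 Pq Lq isT (conn_refl _ _ _ _).
  by exists a, b, c; rewrite pre0 in H.
elim: q x a c => [|y q IH] x a c.
  move=> _ /= -> ai H; exists a, (size p), c; rewrite vt_last ai Hi; split=> //.
  by rewrite /suf drop_size weight_nil leq_add2l.
rewrite [path _ _ _]/= => /andP [xy Pq] Lq ai H.
have Exy : E x y by case/andP: xy.
have PE : path E x (y :: q) by rewrite /= Exy; apply: sub_path Pq => u v /andP [].
have CE : conn E w s x (pre a + c).
  apply: conn_trans (conn_sub _ H); last by move=> u v /andP [].
  by exists (take a p); rewrite path_take last_take //; lia.
(* [step] follows one edge after the invariant has been renormalised: if [x] lies on [P], then [a']
   is its position, so an edge of [P] leads to the next position with nothing walked off [P]. *)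
have step a' c' : a' <= i -> conn offP w (vt a') x c' -> pre a' + c' <= pre a + c ->
    (forall j, j <= size p -> x = vt j -> j <= i /\ a' = j) ->
    exists a0 b0 c0, [/\ a0 <= i < b0, b0 <= size p, conn offP w (vt a0) (vt b0) c0 &
      pre a0 + c0 + suf b0 <= pre a + c + weight w x (y :: q)].
  move=> a'i H' le xP; rewrite weight_cons.
  have [on|off] := boolP (onP P x y).
    case/onPP: on => k Hk [xk yk].
    have [ki ak] := xP k (ltnW Hk) xk.
    have ne : k != i.
      by apply/eqP => e; move: xy; rewrite xk yk e /Eminus !eqxx andbF.
    have ki' : k < i by rewrite ltn_neqAle ne.
    have [a0 [b0 [c0 [h1 h2 h3 h4]]]] := IH y k.+1 0 Pq Lq ki' (eq_ind_r (fun z => conn _ _ _ z _) (conn_refl _ _ _ _) yk).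
    exists a0, b0, c0; split=> //; apply: leq_trans h4 _.
    rewrite pre_S // -xk -yk -ak; lia.
  have H2 : conn offP w (vt a') y (c' + w x y).
    by apply: conn_trans H' (conn_edge _ _); rewrite /offP Exy off.
  have [a0 [b0 [c0 [h1 h2 h3 h4]]]] := IH y a' _ Pq Lq a'i H2.
  by exists a0, b0, c0; split=> //; apply: leq_trans h4 _; lia.
have [/(nthP s) [j Hj xj]|nP] := boolP (x \in P); last first.
  apply: (step a c) => // j Hj xj; case/negP: nP; rewrite xj; exact: mem_nth.
rewrite ltnS in Hj.
(* At a vertex of [P] up to position [i], the walk so far is exchanged for the prefix of [P], which
   is no longer. Beyond [i] the detour is complete and the rest of the walk is exchanged for the
   suffix. *)
have [ji|ij] := leqP j i.
  apply: (step j 0) => //; first by rewrite /vt xj; apply: conn_refl.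
    by rewrite addn0; apply: pre_min => //; rewrite /vt xj.
  move=> j' Hj' e; have -> : j' = j by apply: vt_inj => //; rewrite -e /vt xj.
  by [].
exists a, j, c; rewrite ai ij /vt xj; split=> //.
rewrite leq_add2l; apply: suf_min => //; exists (y :: q); by rewrite /vt xj.
Qed.

(** The part off [P] is replaced by a cheapest one to make it simple: it then has fewer than [n]
    hops, and [h] consecutive vertices of it form a set of [h] elements that the sample can hit. *)
Lemma replacement i : i < size p ->
  no_rpath E s t (vt i) (vt i.+1) \/
  exists L a b q, [/\ is_rdist E w s t (vt i) (vt i.+1) L, (a <= i < b) && (b <= size p),
    path offP (vt a) q /\ last (vt a) q = vt b, uniq (vt a :: q) &
    pre a + weight w (vt a) q + suf b <= L].
Proof.
move=> Hi.
have [ex|nex] := pselect (exists q, path (Eminus E (vt i) (vt i.+1)) s q /\ last s q = t); last first.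
  by left=> q Pq Lq; apply: nex; exists q.
right; have [q [Pq Lq Mq]] := min_walk w ex.
have [a [b [c [ab Hb [q1 [P1 L1 W1]] le]]]] := detour_exists Hi Pq Lq.
have ex1 : exists q, path offP (vt a) q /\ last (vt a) q = vt b by exists q1.
have [q2 [P2 L2 M2]] := min_walk w ex1.
exists (weight w s q), a, b, q2; split=> //.
- by split=> //; exists q.
- by lia.
- apply: (min_uniq (e := offP) (w := w)) => //; first by move=> u v /andP [/wpos].
  by move=> q' Pq' Lq'; apply: M2; rewrite // Lq'.
- have := M2 _ P1 L1; lia.
Qed.

End PathGraph.

(** * Broadcast *)

Section Flood.
Variables (n N L : nat).

(** A state holds the items known and the items already forwarded. *)
Definition fl_new (st : seq (seq nat) * seq (seq nat)) := [seq x <- st.1 | x \notin st.2].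
Definition fl_init (own : seq (seq nat)) : seq (seq nat) * seq (seq nat) := (own, [::]).
(** The leading 1 distinguishes an item from the idle message, so that all messages have the same
    length. *)
Definition fl_msg (own : seq (seq nat)) (st : seq (seq nat) * seq (seq nat)) :=
  if fl_new st is x :: _ then 1 :: x else nseq L.+1 0.
Definition fl_upd (own : seq (seq nat)) (st : seq (seq nat) * seq (seq nat))
    (ib : nat -> option (NbrInfo * seq nat)) :=
  (st.1 ++ nlist N ib (fun _ y => if head 0 y == 1 then [:: behead y] else [::]),
   if fl_new st is x :: _ then x :: st.2 else st.2).

Variables (I : inst n) (xi : 'I_n -> seq (seq nat)).
Hypothesis inj : injective (gid I).
Hypothesis idN : forall v, gid I v < N.
Local Notation fl := (prun fl_init fl_msg fl_upd I xi).

Lemma fl_sent_known k v : {subset (fl k v).2 <= (fl k v).1}.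
Proof.
elim: k v => [//|k IH] v x /=; rewrite mem_cat.
case E: (fl_new _) => [|y l]; first by move=> /IH ->.
rewrite inE => /orP [/eqP ->|/IH -> //].
have : y \in fl_new (fl k v) by rewrite E mem_head.
by rewrite mem_filter => /andP [_ ->].
Qed.

Lemma fl_sent_uniq k v : uniq (fl k v).2.
Proof.
elim: k => [//|k IH] /=.
case E: (fl_new _) => [//|y l] /=; rewrite IH andbT.
have : y \in fl_new (fl k v) by rewrite E mem_head.
by rewrite mem_filter => /andP [].
Qed.

Lemma fl_msgP k u x : x \in (if head 0 (fl_msg (xi u) (fl k u)) == 1
    then [:: behead (fl_msg (xi u) (fl k u))] else [::]) <-> ohead (fl_new (fl k u)) = Some x.
Proof.
rewrite /fl_msg; case: (fl_new _) => [|y l] /=; first by [].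
rewrite inE; split; [by move=> /eqP ->|by case=> ->].
Qed.

Lemma fl_known_step k v x : x \in (fl k.+1 v).1 <->
  x \in (fl k v).1 \/ exists2 u, adj (gE I) v u & ohead (fl_new (fl k u)) = Some x.
Proof.
rewrite /= mem_cat; split.
  move=> /orP [->|]; first by left.
  by rewrite nlistP // => -[u a /fl_msgP H]; right; exists u.
move=> [->//|[u a H]]; apply/orP; right; rewrite nlistP //; exists u => //.
by apply/fl_msgP.
Qed.

Lemma fl_sound k v x : x \in (fl k v).1 -> exists u, x \in xi u.
Proof.
elim: k v => [|k IH] v; first by exists v.
move=> /fl_known_step [/IH //|[u _]].
case E: (fl_new _) => [//|y l] [yx]; apply: (IH u); rewrite -yx.
have : y \in fl_new (fl k u) by rewrite E mem_head.
by rewrite mem_filter => /andP [].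
Qed.

Lemma fl_known_mono k v : {subset (fl k v).1 <= (fl k.+1 v).1}.
Proof. by move=> x H; apply/fl_known_step; left. Qed.

Lemma fl_own k v : {subset xi v <= (fl k v).1}.
Proof. elim: k => [//|k IH] x H; exact/fl_known_mono/IH. Qed.

Lemma fl_sent_nbr k v u : adj (gE I) v u -> {subset (fl k u).2 <= (fl k v).1}.
Proof.
move=> a; elim: k => [//|k IH] x H; apply/fl_known_step; move: H => /=.
case E: (fl_new _) => [|y l]; first by move=> /IH; left.
rewrite inE => /orP [/eqP ->|/IH]; last by left.
by right; exists u => //; rewrite E.
Qed.

(* A vertex forwards a new item in every round until it has forwarded everything
   that originates in its ball of radius [d]. *)
Lemma fl_progress k d v : k - d <= size (fl k v).2 \/
  forall u, within (gE I) d v u -> {subset xi u <= (fl k v).2}.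
Proof.
elim: k d v => [|k IH] d v; first by left.
have [dk|kd] := ltnP k d; first by left; have -> : k.+1 - d = 0 by lia.
have [lt|H] := IH d v; last first.
  right=> u /H S x /S /=; case: (fl_new _) => // y l; by rewrite inE orbC => ->.
rewrite /=; case E: (fl_new _) => [|y l]; last by left; rewrite /= subSn.
have S : {subset (fl k v).1 <= (fl k v).2}.
  move=> x Hx; apply: contraT => Hn.
  suff : x \in fl_new (fl k v) by rewrite E.
  by rewrite mem_filter Hn.
have [le|gt] := leqP (k.+1 - d) (size (fl k v).2); first by left.
right=> u [[|z q] [Pq Lq Sq]]; first by rewrite /= in Lq; rewrite -Lq => x Hx; apply/S/fl_own.
case: d Sq kd lt gt => [//|d] Sq kd lt gt.
move: Pq => /= /andP [vz Pq].
(* Being idle, [v] has forwarded everything that its neighbour [z] has sent; if [z] had sent [k - d]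
   items, so would have [v], against [gt]. *)
have [H|H] := IH d z.
  have le := uniq_leq_size (fl_sent_uniq k z) (fun x Hx => S x (fl_sent_nbr vz Hx)).
  by have := leq_trans H le; rewrite leqNgt -subSS gt.
move=> x Hx; apply/S/(fl_sent_nbr vz)/(H u) => //; by exists q.
Qed.

(** Items forwarded by [v] are distinct elements of [U]; after more than [KK + dia] rounds the count
    in [fl_progress] is impossible, so its other alternative holds, for the whole graph. *)
Lemma flood KK dia k v (U : seq (seq nat)) :
  (forall u, {subset xi u <= U}) -> size U <= KK ->
  (forall u v, within (gE I) dia u v) -> KK + dia < k ->
  forall x, x \in (fl k v).1 <-> exists u, x \in xi u.
Proof.
move=> HU sU W Hk x; split; first exact: fl_sound.
move=> [u Hx]; apply: fl_sent_known.
have [H|H] := fl_progress k dia v; last by apply: (H u).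
have S : {subset (fl k v).2 <= U} by move=> y /fl_sent_known /fl_sound [z] /HU.
have := leq_trans (leq_trans H (uniq_leq_size (fl_sent_uniq k v) S)) sU.
by rewrite leq_subLR leqNgt addnC Hk.
Qed.

Lemma fl_wf B k v : (forall u x, x \in xi u -> size x = L /\ all (fun y => y < n ^ B) x) ->
  1 < n ^ B -> size (fl_msg (xi v) (fl k v)) = L.+1 /\
    all (fun y => y < n ^ B) (fl_msg (xi v) (fl k v)).
Proof.
move=> H n1; rewrite /fl_msg; case E: (fl_new _) => [|y l].
  by rewrite size_nseq; split=> //; rewrite all_nseq orbC ltnW.
have : y \in fl_new (fl k v) by rewrite E mem_head.
rewrite mem_filter => /andP [_ /fl_sound [u /H [S A]]].
by rewrite /= S n1.
Qed.
End Flood.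

(** * Source detection *)

Section SourceDetection.
Variables (n N H : nat) (len : NbrInfo -> option nat).

Definition lp_state := ((nat -> nat) * (nat -> nat))%type.
(* [st.1 j] is the current distance estimate to source [j] and [st.2 j] the last one sent ([H.+1] if none); a pair (distance, source) is encoded as [x * N + j], so that the order of nat is lexicographic. *)
Definition lp_key (st : lp_state) : nat :=
  lmin (H.+1 * N) [seq st.1 j * N + j | j <- iota 0 N & st.1 j < st.2 j].
Definition lp_init (y : bool * nat) : lp_state :=
  (fun j => if y.1 && (j == y.2) then 0 else H.+1, fun=> H.+1).
Definition lp_msg (y : bool * nat) (st : lp_state) : seq nat :=
  if lp_key st < H.+1 * N then [:: 1; lp_key st %/ N; lp_key st %% N] else [:: 0; 0; 0].
Definition lp_upd (y : bool * nat) (st : lp_state) (ib : nat -> option (NbrInfo * seq nat)) : lp_state :=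
  (fun j => lmin (st.1 j) (nlist N ib (fun f y =>
     if (nth 0 y 0 == 1) && (nth 0 y 2 == j) then
       if len f is Some l then [:: nth 0 y 1 + l] else [::] else [::])),
   fun j => if (lp_key st < H.+1 * N) && (lp_key st %% N == j) then lp_key st %/ N else st.2 j).

Variables (I : inst n) (xi : 'I_n -> bool * nat) (ge : rel 'I_n) (ew : 'I_n -> 'I_n -> nat).
Hypothesis inj : injective (gid I).
Hypothesis idN : forall v, gid I v < N.
Hypothesis xi_id : forall v, (xi v).2 = gid I v.
Hypothesis lenP : forall v u, adj (gE I) v u -> len (link I v u) = if ge v u then Some (ew v u) else None.
Hypothesis ge_adj : forall v u, ge v u -> adj (gE I) v u.
Hypothesis ew_pos : forall v u, ge v u -> 0 < ew v u.
Local Notation lp := (prun lp_init lp_msg lp_upd I xi).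
Local Notation lm v := (xi v).1.
Local Notation id := (gid I).

Definition walk_length j v d : Prop :=
  exists q, [/\ path ge v q, lm (last v q), id (last v q) = j & weight ew v q = d].

Lemma lp_keyP st : (forall j, st.1 j <= H.+1) -> (forall j, st.2 j <= H.+1) -> lp_key st < H.+1 * N ->
  let j := lp_key st %% N in
  [/\ j < N, lp_key st %/ N = st.1 j & st.1 j < st.2 j].
Proof.
move=> b1 b2 /lmin_mem; rewrite -/(lp_key st) => /mapP [j].
rewrite mem_filter mem_iota add0n => /and3P [lt _ jN] ->.
by rewrite modnMDl modn_small // divnMDl ?divn_small ?addn0 //; lia.
Qed.

Lemma lp_key_le st j : j < N -> st.1 j < st.2 j -> lp_key st <= st.1 j * N + j.
Proof.
move=> jN lt; apply: lmin_le; apply/mapP; exists j => //.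
by rewrite mem_filter lt mem_iota.
Qed.

Lemma lp_est_S k v j : (lp k.+1 v).1 j <= (lp k v).1 j.
Proof. exact: lmin_top. Qed.

Lemma lp_est_mono k k' v j : k <= k' -> (lp k' v).1 j <= (lp k v).1 j.
Proof.
move=> /subnKC <-; elim: (k' - k) => [|i IH]; first by rewrite addn0.
by rewrite addnS; apply: leq_trans (lp_est_S _ _ _) IH.
Qed.

Lemma lp_est_bound k v j : (lp k v).1 j <= H.+1.
Proof. by apply: leq_trans (lp_est_mono _ _ (leq0n k)) _; rewrite /=; case: ifP. Qed.

Lemma lp_snt_bound k v j : (lp k v).2 j <= H.+1.
Proof.
elim: k j => [//|k IH] j; rewrite [(lp _ _).2 _]/=; case: ifP => // /andP [lt _].
have [_ -> _] := lp_keyP (lp_est_bound k v) IH lt; exact: lp_est_bound.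
Qed.

Lemma lp_keyP' k v (st := lp k v) : lp_key st < H.+1 * N ->
  let j := lp_key st %% N in [/\ j < N, lp_key st %/ N = st.1 j & st.1 j < st.2 j].
Proof. by apply: lp_keyP; [apply: lp_est_bound|apply: lp_snt_bound]. Qed.

Lemma lp_snt_S k v j : (lp k.+1 v).2 j <= (lp k v).2 j.
Proof.
rewrite [(lp k.+1 _).2 _]/=; case: ifP => // /andP [/lp_keyP' [_ -> lt] /eqP e].
by rewrite e in lt *; apply: ltnW.
Qed.

Lemma lp_snt_mono k k' v j : k <= k' -> (lp k' v).2 j <= (lp k v).2 j.
Proof.
move=> /subnKC <-; elim: (k' - k) => [|i IH]; first by rewrite addn0.
by rewrite addnS; apply: leq_trans (lp_snt_S _ _ _) IH.
Qed.

Lemma lp_est_snt k v j : (lp k v).1 j <= (lp k v).2 j.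
Proof.
elim: k => [|k IH]; first by rewrite /=; case: ifP.
apply: leq_trans (lp_est_S _ _ _) _.
rewrite [(lp _ _).2 _]/=; case: ifP => // /andP [/lp_keyP' [_ -> _] /eqP ->]; exact: leqnn.
Qed.

Lemma lp_msg_flag y st j : (nth 0 (lp_msg y st) 0 == 1) && (nth 0 (lp_msg y st) 2 == j) =
  (lp_key st < H.+1 * N) && (lp_key st %% N == j).
Proof. by rewrite /lp_msg; case: (lp_key st < H.+1 * N). Qed.

Lemma lp_msg_val y st : lp_key st < H.+1 * N -> nth 0 (lp_msg y st) 1 = lp_key st %/ N.
Proof. by rewrite /lp_msg => ->. Qed.

Lemma lp_recv k v j : (lp k.+1 v).1 j < (lp k v).1 j ->
  exists u, [/\ ge v u, lp_key (lp k u) < H.+1 * N, lp_key (lp k u) %% N = j &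
    (lp k.+1 v).1 j = lp_key (lp k u) %/ N + ew v u].
Proof.
rewrite [(lp k.+1 _).1 _]/= => /lmin_mem; rewrite nlistP // => -[u a].
rewrite lp_msg_flag; case: ifP => // /andP [lt /eqP e].
rewrite lenP //; case: ifP => // g; rewrite inE lp_msg_val // => /eqP E; by exists u.
Qed.

Lemma lp_sent k v u j : ge v u -> lp_key (lp k u) < H.+1 * N -> lp_key (lp k u) %% N = j ->
  (lp k.+1 v).1 j <= lp_key (lp k u) %/ N + ew v u.
Proof.
move=> g lt e; rewrite [(lp k.+1 _).1 _]/=; apply: lmin_le; rewrite nlistP //.
exists u; first exact: ge_adj.
by rewrite lp_msg_flag lt e eqxx lenP ?ge_adj // g lp_msg_val // mem_head.
Qed.

Lemma lp_sound k v j : (lp k v).1 j <= H -> walk_length j v ((lp k v).1 j).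
Proof.
elim: k v j => [|k IH] v j.
  rewrite /=; case: ifP => [/andP [l /eqP ->] _|_]; last by rewrite ltnn.
  by exists [::]; rewrite /= weight_nil -xi_id.
have := lp_est_S k v j; rewrite leq_eqVlt => /orP [/eqP -> /IH //|/lp_recv [u [g lt e E]]].
rewrite E => le; have [_ Ed _] := lp_keyP' lt; rewrite e in Ed.
have [|q [Pq lq iq wq]] := IH u j; first by rewrite -Ed; lia.
exists (u :: q); rewrite /= g; split=> //.
by rewrite weight_cons wq Ed addnC.
Qed.

(** The message with which [u] updates its sent value reaches [v] in the same round. *)
Lemma lp_nbr k v u j : ge v u -> (lp k v).1 j <= (lp k u).2 j + ew v u.
Proof.
move=> g; elim: k => [|k IH].
  by apply: leq_trans (lp_est_bound 0 v j) _; rewrite /= leq_addr.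
rewrite [(lp k.+1 u).2 _]/=; case: ifP => [/andP [lt /eqP e]|_]; first exact: lp_sent.
exact: leq_trans (lp_est_S _ _ _) IH.
Qed.

Definition isd j v d : Prop := walk_length j v d /\ forall d', walk_length j v d' -> d <= d'.

Lemma isd_ex j v d : walk_length j v d -> exists2 d', isd j v d' & d' <= d.
Proof.
move=> W; have ex : exists d, `[< walk_length j v d >] by exists d; apply/asboolP.
case: (ex_minnP ex) => d' /asboolP W' M; exists d'; last by apply: M; apply/asboolP.
by split=> // d'' W''; apply: M; apply/asboolP.
Qed.

Lemma LW_lt j v d : walk_length j v d -> j < N.
Proof. by case=> q [_ _ <- _]. Qed.

(** The landmarks whose pair (distance, identifier) at [v] precedes [(d, j)]; the cardinality is the
    rank of that pair in the pipeline. *)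
Definition lp_below v d j := [set l | lm l & `[< exists d', isd (id l) v d' /\ d' * N + id l < d * N + j >]].

(** Take the next vertex on a shortest walk. A landmark ahead of [j] at [u] is also ahead at [v],
    since its distance grows by at most [ew v u]; so the rank does not increase towards the
    source. *)
Lemma lp_pred j v d : isd j v d -> 0 < d -> exists u, [/\ ge v u, ew v u <= d,
  isd j u (d - ew v u) & lp_below u (d - ew v u) j \subset lp_below v d j].
Proof.
move=> [[[|u q] [Pq lq iq wq]] M] d0; first by rewrite weight_nil in wq; lia.
move: Pq => /= /andP [g Pq]; rewrite weight_cons in wq; exists u.
have ext j' d' : walk_length j' u d' -> walk_length j' v (ew v u + d').
  by move=> [q' [P' l' i' w']]; exists (u :: q'); rewrite /= g weight_cons w'.
split=> //; first by lia.
  split; first by exists q; split=> //; lia.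
  by move=> d' /ext /M; lia.
apply/subsetP => l; rewrite !inE => /andP [-> /asboolP [d' [[W' M'] lt]]] /=.
apply/asboolP; have [d'' i'' le''] := isd_ex (ext _ _ W').
exists d''; split=> //.
have : d'' * N <= (ew v u + d') * N by rewrite leq_mul2r le'' orbT.
have : (d - ew v u) * N + ew v u * N = d * N by rewrite -mulnDl subnK //; lia.
rewrite mulnDl; lia.
Qed.

(* A minimal pair [(d, j)] is forwarded after at most [d] plus its rank rounds. *)
Lemma lp_progress sz v j d : isd j v d -> d <= H -> d + #|lp_below v d j| <= sz ->
  (lp sz v).1 j = d /\ (lp sz.+1 v).2 j = d.
Proof.
elim/ltn_ind: sz v j d => sz IH v j d D dH le.
have [W M] := D; have jN := LW_lt W.
have low k : (lp k v).1 j >= d.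
  have [l|l] := leqP ((lp k v).1 j) H; first exact/M/lp_sound.
  exact: leq_trans (leqW dH) l.
have est : (lp sz v).1 j = d.
  apply/eqP; rewrite eqn_leq low andbT.
  have [d0|d0] := posnP d.
    move: W; rewrite d0 => -[[|u q] [Pq lq iq wq]].
      apply: leq_trans (lp_est_mono _ _ (leq0n sz)) _.
      by rewrite /= in lq iq *; rewrite lq xi_id iq eqxx.
    move: Pq => /= /andP [/ew_pos g _]; rewrite weight_cons in wq; lia.
  have [u [g ed Du sub]] := lp_pred D d0.
  have c := subset_leq_card sub; have g0 := ew_pos g.
  have lt : (d - ew v u) + #|lp_below u (d - ew v u) j| < sz by lia.
  have [||_ Eu] := IH _ lt u j _ Du; [lia|exact: leqnn|].
  apply: leq_trans (lp_nbr sz j g) _.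
  have := lp_snt_mono u j lt; rewrite Eu; lia.
split=> //.
have [e|ne] := eqVneq ((lp sz v).2 j) d.
  apply/eqP; rewrite eqn_leq -{1}e lp_snt_S /=.
  exact: leq_trans (low sz.+1) (lp_est_snt _ _ _).
have lts : (lp sz v).1 j < (lp sz v).2 j.
  by rewrite ltn_neqAle lp_est_snt est andbT eq_sym.
have kle := lp_key_le jN lts; rewrite est in kle.
have kB : lp_key (lp sz v) < H.+1 * N.
  apply: leq_ltn_trans kle _; apply: (@leq_trans (d * N + N)); first by rewrite ltn_add2l.
  by rewrite -mulSnr leq_mul2r ltnS dH orbT.
have [j'N E' lt'] := lp_keyP' kB.
rewrite [(lp sz.+1 v).2 _]/= kB /=; case: eqP => [e|/eqP ne']; first by rewrite E' e est.
(* Suppose another pair is sent instead. It is smaller, so the true distance of its source is at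
   most [d] and has smaller rank; by induction that distance was sent earlier, and nothing about
   this source is pending. *)
exfalso.
set j' := lp_key (lp sz v) %% N in j'N E' lt' ne'.
have kE : lp_key (lp sz v) = (lp sz v).1 j' * N + j' by rewrite -E' -divn_eq.
have kl : (lp sz v).1 j' * N + j' < d * N + j.
  rewrite -kE ltn_neqAle kle andbT; apply: contra ne' => /eqP e.
  by rewrite /j' e modnMDl modn_small.
have est'H : (lp sz v).1 j' <= H by rewrite -ltnS; apply: leq_trans lt' (lp_snt_bound _ _ _).
have W' := lp_sound est'H.
have [d2 D2 le2] := isd_ex W'.
have kl2 : d2 * N + j' < d * N + j.
  by apply: leq_ltn_trans kl; rewrite leq_add2r leq_mul2r le2 orbT.
have d2d : d2 <= d.
  rewrite leqNgt; apply/negP => lt2.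
  have : d.+1 * N <= d2 * N by rewrite leq_mul2r lt2 orbT.
  rewrite mulSnr; lia.
have [q' [_ l' i' _]] := W'; set l0 := last v q' in l' i'.
have rk : #|lp_below v d2 j'| < #|lp_below v d j|.
  apply: proper_card; apply/properP; split.
    apply/subsetP => l; rewrite !inE => /andP [-> /asboolP [d' [D' lt]]] /=.
    by apply/asboolP; exists d'; split=> //; apply: ltn_trans lt kl2.
  exists l0; rewrite !inE l' /= i'.
    by apply/asboolP; exists d2.
  apply/asboolPn => -[d' [[W3 _]]]; have le3 := D2.2 _ W3.
  by rewrite ltn_add2r ltn_mul2r (ltnNge d') le3 andbF.
have lt2 : d2 + #|lp_below v d2 j'| < sz by lia.
have [||_ Es] := IH _ lt2 v j' d2 D2; [lia|exact: leqnn|].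
have := lp_snt_mono v j' lt2; rewrite Es; lia.
Qed.

Lemma source_detection k v j : H + #|[set l | lm l]| <= k ->
  ((lp k v).1 j <= H -> walk_length j v ((lp k v).1 j)) /\
  (forall d, walk_length j v d -> d <= H -> (lp k v).1 j <= d).
Proof.
move=> Hk; split; first exact: lp_sound.
move=> d W dH; have [d' D' le] := isd_ex W.
have lt : #|lp_below v d' j| <= #|[set l | lm l]|.
  by apply: subset_leq_card; apply/subsetP => l; rewrite !inE => /andP [].
have [||-> _ //] := lp_progress (sz := k) D'; lia.
Qed.

Lemma lp_wf B k v : 1 < n ^ B -> H < n ^ B -> N <= n ^ B ->
  size (lp_msg (xi v) (lp k v)) = 3 /\ all (fun y => y < n ^ B) (lp_msg (xi v) (lp k v)).
Proof.
move=> h1 h2 h3; rewrite /lp_msg; case: ifP => /= lt; last by rewrite ltnW.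
have [jN -> l2] := lp_keyP' lt.
rewrite h1 (leq_trans jN h3) !andbT; split=> //; apply: leq_trans h2.
exact: leq_trans l2 (lp_snt_bound _ _ _).
Qed.
End SourceDetection.

(** * Furthest vertices and pipelined scans *)

Lemma foldr_maxn_ge b (s : seq nat) x : x \in b :: s -> x <= foldr maxn b s.
Proof.
elim: s => [|y s IH] /=; first by rewrite inE => /eqP ->.
rewrite !inE => /or3P [e|/eqP ->|e]; last by rewrite leq_max IH ?orbT // inE e orbT.
  by rewrite leq_max IH ?orbT // inE e.
exact: leq_maxl.
Qed.

Lemma foldr_maxn_mem b (s : seq nat) : foldr maxn b s \in b :: s.
Proof.
elim: s => [|y s] /=; first by rewrite mem_head.
rewrite /maxn; case: ifP => _; rewrite !inE; last by rewrite eqxx orbT.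
by move=> /orP [->//|->]; rewrite !orbT.
Qed.

Section Furthest.
Variables (n N : nat) (len : NbrInfo -> option nat).

(* [st.2 z] is the largest key reached within length [z]; its value at time [z] is final and is sent in that round. *)
Definition fu_init (y : nat) : nat * (nat -> nat) := (0, fun=> y).
Definition fu_msg (y : nat) (st : nat * (nat -> nat)) : seq nat := [:: st.2 st.1].
Definition fu_upd (y : nat) (st : nat * (nat -> nat)) (ib : nat -> option (NbrInfo * seq nat)) :=
  (st.1.+1, fun z => foldr maxn (st.2 z) (nlist N ib (fun f m =>
     if len f is Some l then if st.1 + l <= z then [:: head 0 m] else [::] else [::]))).

Variables (I : inst n) (xi : 'I_n -> nat) (ge : rel 'I_n) (ew : 'I_n -> 'I_n -> nat).
Hypothesis inj : injective (gid I).
Hypothesis idN : forall v, gid I v < N.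
Hypothesis lenP : forall v u, adj (gE I) v u -> len (link I v u) = if ge v u then Some (ew v u) else None.
Hypothesis ge_adj : forall v u, ge v u -> adj (gE I) v u.
Hypothesis ew_pos : forall v u, ge v u -> 0 < ew v u.
Local Notation fu := (prun fu_init fu_msg fu_upd I xi).

Lemma fu_time k v : (fu k v).1 = k.
Proof. by elim: k => //= k ->. Qed.

Lemma fu_mono k k' v z : k <= k' -> (fu k v).2 z <= (fu k' v).2 z.
Proof.
move=> /subnKC <-; elim: (k' - k) => [|i IH]; first by rewrite addn0.
by rewrite addnS /=; apply: leq_trans IH _; apply: foldr_maxn_ge; rewrite mem_head.
Qed.

Lemma fu_complete k v q z : path ge v q -> weight ew v q <= k -> weight ew v q <= z ->
  xi (last v q) <= (fu k v).2 z.
Proof.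
elim: q v k z => [|u q IH] v k z.
  by move=> _ _ _; apply: leq_trans (fu_mono v z (leq0n k)).
rewrite [path _ _ _]/= weight_cons => /andP [g Pq] Hk Hz; rewrite [last _ _]/=.
have g0 := ew_pos g.
set d := weight ew u q in Hk Hz.
(* [u] sends its entry for length [d] at time [d]; it arrives at time [d.+1], which is at most [k]
   because the edge has positive length. *)
have := IH u d d Pq (leqnn _) (leqnn _) => le; apply: leq_trans le _.
apply: leq_trans (fu_mono (k := d.+1) (k' := k) v z _); last by lia.
apply: foldr_maxn_ge; rewrite inE; apply/orP; right.
rewrite nlistP //; exists u; first exact: ge_adj.
rewrite lenP ?ge_adj // g !fu_time; case: ifP => [_|/negP []]; last by rewrite addnC.
by rewrite inE /= fu_time.
Qed.

Lemma fu_sound k v z : exists q, [/\ path ge v q, weight ew v q <= z & (fu k v).2 z = xi (last v q)].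
Proof.
elim: k v z => [|k IH] v z; first by exists [::]; rewrite weight_nil.
rewrite [(fu k.+1 v).2 z]/=.
set s := nlist _ _ _; have := foldr_maxn_mem ((fu k v).2 z) s.
rewrite inE => /orP [/eqP ->|]; first exact: IH.
rewrite {2}/s nlistP // => -[u a]; rewrite lenP //; case: ifP => // g.
case: ifP => // le; rewrite inE => /eqP ->.
have [q [Pq Wq E]] := IH u (fu k u).1; exists (u :: q); rewrite /= g; split=> //.
rewrite weight_cons addnC; apply: leq_trans le; rewrite leq_add2r.
by move: Wq; rewrite !fu_time.
Qed.
End Furthest.

Lemma last_bd (bd : pred nat) i : bd 0 -> exists x o, [/\ x + o = i, bd x & forall j, x < j <= i -> ~~ bd j].
Proof.
move=> b0; elim: i => [|i [x [o [e bx nb]]]]; first by exists 0, 0; split=> // j; lia.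
have [b|b] := boolP (bd i.+1); first by exists i.+1, 0; rewrite addn0; split=> // j; lia.
exists x, o.+1; rewrite addnS e; split=> // j Hj.
have [->//|ne] := eqVneq j i.+1; apply: nb; lia.
Qed.

(** * Scans along the path *)

Section Scan.
Variables (n N L : nat) (pr : NbrInfo -> bool) (lnk : NbrInfo -> seq nat -> seq nat).

(* A scan along the path: a boundary vertex starts one tag per round with payload [sc_base], the others forward a tag after transforming its payload by [sc_comb]. The state is the time, the item just received (to be forwarded), and all items received. *)
Definition sc_static := (bool * seq nat * (nat -> seq nat) * (nat -> seq nat -> seq nat))%type.
Definition sc_state := (nat * seq nat * seq (seq nat))%type.
Definition sc_bd (y : sc_static) := y.1.1.1.
Definition sc_ents (y : sc_static) := y.1.1.2.
Definition sc_base (y : sc_static) := y.1.2.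
Definition sc_comb (y : sc_static) := y.2.
Definition sc_init (y : sc_static) : sc_state := (0, [::], [::]).
Definition sc_msg (y : sc_static) (st : sc_state) : seq nat :=
  if sc_bd y then
    if st.1.1 < size (sc_ents y) then
      let tag := nth 0 (sc_ents y) st.1.1 in 1 :: tag :: sc_base y tag
    else nseq L.+2 0
  else if st.1.2 is tag :: x then 1 :: tag :: sc_comb y tag x else nseq L.+2 0.
Definition sc_new (ib : nat -> option (NbrInfo * seq nat)) : seq (seq nat) :=
  nlist N ib (fun f m => if pr f && (head 0 m == 1) then [:: nth 0 m 1 :: lnk f (drop 2 m)] else [::]).
Definition sc_upd (y : sc_static) (st : sc_state) ib : sc_state :=
  (st.1.1.+1, head [::] (sc_new ib), st.2 ++ sc_new ib).

Variables (I : inst n) (xi : 'I_n -> sc_static) (vtx : nat -> 'I_n) (ell : nat).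
Hypothesis inj : injective (gid I).
Hypothesis idN : forall v, gid I v < N.
Hypothesis vtx_adj : forall i, i < ell -> adj (gE I) (vtx i.+1) (vtx i).
Hypothesis vtx_pr : forall i u, i < ell -> adj (gE I) (vtx i.+1) u ->
  pr (link I (vtx i.+1) u) = (u == vtx i).
Hypothesis vtx0_pr : forall u, adj (gE I) (vtx 0) u -> ~~ pr (link I (vtx 0) u).
Hypothesis vtx0_bd : sc_bd (xi (vtx 0)).
Hypothesis off_pr : forall v, (forall i, i <= ell -> v != vtx i) ->
  ~~ sc_bd (xi v) /\ forall u, adj (gE I) v u -> ~~ pr (link I v u).
Local Notation sc := (prun sc_init sc_msg sc_upd I xi).
Local Notation bdv i := (sc_bd (xi (vtx i))).

Lemma sc_time k v : (sc k v).1.1 = k.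
Proof. by elim: k => //= k ->. Qed.

(** The specification of the scan: the payload that leaves position [x + o] for [tag], the scan
    having started at the boundary [x]. *)
Fixpoint sc_sent (x o tag : nat) : seq nat :=
  if o is o'.+1 then
    sc_comb (xi (vtx (x + o))) tag
      (lnk (link I (vtx (x + o)) (vtx (x + o'))) (sc_sent x o' tag))
  else sc_base (xi (vtx x)) tag.

Definition sc_recv x o tag := lnk (link I (vtx (x + o).+1) (vtx (x + o))) (sc_sent x o tag).

Lemma sc_sentS x o tag : sc_sent x o.+1 tag = sc_comb (xi (vtx (x + o).+1)) tag (sc_recv x o tag).
Proof. by rewrite /sc_recv /= addnS. Qed.

Lemma sc_newP f i c : i < ell -> (c \in sc_new (inbox I f (vtx i.+1))) <->
  (head 0 (f (vtx i)) == 1) && (c == nth 0 (f (vtx i)) 1 :: lnk (link I (vtx i.+1) (vtx i)) (drop 2 (f (vtx i)))).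
Proof.
move=> Hi; rewrite /sc_new nlistP //; split.
  by move=> [u a]; rewrite vtx_pr //; case: eqP => //= ->; case: ifP => //= _; rewrite inE.
move=> /andP [h e]; exists (vtx i); first exact: vtx_adj.
by rewrite vtx_pr ?vtx_adj // eqxx h inE.
Qed.

Lemma sc_new_head f i : i < ell -> head [::] (sc_new (inbox I f (vtx i.+1))) =
  if head 0 (f (vtx i)) == 1 then nth 0 (f (vtx i)) 1 :: lnk (link I (vtx i.+1) (vtx i)) (drop 2 (f (vtx i)))
  else [::].
Proof.
move=> Hi; have := sc_newP f _ Hi; case: (sc_new _) => [|c s] H /=.
  case: ifP => // h; have [_] := H (nth 0 (f (vtx i)) 1 :: lnk (link I (vtx i.+1) (vtx i)) (drop 2 (f (vtx i)))).
  by rewrite h eqxx => /(_ isT).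
by have [/(_ (mem_head _ _)) /andP [-> /eqP ->] _] := H c.
Qed.

(** The pipeline in closed form: an item advances one position per round, so at time [k] offset [o]
    sends the tag that its boundary started at time [k - o]. *)
Lemma sc_msgP x o k : bdv x -> (forall i, x < i <= x + o -> ~~ bdv i) -> x + o <= ell ->
  sc_msg (xi (vtx (x + o))) (sc k (vtx (x + o))) =
    if o <= k < o + size (sc_ents (xi (vtx x))) then
      let tag := nth 0 (sc_ents (xi (vtx x))) (k - o) in 1 :: tag :: sc_sent x o tag
    else nseq L.+2 0.
Proof.
move=> bx; elim: o k => [|o IH] k nb Hl.
  by rewrite addn0 /sc_msg bx sc_time subn0.
have nb' : forall i, x < i <= x + o -> ~~ bdv i by move=> i Hi; apply: nb; lia.
have {}IH k' := IH k' nb'; rewrite addnS in Hl *.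
rewrite /sc_msg (negPf (nb (x + o).+1 _)); last by lia.
case: k => [|k]; first by [].
rewrite [(sc k.+1 _).1.2]/= sc_new_head //; move: (IH k (ltnW Hl)).
set sz := size _; have -> : (o < k.+1 < o.+1 + sz) = (o <= k < o + sz) by lia.
move: (sc_msg _ _) => m ->.
by case: (o <= k < o + sz); rewrite //= subSS ?drop0 ?addnS.
Qed.

Lemma sc_rec_path x o k c : bdv x -> (forall i, x < i <= x + o -> ~~ bdv i) -> x + o < ell ->
  (c \in (sc k (vtx (x + o).+1)).2) <->
  exists j, [/\ j < size (sc_ents (xi (vtx x))), j + o < k &
    c = let tag := nth 0 (sc_ents (xi (vtx x))) j in tag :: sc_recv x o tag].
Proof.
move=> bx nb Hl; elim: k => [|k IH]; first by split=> // -[j []].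
have := sc_msgP k bx nb (ltnW Hl); rewrite [(sc k.+1 _).2]/= mem_cat.
set sz := size _ => M; split.
  move=> /orP [/IH [j [h1 h2 ->]]|]; first by exists j; rewrite h1 ltnS ltnW.
  rewrite sc_newP // M; case: (boolP (o <= k < o + sz)) => // /andP [h1 h2] /andP [_ /eqP ->].
  by exists (k - o); rewrite /= ?drop0; split=> //; lia.
move=> [j [h1 h2 ec]]; move: h2; rewrite ltnS leq_eqVlt => /orP [/eqP e|h2].
  apply/orP; right; rewrite sc_newP // M.
  have -> : o <= k < o + sz by lia.
  by rewrite ec /= ?drop0 -e addnK eqxx.
by apply/orP; left; apply/IH; exists j.
Qed.

Lemma scan x o k c : bdv x -> (forall i, x < i <= x + o -> ~~ bdv i) -> x + o < ell ->
  o + size (sc_ents (xi (vtx x))) <= k ->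
  (c \in (sc k (vtx (x + o).+1)).2) <->
  exists2 tag, tag \in sc_ents (xi (vtx x)) & c = tag :: sc_recv x o tag.
Proof.
move=> bx nb Hl Hk; rewrite sc_rec_path //; split.
  by move=> [j [h1 _ ->]]; exists (nth 0 (sc_ents (xi (vtx x))) j) => //; apply: mem_nth.
move=> [tag /(nthP 0) [j h1 <-] ->]; exists j; split=> //.
by apply: leq_trans Hk; rewrite addnC ltn_add2l.
Qed.

Lemma sc_new_nil v f : (forall u, adj (gE I) v u -> ~~ pr (link I v u)) -> sc_new (inbox I f v) = [::].
Proof.
move=> H; rewrite /sc_new; apply/nilP; rewrite /nilp; apply: contraT; rewrite -lt0n -has_predT.
move=> /hasP [c]; rewrite nlistP // => -[u /H /negPf ->].
by [].
Qed.

Lemma sc_rec_off v k : v = vtx 0 \/ (forall i, i <= ell -> v != vtx i) ->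
  (sc k v).1.2 = [::] /\ (sc k v).2 = [::].
Proof.
move=> Hv; have H u : adj (gE I) v u -> ~~ pr (link I v u).
  by case: Hv => [->|/off_pr [_]]; [apply: vtx0_pr|apply].
by elim: k => [//|k [IH1 IH2]] /=; rewrite sc_new_nil // IH2.
Qed.

Lemma sc_wf B k v : 1 < n ^ B ->
  (forall x o tag, bdv x -> tag \in sc_ents (xi (vtx x)) -> x + o <= ell ->
     (forall i, x < i <= x + o -> ~~ bdv i) ->
     [/\ tag < n ^ B, size (sc_sent x o tag) = L & all (fun y => y < n ^ B) (sc_sent x o tag)]) ->
  size (sc_msg (xi v) (sc k v)) = L.+2 /\ all (fun y => y < n ^ B) (sc_msg (xi v) (sc k v)).
Proof.
move=> n1 H.
have Z : size (nseq L.+2 0) = L.+2 /\ all (fun y => y < n ^ B) (nseq L.+2 0).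
  by rewrite size_nseq all_nseq ltnW.
have [[i iv]|off] := pselect (exists i, i <= ell /\ v = vtx i); last first.
  have off' i : i <= ell -> v != vtx i by move=> Hi; apply/eqP => e; apply: off; exists i.
  have [e _] := sc_rec_off k (or_intror off'); have [nb _] := off_pr off'.
  by rewrite /sc_msg (negPf nb) e.
case: iv => Hi ->; have [x [o [e bx nb]]] := last_bd (bd := fun i => bdv i) i vtx0_bd.
rewrite -e in nb Hi *; rewrite sc_msgP //; case: ifP => // /andP [h1 h2].
set tag := nth _ _ _; have tI : tag \in sc_ents (xi (vtx x)) by apply: mem_nth; rewrite ltn_subLR.
by have [h3 h4 h5] := H x o tag bx tI Hi nb; rewrite /= h4 h5 h3 n1.
Qed.
End Scan.

(** * Eccentricity *)

Section Eccentricity.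
Variables (n N : nat).

(** Clock, depth in the breadth-first search from [s] once reached, and largest depth heard of. *)
Definition ec_state := (nat * option nat * nat)%type.
Definition ec_init (y : bool) : ec_state := (0, if y then Some 0 else None, 0).
(** The message 0 is the silence of a vertex not yet reached, hence the successor. *)
Definition ec_msg (y : bool) (st : ec_state) : seq nat := [:: if st.1.2 is Some _ then st.2.+1 else 0].
Definition ec_new (ib : nat -> option (NbrInfo * seq nat)) : seq nat :=
  nlist N ib (fun _ m => if head 0 m is x.+1 then [:: x] else [::]).
Definition ec_dep (st : ec_state) ib : option nat :=
  if st.1.2 is Some d then Some d else if ec_new ib is _ :: _ then Some st.1.1.+1 else None.
Definition ec_upd (y : bool) (st : ec_state) ib : ec_state :=
  (st.1.1.+1, ec_dep st ib, foldr maxn (maxn st.2 (odflt 0 (ec_dep st ib))) (ec_new ib)).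
Definition ec_dec (st : ec_state) : bool := (st.1.2 != None) && (st.1.1 == 3 * st.2 + 3).

Variables (I : inst n) (D : nat).
Hypothesis inj : injective (gid I).
Hypothesis idN : forall v, gid I v < N.
Hypothesis diam : forall u v, within (gE I) D u v.
Local Notation adj := (adj (gE I)).
Local Notation within := (within (gE I)).
Local Notation ec := (prun ec_init ec_msg ec_upd I (fun v => v == gs I)).

Lemma adj_sym u v : adj u v = adj v u. Proof. by rewrite /Defs.adj orbC. Qed.

Lemma within_sym k u v : within k u v -> within k v u.
Proof.
move=> [q [P L S]]; have H x y : adj x y -> adj y x /\ 0 = 0 by rewrite adj_sym.
have [q' [P' L' S' _ _]] := rev_walk (w := fun _ _ => 0) (w' := fun _ _ => 0) H P.
by exists q'; rewrite -L S' P' L'.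
Qed.

Lemma within_trans k1 k2 u v x : within k1 u v -> within k2 v x -> within (k1 + k2) u x.
Proof.
move=> [q [P L S]] [q' [P' L' S']]; exists (q ++ q').
by rewrite cat_path last_cat P L P' L' size_cat leq_add.
Qed.

Lemma within_le k1 k2 u v : k1 <= k2 -> within k1 u v -> within k2 u v.
Proof. by move=> H [q [P L S]]; exists q; rewrite P L (leq_trans S). Qed.

Lemma depth_ex v : exists k, `[< within k (gs I) v >].
Proof. by exists D; apply/asboolP. Qed.
Definition depth v := ex_minn (depth_ex v).

Lemma depth_within v : within (depth v) (gs I) v.
Proof. by rewrite /depth; case: ex_minnP => m /asboolP. Qed.

Lemma depth_min v k : within k (gs I) v -> depth v <= k.
Proof. by move=> H; rewrite /depth; case: ex_minnP => m _; apply; apply/asboolP. Qed.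

Lemma depth_adj u v : adj u v -> depth v <= (depth u).+1.
Proof.
move=> a; apply: depth_min; rewrite -addn1; apply: within_trans (depth_within u) _.
by exists [:: v]; rewrite /= a.
Qed.

Lemma depth_s : depth (gs I) = 0.
Proof. by apply/eqP; rewrite -leqn0; apply: depth_min; exists [::]. Qed.

Lemma depth_pred v : 0 < depth v -> exists u, adj v u /\ depth u = (depth v).-1.
Proof.
move=> d0; have [q [P L S]] := depth_within v.
case/lastP: q P L S => [_ L|q x]; first by move: d0; rewrite -L /= depth_s.
rewrite rcons_path last_rcons size_rcons => /andP [P a] e S; subst x.
exists (last (gs I) q); rewrite adj_sym; split=> //.
have := depth_adj a; have : depth (last (gs I) q) <= size q by apply: depth_min; exists q.
lia.
Qed.

Lemma depth_lt v : depth v < n.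
Proof.
have [q [P L S]] := depth_within v; rewrite -L.
case/shortenP: P L S => q' P' U _ _ _.
have := max_card (mem (gs I :: q')); rewrite (card_uniqP U) card_ord /=.
apply: leq_trans; rewrite ltnS; apply: depth_min; by exists q'.
Qed.

Definition ecc := \max_(v : 'I_n) depth v.

Lemma depth_ecc v : depth v <= ecc. Proof. exact: leq_bigmax. Qed.

Lemma ecc_ex : exists v, depth v = ecc.
Proof. by rewrite /ecc; have [|v ->] := eq_bigmax depth; [rewrite card_ord; case: n (gs I) => // -[]|exists v]. Qed.

Lemma ecc_D : ecc <= D.
Proof. by have [v <-] := ecc_ex; apply: depth_min. Qed.

Lemma ecc_lt : ecc < n.
Proof. by have [v <-] := ecc_ex; apply: depth_lt. Qed.

(** This makes the stopping rule sound: if a vertex has heard only of depths up to [m < ecc], some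
    vertex has depth exactly [m.+1] and would have been heard of in time. *)
Lemma layer m : m <= ecc -> exists u, depth u = m.
Proof.
move=> /subKn <-; elim: (ecc - m) => [|k [u Hu]].
  by rewrite subn0; apply: ecc_ex.
have [e|p] := posnP (depth u); first by exists u; rewrite e in Hu *; lia.
by have [x [_ Ex]] := depth_pred p; exists x; rewrite Ex Hu; lia.
Qed.

Lemma within_ecc u v : within (2 * ecc) u v.
Proof.
rewrite mul2n -addnn; apply: (@within_trans _ _ _ (gs I)).
  by apply: within_sym; apply: within_le (depth_ecc u) (depth_within u).
by apply: within_le (depth_ecc v) (depth_within v).
Qed.

Lemma ec_time k v : (ec k v).1.1 = k.
Proof. by elim: k => //= k ->. Qed.

Lemma ec_newP k v x : x \in ec_new (inbox I (fun u => ec_msg (u == gs I) (ec k u)) v) <->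
  exists2 u, adj v u & (ec k u).1.2 != None /\ (ec k u).2 = x.
Proof.
rewrite /ec_new nlistP //; split=> -[u a H]; exists u => //; move: H; rewrite /ec_msg /=.
  by case: (ec k u).1.2 => //= d; rewrite inE => /eqP ->.
by case: (ec k u).1.2 => //= [d [_ ->]|[]//]; rewrite inE.
Qed.

Lemma ec_depP k v : (ec k v).1.2 = if depth v <= k then Some (depth v) else None.
Proof.
elim: k v => [|k IH] v.
  rewrite /=; case: eqP => [->|ne]; first by rewrite depth_s.
  rewrite leqn0; case: eqP => // e; case: ne.
  by have [[|x q] [_ L S]] := depth_within v; [rewrite -L|rewrite e in S].
rewrite [(ec k.+1 v).1.2]/= /ec_dep IH.
have [le|gt] := leqP (depth v) k; first by rewrite leqW.
have P := ec_newP k v; rewrite ec_time.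
case: (ec_new _) P => [|x s] P.
  case: leqP => // le; have [u [a Eu]] := depth_pred (leq_ltn_trans (leq0n _) gt).
  have [_ /(_ (ex_intro2 _ _ u a (conj _ erefl)))] := P (ec k u).2.
  by rewrite IH in_nil => /(_ _) H; have := H; rewrite ifT //; [move=> /(_ isT)|lia].
have [/(_ (mem_head _ _)) [u a [H _]] _] := P x.
move: H; rewrite IH; case: leqP => // le _.
have := depth_adj (u := u) (v := v); rewrite adj_sym a => /(_ isT) le2.
have -> : depth v = k.+1 by lia.
by rewrite leqnn.
Qed.

Lemma ec_mx_lower k v u d : within d u v -> depth u + d <= k -> depth u <= (ec k v).2.
Proof.
elim: k v d => [|k IH] v d W le; first by lia.
have own : depth v <= k.+1 -> depth v <= (ec k.+1 v).2.
  move=> Hk; have := ec_depP k.+1 v; rewrite Hk /= => ->.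
  exact: leq_trans (leq_maxr _ _) (foldr_maxn_ge (mem_head _ _)).
case: W => q [P L S]; case/lastP: q P L S => [_ /= e _|q x]; first by rewrite e in le *; apply: own; lia.
rewrite rcons_path last_rcons size_rcons => /andP [P a] e S; subst x.
set x := last u q in a.
have W : within (size q) u x by exists q.
(* [x] has been reached by then, since a walk from [s] through [u] leads to it. *)
have lx : depth x <= k.
  apply: (@leq_trans (depth u + size q)); last by lia.
  by apply: depth_min; apply: within_trans (depth_within u) W.
have H : depth u <= (ec k x).2 by apply: (IH x (size q) W); lia.
rewrite /=; apply: leq_trans H _.
apply: foldr_maxn_ge; rewrite inE; apply/orP; right; apply/ec_newP.
by exists x; rewrite 1?adj_sym // ec_depP lx.
Qed.

Lemma ec_mx_upper k v : (ec k v).2 <= ecc.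
Proof.
elim: k v => [//|k IH] v.
have E : odflt 0 (ec k.+1 v).1.2 <= ecc.
  by rewrite ec_depP; case: ifP => //= _; apply: depth_ecc.
rewrite [(ec k.+1 v).2]/=; set s := ec_new _.
have := foldr_maxn_mem (maxn (ec k v).2 (odflt 0 (ec k.+1 v).1.2)) s.
rewrite inE => /orP [/eqP ->|]; first by rewrite geq_max IH.
by rewrite {2}/s => /ec_newP [u _ [_ <-]].
Qed.

(* At time [t >= 2 (m + 1) + depth v], a vertex of depth [m + 1], if any, is known to [v];
   and [depth v <= m], so that time [3 m + 3] is late enough. *)
Lemma ecc_dec v : (forall k, k < 3 * ecc + 3 -> ec_dec (ec k v) = false) /\
  ec_dec (ec (3 * ecc + 3) v) /\ (ec (3 * ecc + 3) v).2 = ecc.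
Proof.
have dv := depth_ecc v.
split=> [k Hk|].
  apply/negP; rewrite /ec_dec ec_time ec_depP => /andP [nN /eqP e]; move: nN; case: ifP => // le _.
  set m := (ec k v).2 in e.
  have own : depth v <= m by apply: (@ec_mx_lower k v v 0); [exists [::]|rewrite addn0].
  have [|u Eu] := @layer m.+1; first by lia.
  have W : within (depth u + depth v) u v.
    exact: within_trans (within_sym (depth_within u)) (depth_within v).
  have : depth u <= m by apply: ec_mx_lower W _; lia.
  by rewrite Eu ltnn.
have E : (ec (3 * ecc + 3) v).2 = ecc.
  apply/eqP; rewrite eqn_leq ec_mx_upper; have [u Eu] := ecc_ex; rewrite -{1}Eu.
  apply: (ec_mx_lower (d := depth u + depth v)); last by lia.
  exact: within_trans (within_sym (depth_within u)) (depth_within v).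
rewrite /ec_dec E ec_time eqxx ec_depP; case: leqP => //; lia.
Qed.

Lemma ec_wf B k v : n < n ^ B ->
  size (ec_msg (v == gs I) (ec k v)) = 1 /\ head 0 (ec_msg (v == gs I) (ec k v)) < n ^ B.
Proof.
move=> H; rewrite /ec_msg; split=> //; case: (ec k v).1.2 => [_|] /=; last by lia.
by apply: leq_ltn_trans H; apply: leq_ltn_trans ecc_lt; apply: ec_mx_upper.
Qed.
End Eccentricity.

(** * One direction of the path *)

(* What a vertex knows of its place on the path: on the path or not, segment boundary or not, position, lengths of the prefix and suffix of the path, all landmarks, and the positions of the boundaries. *)
Record ninfo := NInfo { ni_on : bool; ni_bd : bool; ni_ix : nat; ni_pre : nat;
  ni_suf : nat; ni_lms : seq nat; ni_bps : seq nat }.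

Section Half.
Variables (n N INF H S h : nat).

Definition landmark_est (Ls : nat -> nat -> nat) l : nat :=
  lmin INF [seq 2 ^ i * Ls i l | i <- iota 0 S.+1 & Ls i l <= H].
(* Keys order the path vertices by position and carry the remaining length; [0] means off the path. *)
Definition kappa (nu : ninfo) : nat := if ni_on nu then (ni_ix nu).+1 * INF + ni_suf nu else 0.
(** The quotient of a key by [INF] is the position plus one, so the filter keeps positions at least
    [y] and rejects vertices off the path; the remainder is the length still to go. *)
Definition rejoin_est (nu : ninfo) (Fs : nat -> nat -> nat) y : nat :=
  lmin INF [seq ni_pre nu + 2 ^ c.1 * c.2 + Fs c.1 c.2 %% INF |
    c <- [seq (i, z) | i <- iota 0 S.+1, z <- iota 0 H.+1] & y < Fs c.1 c.2 %/ INF].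
(* Tag [l.*2]: leave the path for landmark [l]; tag [y.*2.+1]: rejoin the path at position [y] or later. *)
Definition start_value nu Fs Ls tag : nat :=
  if odd tag then rejoin_est nu Fs tag./2 else minn INF (ni_pre nu + landmark_est Ls tag./2).
(** A segment forwards only the tags that its boundary starts. The last block supplies the
    thresholds for the edges of the segment itself, whose ends are at most [h] positions away. *)
Definition pm_ents nu : seq nat :=
  [seq l.*2 | l <- ni_lms nu] ++ [seq y.*2.+1 | y <- ni_bps nu] ++
  [seq y.*2.+1 | y <- iota (ni_ix nu).+1 h].
Definition pm_static nu Fs Ls : sc_static :=
  (ni_bd nu, pm_ents nu, fun tag => [:: start_value nu Fs Ls tag],
   fun tag x => [:: minn (start_value nu Fs Ls tag) (head 0 x)]).
Definition pm_get (rec : seq (seq nat)) tag : nat :=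
  nth INF (head [::] [seq c <- rec | head 0 c == tag]) 1.
(** The scan delivers minima over strictly earlier positions; the vertex adds its own value, and a
    boundary discards the records of the preceding segment. *)
Definition pm_acc nu Fs Ls rec tag : nat :=
  if ni_bd nu then start_value nu Fs Ls tag else minn (start_value nu Fs Ls tag) (pm_get rec tag).

Variables (I : inst n) (ge : rel 'I_n) (wb : 'I_n -> 'I_n -> nat) (pr : NbrInfo -> bool).
Variables (vtx : nat -> 'I_n) (ell : nat) (prex sufx : nat -> nat) (Lam : pred 'I_n).
Variables (nu : 'I_n -> ninfo) (Fr Lr : 'I_n -> nat -> nat -> nat) (kq : nat).
Local Notation id := (gid I).
Hypothesis kq0 : 0 < kq.
Hypothesis inj : injective (gid I).
Hypothesis idN : forall v, gid I v < N.
Hypothesis HE : H = (kq.*2 + 1) * h.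
Hypothesis suf_anti : forall i j, i <= j <= ell -> sufx j <= sufx i.
Hypothesis suf_INF : forall i, i <= ell -> sufx i < INF.
Hypothesis vtx_adj : forall i, i < ell -> adj (gE I) (vtx i.+1) (vtx i).
Hypothesis vtx_pr : forall i u, i < ell -> adj (gE I) (vtx i.+1) u ->
  pr (link I (vtx i.+1) u) = (u == vtx i).
Hypothesis vtx0_pr : forall u, adj (gE I) (vtx 0) u -> ~~ pr (link I (vtx 0) u).
Hypothesis off_pr : forall v, (forall i, i <= ell -> v != vtx i) ->
  forall u, adj (gE I) v u -> ~~ pr (link I v u).
Hypothesis Lam0 : Lam (vtx 0).
Hypothesis window : forall x, x + h <= ell -> exists i, x < i <= x + h /\ Lam (vtx i).
Hypothesis nu_on : forall i, i <= ell -> [/\ ni_on (nu (vtx i)), ni_ix (nu (vtx i)) = i,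
  ni_pre (nu (vtx i)) = prex i & ni_suf (nu (vtx i)) = sufx i].
Hypothesis nu_off : forall v, (forall i, i <= ell -> v != vtx i) -> ni_on (nu v) = false.
Hypothesis nu_bd : forall v, ni_bd (nu v) = ni_on (nu v) && Lam v.
Hypothesis nu_lms : forall v l, l \in ni_lms (nu v) <-> exists2 u, Lam u & id u = l.
Hypothesis nu_bps : forall v y, y \in ni_bps (nu v) <-> y <= ell /\ Lam (vtx y).
Hypothesis lr_sound : forall v i l, i <= S -> Lr v i l <= H ->
  exists q, [/\ path ge v q, Lam (last v q), id (last v q) = l & weight (rw wb (2 ^ i)) v q = Lr v i l].
Hypothesis lr_complete : forall v i l q, i <= S -> path ge v q -> Lam (last v q) ->
  id (last v q) = l -> weight (rw wb (2 ^ i)) v q <= H -> Lr v i l <= weight (rw wb (2 ^ i)) v q.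
Hypothesis fr_sound : forall v i z, i <= S -> exists q, [/\ path ge v q,
  weight (rw wb (2 ^ i)) v q <= z & Fr v i z = kappa (nu (last v q))].
Hypothesis fr_complete : forall v i z q, i <= S -> z <= H -> path ge v q ->
  weight (rw wb (2 ^ i)) v q <= z -> kappa (nu (last v q)) <= Fr v i z.

Lemma p2 i : 0 < 2 ^ i. Proof. by rewrite expn_gt0. Qed.

Lemma dtv_sound v l : landmark_est (Lr v) l < INF -> exists2 u, Lam u /\ id u = l & conn ge wb v u (landmark_est (Lr v) l).
Proof.
move/lmin_mem; rewrite -/(landmark_est (Lr v) l) => /mapP [i].
rewrite mem_filter mem_iota ltnS => /and3P [le _ iS] ->.
have [q [Pq Lq iq wq]] := lr_sound iS le; exists (last v q) => //; exists q; split=> //.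
by rewrite -wq; case/andP: (rw_bounds wb v q (p2 i)).
Qed.

Lemma dtv_complete v q : path ge v q -> Lam (last v q) -> size q <= h -> weight wb v q < 2 ^ S ->
  kq * landmark_est (Lr v) (id (last v q)) <= kq.+1 * weight wb v q.
Proof.
move=> Pq Lq sq wS; have [i iS [le1 le2]] := scale kq0 sq wS; rewrite -HE in le1.
have c := lr_complete iS Pq Lq erefl le1.
apply: leq_trans le2; rewrite leq_mul2l; apply/orP; right.
apply: (@leq_trans (2 ^ i * Lr v i (id (last v q)))); last by rewrite leq_mul2l c orbT.
apply: lmin_le; apply/mapP; exists i => //.
by rewrite mem_filter mem_iota add0n iS (leq_trans c le1).
Qed.

Lemma kappa_vtx i : i <= ell -> kappa (nu (vtx i)) = i.+1 * INF + sufx i.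
Proof. by move=> /nu_on [o ix _ sf]; rewrite /kappa o ix sf. Qed.

Lemma kappa_div i : i <= ell -> kappa (nu (vtx i)) %/ INF = i.+1 /\ kappa (nu (vtx i)) %% INF = sufx i.
Proof.
move=> Hi; have lt := suf_INF Hi; rewrite kappa_vtx // modnMDl modn_small // divnMDl; last by lia.
by rewrite divn_small // addn0.
Qed.

Lemma on_vtx v : ni_on (nu v) -> exists2 i, i <= ell & v = vtx i.
Proof.
move=> o; have [//|ne] := pselect (exists2 i, i <= ell & v = vtx i).
by rewrite nu_off // in o => i Hi; apply/eqP => e; apply: ne; exists i.
Qed.

Lemma vthr_sound a y : a <= ell -> rejoin_est (nu (vtx a)) (Fr (vtx a)) y < INF ->
  exists b c, [/\ y <= b <= ell, conn ge wb (vtx a) (vtx b) c &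
    prex a + c + sufx b <= rejoin_est (nu (vtx a)) (Fr (vtx a)) y].
Proof.
move=> Ha /lmin_mem; rewrite -/(rejoin_est _ _ _) => /mapP [[i z]].
rewrite mem_filter => /andP [lt /allpairsP [[i' z'] [h1 h2 e]]].
case: e => e1 e2; subst i' z'.
rewrite mem_iota add0n ltnS in h1; rewrite mem_iota add0n ltnS in h2.
move=> ->; have [q [Pq wq E]] := fr_sound (vtx a) z (h1 : i <= S).
have o : ni_on (nu (last (vtx a) q)).
  by move: lt; rewrite /= E /kappa; case: ifP => //; rewrite div0n.
have [b Hb eb] := on_vtx o; rewrite /= E eb in lt *.
have [d1 d2] := kappa_div Hb; rewrite d1 in lt; rewrite d2.
exists b, (2 ^ i * z); split; first by lia.
  exists q; split=> //; apply: leq_trans (_ : _ <= 2 ^ i * weight (rw wb (2 ^ i)) (vtx a) q) _.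
    by case/andP: (rw_bounds wb (vtx a) q (p2 i)).
  by rewrite leq_mul2l wq orbT.
by have [_ _ -> _] := nu_on Ha.
Qed.

Lemma vthr_complete a b y q : a <= ell -> y <= b <= ell -> path ge (vtx a) q -> last (vtx a) q = vtx b ->
  size q <= h -> weight wb (vtx a) q < 2 ^ S ->
  kq * rejoin_est (nu (vtx a)) (Fr (vtx a)) y <= kq * (prex a + sufx b) + kq.+1 * weight wb (vtx a) q.
Proof.
move=> Ha /andP [yb Hb] Pq Lq sq wS; have [i iS [le1 le2]] := scale kq0 sq wS; rewrite -HE in le1.
set z := weight _ _ _ in le1 le2.
have c := fr_complete iS le1 Pq (leqnn _); rewrite Lq in c.
have [q' [Pq' wq' E]] := fr_sound (vtx a) z (iS : i <= S).
(* The key of [vtx b] is a positive lower bound, so the furthest vertex found is on the path as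
   well. *)
have o : ni_on (nu (last (vtx a) q')).
  move: c; rewrite E {2}/kappa; case: ifP => // _; rewrite kappa_vtx // leqn0 => /eqP.
  have := suf_INF Hb; lia.
have [b' Hb' eb'] := on_vtx o; rewrite E eb' in c.
have [d1 d2] := kappa_div Hb'.
have bb : b <= b'.
  rewrite -ltnS -d1 -(proj1 (kappa_div Hb)); exact: leq_div2r.
have sb : sufx b' <= sufx b by apply: suf_anti; rewrite bb.
apply: (@leq_trans (kq * (prex a + 2 ^ i * z + sufx b'))); last first.
  have : kq * sufx b' <= kq * sufx b by rewrite leq_mul2l sb orbT.
  move: le2; rewrite !mulnDr; lia.
rewrite leq_mul2l; apply/orP; right; apply: lmin_le; apply/mapP; exists (i, z).
  rewrite mem_filter; apply/andP; split; first by rewrite /= E eb' d1; lia.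
  by apply: (allpairs_f pair); rewrite mem_iota add0n ltnS.
by rewrite /= E eb' d2; have [_ _ -> _] := nu_on Ha.
Qed.

Local Notation val a := (start_value (nu (vtx a)) (Fr (vtx a)) (Lr (vtx a))).

Lemma vlm_sound a l : a <= ell -> val a l.*2 < INF ->
  exists u c, [/\ Lam u, id u = l, conn ge wb (vtx a) u c & prex a + c <= val a l.*2].
Proof.
move=> Ha; rewrite /start_value odd_double doubleK => lt.
have [_ _ E _] := nu_on Ha; rewrite E in lt *.
have lt2 : prex a + landmark_est (Lr (vtx a)) l < INF by lia.
have [u [Lu iu] C] := dtv_sound (leq_ltn_trans (leq_addl _ _) lt2).
by exists u, (landmark_est (Lr (vtx a)) l); split=> //; lia.
Qed.

Lemma vlm_complete a q : a <= ell -> path ge (vtx a) q -> Lam (last (vtx a) q) -> size q <= h ->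
  weight wb (vtx a) q < 2 ^ S ->
  kq * val a (id (last (vtx a) q)).*2 <= kq * prex a + kq.+1 * weight wb (vtx a) q.
Proof.
move=> Ha Pq Lq sq wS; rewrite /start_value odd_double doubleK.
have [_ _ -> _] := nu_on Ha; apply: leq_trans (_ : _ <= kq * (prex a + landmark_est (Lr (vtx a)) (id (last (vtx a) q)))) _.
  by rewrite leq_mul2l geq_minr orbT.
by rewrite mulnDr leq_add2l dtv_complete.
Qed.

Local Notation xi := (fun v => pm_static (nu v) (Fr v) (Lr v)).
Local Notation rec k v := (prun sc_init (sc_msg 1) (sc_upd N pr (fun _ x => x)) I xi k v).2.
Local Notation bd i := (ni_bd (nu (vtx i))).

Lemma bdE i : i <= ell -> bd i = Lam (vtx i).
Proof. by move=> /nu_on [o _ _ _]; rewrite nu_bd o. Qed.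

Lemma gap x o : bd x -> (forall i, x < i <= x + o -> ~~ bd i) -> x + o <= ell -> o < h \/ x + h > ell.
Proof.
move=> bx nb Hl; have [lt|ge'] := ltnP o h; first by left.
right; rewrite ltnNge; apply/negP => le; have [i [Hi Li]] := window le.
have Hn : ~~ bd i by apply: nb; lia.
by rewrite bdE ?Li // in Hn; lia.
Qed.

Lemma pm_sent x o tag : exists2 v, sc_sent (fun _ y => y) I xi vtx x o tag = [:: v] &
  (forall a, x <= a <= x + o -> v <= val a tag) /\ exists2 a, x <= a <= x + o & v = val a tag.
Proof.
elim: o => [|o [v E [le [a0 Ha0 ev]]]].
  exists (val x tag) => //; split; last by exists x => //; lia.
  by move=> a Ha; have -> : a = x by lia.
rewrite sc_sentS /sc_recv E /=; eexists; first by reflexivity.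
split.
  move=> a Ha; have [e|ne] := eqVneq a (x + o).+1; first by rewrite e geq_minl.
  by apply: leq_trans (geq_minr _ _) (le _ _); lia.
rewrite /minn; case: ifP => _; first by exists (x + o).+1 => //; lia.
by exists a0 => //; lia.
Qed.

Section Run.
Variable k : nat.
Hypothesis Hk : forall v, h + size (pm_ents (nu v)) <= k.

Lemma off_pr' : forall v, (forall i, i <= ell -> v != vtx i) ->
  ~~ sc_bd (xi v) /\ forall u, adj (gE I) v u -> ~~ pr (link I v u).
Proof. by move=> v off; split; [rewrite /sc_bd /= nu_bd nu_off|apply: off_pr]. Qed.

Lemma bd0 : bd 0. Proof. by rewrite bdE. Qed.

Lemma segment i : exists x o, [/\ x + o = i, bd x & forall j, x < j <= i -> ~~ bd j].
Proof. exact: (last_bd (bd := fun i => bd i) i bd0). Qed.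

Lemma seg_short x o : bd x -> (forall i, x < i <= x + o -> ~~ bd i) -> x + o < ell -> o < h.
Proof.
move=> bx nb Hl; have [//|lt] := gap bx nb (ltnW Hl); lia.
Qed.

Lemma pm_rec x o c : bd x -> (forall i, x < i <= x + o -> ~~ bd i) -> x + o < ell ->
  (c \in rec k (vtx (x + o).+1)) <->
  exists2 tag, tag \in pm_ents (nu (vtx x)) & c = tag :: sc_sent (fun _ y => y) I xi vtx x o tag.
Proof.
move=> bx nb Hl; apply: (scan 1 (fun _ y => y) inj idN vtx_adj vtx_pr bd0 (xi := xi)) => //.
by apply: leq_trans (Hk (vtx x)); rewrite leq_add2r ltnW // (seg_short bx nb).
Qed.
Local Notation R y tag := (pm_get (rec k (vtx y)) tag).
Local Notation Acc i tag := (pm_acc (nu (vtx i)) (Fr (vtx i)) (Lr (vtx i)) (rec k (vtx i)) tag).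

Lemma R_sound y tag : y <= ell -> R y tag < INF -> exists2 a, a < y & R y tag = val a tag.
Proof.
case: y => [|y] Hy.
  have [_ ->] := sc_rec_off 1 (fun _ y => y) (xi := xi) inj idN vtx0_pr off_pr' k (or_introl erefl).
  by rewrite /pm_get /= ltnn.
have [x [o [e bx nb]]] := segment y; rewrite -e in Hy nb *.
rewrite /pm_get; case E: [seq c <- _ | _] => [|c s]; first by rewrite /= ltnn.
have : c \in [seq c <- rec k (vtx (x + o).+1) | head 0 c == tag] by rewrite E mem_head.
rewrite mem_filter => /andP [/eqP Ec /(pm_rec _ bx nb Hy) [tag' _ ec]].
have [v Ev [_ [a Ha va]]] := pm_sent x o tag'.
rewrite ec /= in Ec; subst tag'; rewrite ec Ev /= => _.
by exists a => //; lia.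
Qed.

Lemma R_complete x a y tag : bd x -> (forall i, x < i < y -> ~~ bd i) -> x <= a < y -> y <= ell ->
  tag \in pm_ents (nu (vtx x)) -> R y tag <= val a tag.
Proof.
move=> bx nb Ha Hy tI; case: y nb Ha Hy => [|y] nb Ha Hy; first by lia.
have ey : y = x + (y - x) by lia.
move: nb Ha Hy; rewrite ey; set o := y - x => nb Ha Hy.
have nb' : forall i, x < i <= x + o -> ~~ bd i by move=> i Hi; apply: nb; lia.
have [v Ev [le _]] := pm_sent x o tag.
have Iv : tag :: [:: v] \in rec k (vtx (x + o).+1).
  by apply/(pm_rec _ bx nb' Hy); exists tag; rewrite ?Ev.
have : tag :: [:: v] \in [seq c <- rec k (vtx (x + o).+1) | head 0 c == tag].
  by rewrite mem_filter /= eqxx.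
rewrite /pm_get; case E: [seq c <- _ | _] => [//|c s] _.
have : c \in [seq c <- rec k (vtx (x + o).+1) | head 0 c == tag] by rewrite E mem_head.
rewrite mem_filter => /andP [/eqP Ec /(pm_rec _ bx nb' Hy) [tag' _ ec]].
rewrite ec /= in Ec; subst tag'; rewrite ec Ev /=; apply: le; lia.
Qed.

Lemma Acc_sound i tag : i <= ell -> Acc i tag < INF -> exists2 a, a <= i & Acc i tag = val a tag.
Proof.
move=> Hi; rewrite /pm_acc; case: ifP => _; first by exists i.
rewrite /minn; case: ifP => [_ _|_ lt]; first by exists i.
by have [a Ha ->] := R_sound Hi lt; exists a => //; apply: ltnW.
Qed.

Lemma Acc_complete x a i tag : bd x -> (forall j, x < j <= i -> ~~ bd j) -> x <= a <= i -> i <= ell ->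
  tag \in pm_ents (nu (vtx x)) -> Acc i tag <= val a tag.
Proof.
move=> bx nb Ha Hi tI; rewrite /pm_acc.
have [->|ne] := eqVneq a i; first by case: ifP => _; rewrite ?geq_minl.
case: ifP => b.
  have : ~~ bd i by apply: nb; lia.
  by rewrite b.
apply: leq_trans (geq_minr _ _) _; apply: (R_complete bx) => //; last by lia.
by move=> j Hj; apply: nb; lia.
Qed.

(** Either [a] lies in the segment of [p], where [loc] accounts for it, or the first boundary [y]
    after [a] has received a minimum taken over a stretch that contains [a]. *)
Lemma best p a tag loc : a <= p < ell -> (forall x, x <= ell -> bd x -> tag \in pm_ents (nu (vtx x))) ->
  (forall x, bd x -> (forall j, x < j <= p -> ~~ bd j) -> x <= a -> loc <= val a tag) ->
  loc <= val a tag \/ exists y, [/\ y <= p, bd y & R y tag <= val a tag].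
Proof.
move=> Ha tI L; have [x [o [e bx nb]]] := segment p.
have [xa|ax] := leqP x a; first by left; apply: (L x).
right; have ex : exists y, (a < y) && bd y by exists x; rewrite ax.
case: (ex_minnP ex) => y /andP [ay by_] ymin.
have yx : y <= x by apply: ymin; rewrite ax.
exists y; split=> //; first by lia.
have [x0 [o0 [e0 bx0 nb0]]] := segment a.
apply: (R_complete bx0); [|lia|lia|apply: tI => //; lia].
move=> i Hi; have [ia|ai] := leqP i a; first by apply: nb0; lia.
apply/negP => bi; have := ymin i; rewrite ai bi => /(_ isT); lia.
Qed.

Lemma ents_lm v u : Lam u -> (id u).*2 \in pm_ents (nu v).
Proof.
by move=> Lu; rewrite /pm_ents mem_cat; apply/orP; left; apply: map_f; apply/nu_lms; exists u.
Qed.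

Lemma ents_bp v z : z <= ell -> Lam (vtx z) -> z.*2.+1 \in pm_ents (nu v).
Proof.
move=> Hz Lz; rewrite /pm_ents !mem_cat; apply/orP; right; apply/orP; left.
by apply: (map_f (fun y => y.*2.+1)); apply/nu_bps.
Qed.

Lemma ents_near x z : x <= ell -> x < z <= x + h -> z.*2.+1 \in pm_ents (nu (vtx x)).
Proof.
move=> Hx Hz; rewrite /pm_ents !mem_cat; apply/orP; right; apply/orP; right.
apply: (map_f (fun y => y.*2.+1)); have [_ -> _ _] := nu_on Hx; rewrite mem_iota; lia.
Qed.
End Run.

Lemma pm_val_le m Fs Ls tag : start_value m Fs Ls tag <= INF.
Proof. by rewrite /start_value; case: ifP => _; [apply: lmin_top|apply: geq_minl]. Qed.

Lemma pm_wf B k v : 1 < n ^ B -> INF < n ^ B -> N.*2 <= n ^ B -> (ell + h).*2.+1 < n ^ B ->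
  size (sc_msg 1 (xi v) (prun sc_init (sc_msg 1) (sc_upd N pr (fun _ x => x)) I xi k v)) = 3 /\
  all (fun y => y < n ^ B) (sc_msg 1 (xi v) (prun sc_init (sc_msg 1) (sc_upd N pr (fun _ x => x)) I xi k v)).
Proof.
move=> h1 h2 h3 h4.
apply: (sc_wf (L := 1) (xi := xi) (lnk := fun _ x => x) inj idN vtx_adj vtx_pr vtx0_pr bd0 off_pr' k v h1) => x o tag bx tI Hl nb.
have [w -> [_ [a Ha ->]]] := pm_sent x o tag; rewrite /= andbT.
have le : val a tag < n ^ B by apply: leq_ltn_trans h2; apply: pm_val_le.
split=> //.
move: tI; rewrite /sc_ents /= /pm_ents !mem_cat => /or3P [] /mapP [y Hy ->].
- have [u _ <-] := (nu_lms _ _).1 Hy; apply: leq_trans h3; rewrite ltn_double; exact: idN.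
- have [Hy' _] := (nu_bps _ _).1 Hy; apply: leq_ltn_trans h4; rewrite ltnS leq_double; lia.
- have xl : x <= ell by lia.
  have [_ e _ _] := nu_on xl; rewrite e mem_iota in Hy.
  apply: leq_ltn_trans h4; rewrite ltnS leq_double; lia.
Qed.
End Half.

(** * Positions on the path *)

Section Chain.
Variables (n N h : nat).

(** Counting [s] and [t] as landmarks lets the path start at a boundary in both directions. *)
Definition is_landmark (x : LocalInput * bool) : bool := x.2 || li_is_s x.1 || li_is_t x.1.
Definition on_path (x : LocalInput * bool) : bool :=
  has (fun j => if li_nbr x.1 j is Some f then out_onP f || in_onP f else false) (iota 0 N).
(** A single tag suffices: each boundary sends its identifier with counters of hops and length,
    which [wk_lnk] advances on every edge. *)
Definition wk (x : LocalInput * bool) : sc_static :=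
  (on_path x && is_landmark x, [:: 0], fun=> [:: li_id x.1; 0; 0], fun _ y => y).
Definition wk_lnk (f : NbrInfo) (y : seq nat) : seq nat :=
  [:: nth 0 y 0; (nth 0 y 1).+1; nth 0 y 2 + odflt 0 (in_w f)].
Definition wk_rec (rec : seq (seq nat)) : seq nat := behead (head [::] rec).
Definition wk_pos x rec : seq nat := if on_path x && is_landmark x then [:: li_id x.1; 0; 0] else wk_rec rec.
(* [0]: off the path, [1]: s, [2]: inner vertex, [3]: t. *)
Definition wk_flag (x : LocalInput * bool) (rec : seq (seq nat)) : nat :=
  if li_is_s x.1 then 1 else if rec == [::] then 0 else if li_is_t x.1 then 3 else 2.
(* Identifier, flag, the previous landmark on the path, and the hops and length from it. *)
Definition wk_item x rec : seq nat :=
  let r := wk_rec rec in [:: li_id x.1; wk_flag x rec; nth 0 r 0; nth 0 r 1; nth 0 r 2].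
Definition wk_items x rec : seq (seq nat) := if is_landmark x then [:: wk_item x rec] else [::].

(** Follows the links to previous landmarks back to [s], adding up hops and lengths; [f] is fuel,
    and [n] is enough because positions decrease. *)
Fixpoint path_position (G : seq (seq nat)) f b : nat * nat :=
  if f is f'.+1 then
    let x := head [::] [seq x <- G | nth 0 x 0 == b] in
    if nth 0 x 1 == 1 then (0, 0)
    else let r := path_position G f' (nth 0 x 2) in (r.1 + nth 0 x 3, r.2 + nth 0 x 4)
  else (0, 0).

(* For [b = false] the path is read backwards, positions being counted from t. *)
Definition mk_ninfo (b : bool) (x : LocalInput * bool) (rec G : seq (seq nat)) : ninfo :=
  let w := wk_pos x rec in
  let r := path_position G n (nth 0 w 0) in
  let ix := r.1 + nth 0 w 1 in
  let p := r.2 + nth 0 w 2 in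
  let rt := path_position G n (nth 0 (head [::] [seq x <- G | nth 0 x 1 == 3]) 0) in
  let bps := undup [seq (path_position G n (nth 0 x 0)).1 | x <- G & nth 0 x 1 != 0] in
  NInfo (on_path x) (on_path x && is_landmark x) (if b then ix else rt.1 - ix) (if b then p else rt.2 - p)
    (if b then rt.2 - p else p) (undup [seq nth 0 x 0 | x <- G])
    (if b then bps else undup [seq rt.1 - y | y <- bps]).

Variable I : inst n.
Local Notation id := (gid I).
Local Notation vt := (vt (gs I) (gp I)).
Local Notation pre := (pre (gw I) (gs I) (gp I)).
Local Notation suf := (suf (gw I) (gs I) (gp I)).
Local Notation ell := (size (gp I)).
Hypothesis inj : injective id.
Hypothesis idN : forall v, id v < N.
Hypothesis wpos : forall u v, gE I u v -> 0 < gw I u v.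
Hypothesis SP : shortest_path (gE I) (gw I) (gs I) (gt I) (gp I).
Hypothesis ell0 : 0 < ell.

Definition Lam (v : 'I_n) : bool := glm I v || (v == gs I) || (v == gt I).
Hypothesis window : forall x, x + h <= ell -> exists i, x < i <= x + h /\ Lam (vt i).
Local Notation X0 v := (loc I v, glm I v).

Lemma nlamE v : is_landmark (X0 v) = Lam v. Proof. by []. Qed.

Lemma vt_adj i : i < ell -> adj (gE I) (vt i.+1) (vt i).
Proof. by move=> Hi; rewrite /adj (vt_edge SP Hi) orbT. Qed.

Lemma in_onP_vt i u : i < ell -> in_onP (link I (vt i.+1) u) = (u == vt i).
Proof.
move=> Hi; rewrite /=; apply/onPP/eqP => [[j Hj [-> e]]|->]; last by exists i.
by have := vt_inj wpos SP Hi Hj e; case=> ->.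
Qed.

Lemma out_onP_vt i u : i < ell -> out_onP (link I (vt i) u) = (u == vt i.+1).
Proof.
move=> Hi; rewrite /=; apply/onPP/eqP => [[j Hj [e ->]]|->]; last by exists i.
by have := vt_inj wpos SP (ltnW Hi) (ltnW Hj) e => ->.
Qed.

Lemma in_onP_vt0 u : ~~ in_onP (link I (vt 0) u).
Proof.
rewrite /=; apply/onPP => -[j Hj [_ e]].
by have := vt_inj wpos SP (leq0n _) Hj e.
Qed.

Lemma out_onP_vtl u : ~~ out_onP (link I (vt ell) u).
Proof.
rewrite /=; apply/onPP => -[j Hj [e _]].
by have := vt_inj wpos SP (leqnn _) (ltnW Hj) e; lia.
Qed.

Lemma onP_off v u : (forall i, i <= ell -> v != vt i) ->
  ~~ in_onP (link I v u) /\ ~~ out_onP (link I v u).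
Proof.
move=> off; rewrite /=; split; apply/onPP => -[j Hj [e1 e2]].
  by have := off j.+1 Hj; rewrite e2 eqxx.
by have := off j (ltnW Hj); rewrite e1 eqxx.
Qed.

Lemma nonP v : reflect (exists2 i, i <= ell & v = vt i) (on_path (X0 v)).
Proof.
have nb (u : 'I_n) : adj (gE I) v u -> li_nbr (loc I v) (id u) = Some (link I v u).
  move=> a; rewrite loc_nbr; case: pickP => [u' /andP [_ /eqP /inj ->] //|/(_ u)].
  by rewrite a eqxx.
apply: (iffP hasP) => [[j _]|[i Hi ->{}] ].
  rewrite [fst _]/= loc_nbr; case: pickP => // u /andP [a _] Hu.
  have [//|off] := pselect (exists2 i, i <= ell & v = vt i).
  have off' i : i <= ell -> v != vt i by move=> Hi; apply/eqP => e; apply: off; exists i.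
  by move: Hu; have [/negPf -> /negPf ->] := onP_off u off'.
have [ei|lt] := eqVneq i ell.
  have e1 : i = i.-1.+1 by lia.
  have l1 : i.-1 < ell by lia.
  have a := vt_adj l1; rewrite -e1 in a.
  exists (id (vt i.-1)); first by rewrite mem_iota add0n idN.
  rewrite [fst _]/= loc_nbr; case: pickP => [u /andP [_ /eqP /inj ->]|/(_ (vt i.-1))]; last by rewrite a eqxx.
  by have := in_onP_vt (vt i.-1) l1; rewrite -e1 eqxx => ->; rewrite orbT.
have l1 : i < ell by lia.
have a := vt_adj l1.
exists (id (vt i.+1)); first by rewrite mem_iota add0n idN.
rewrite [fst _]/= loc_nbr; case: pickP => [u /andP [_ /eqP /inj ->]|/(_ (vt i.+1))].
  by rewrite out_onP_vt // eqxx.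
by rewrite /adj orbC -/(adj (gE I) _ _) a eqxx.
Qed.

Lemma non_vt i : i <= ell -> on_path (X0 (vt i)). Proof. by move=> Hi; apply/nonP; exists i. Qed.

Lemma non_off v : (forall i, i <= ell -> v != vt i) -> on_path (X0 v) = false.
Proof. by move=> off; apply/negP => /nonP [i /off /eqP]. Qed.

Lemma pre_mono i j : i <= j <= ell -> pre i <= pre j.
Proof.
move=> /andP [/subnKC <-]; elim: (j - i) => [|k IH] Hk; first by rewrite addn0.
rewrite addnS in Hk *; rewrite (pre_S _ _ Hk); apply: leq_trans (IH (ltnW Hk)) (leq_addr _ _).
Qed.

Local Notation xw := (fun v => wk (X0 v)).
Local Notation rec v := (prun sc_init (sc_msg 3) (sc_upd N in_onP wk_lnk) I xw h v).2.

Lemma wk_bdE i : i <= ell -> sc_bd (xw (vt i)) = Lam (vt i).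
Proof. by move=> Hi; rewrite /sc_bd /= non_vt. Qed.

Lemma Lam_s : Lam (gs I). Proof. by rewrite /Lam eqxx orbT. Qed.
Lemma Lam_t : Lam (gt I). Proof. by rewrite /Lam eqxx orbT. Qed.

Lemma wk_bd0 : sc_bd (xw (vt 0)). Proof. by rewrite wk_bdE // Lam_s. Qed.

Lemma wk_off v : (forall i, i <= ell -> v != vt i) ->
  ~~ sc_bd (xw v) /\ forall u, adj (gE I) v u -> ~~ in_onP (link I v u).
Proof.
by move=> off; split; [rewrite /sc_bd /= non_off|move=> u _; case: (onP_off u off)].
Qed.

Lemma wk_sent x o tag : x + o <= ell ->
  sc_sent wk_lnk I xw vt x o tag = [:: id (vt x); o; pre (x + o) - pre x].
Proof.
elim: o => [|o IH] Hl; first by rewrite /= addn0 subnn.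
have Hl' : x + o < ell by rewrite -addnS.
rewrite sc_sentS /sc_recv IH 1?ltnW //= /wk_lnk /= (vt_edge SP Hl') /= addnS (pre_S _ _ Hl').
congr [:: _; _; _]; have := @pre_mono x (x + o); lia.
Qed.

Lemma wk_segment y : 0 < y <= ell -> exists x o, [/\ (x + o).+1 = y, sc_bd (xw (vt x)),
  forall j, x < j <= x + o -> ~~ sc_bd (xw (vt j)) & o < h].
Proof.
case: y => [//|y] /= Hy.
have [x [o [e bx nb]]] := last_bd (bd := fun i => sc_bd (xw (vt i))) y wk_bd0.
exists x, o; rewrite e; split=> //; rewrite ltnNge; apply/negP => ho.
have [|i [Hi Li]] := @window x; first by lia.
by have : ~~ sc_bd (xw (vt i)); [apply: nb; lia|rewrite wk_bdE ?Li //; lia].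
Qed.

Lemma wk_rec_vt y : 0 < y <= ell -> exists x, [/\ x < y, Lam (vt x), rec (vt y) != [::] &
  wk_rec (rec (vt y)) = [:: id (vt x); y - x; pre y - pre x]].
Proof.
move=> Hy; have [x [o [e bx nb ho]]] := wk_segment Hy.
have xo : x + o < ell by lia.
have P c := scan 3 wk_lnk inj idN vt_adj (fun i u H _ => in_onP_vt u H) wk_bd0 c bx nb xo (k := h).
have {}P c : c \in rec (vt y) <-> c = [:: 0; id (vt x); y - x; pre y - pre x].
  rewrite -e; have {}P := P c; rewrite addn1 in P; rewrite (P ho); split.
    move=> [tag]; rewrite inE => /eqP -> ->; rewrite /sc_recv wk_sent 1?ltnW // /wk_lnk /=.
    rewrite (vt_edge SP xo) /= (pre_S _ _ xo); have := @pre_mono x (x + o) => pm.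
    congr [:: _; _; _; _]; lia.
  move=> ->; exists 0; rewrite ?inE // /sc_recv wk_sent 1?ltnW // /wk_lnk /=.
  rewrite (vt_edge SP xo) /= (pre_S _ _ xo); have := @pre_mono x (x + o) => pm.
  congr [:: _; _; _; _]; lia.
exists x; split; first by lia.
- by rewrite -wk_bdE //; lia.
- by apply/eqP => e0; have [_ /(_ erefl)] := P [:: 0; id (vt x); y - x; pre y - pre x]; rewrite e0.
rewrite /wk_rec; case E: (rec (vt y)) => [|c s].
  by have [_ /(_ erefl)] := P [:: 0; id (vt x); y - x; pre y - pre x]; rewrite E.
have cI : c \in rec (vt y) by rewrite E mem_head.
by rewrite /= ((P c).1 cI).
Qed.

Lemma wk_rec_nil v : v = vt 0 \/ (forall i, i <= ell -> v != vt i) -> rec v = [::].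
Proof.
move=> Hv; have [] // := sc_rec_off 3 wk_lnk (xi := xw) inj idN (fun u _ => in_onP_vt0 u) wk_off h Hv.
Qed.

Lemma wk_pos_vt i : i <= ell -> exists x, [/\ x <= i, Lam (vt x) &
  wk_pos (X0 (vt i)) (rec (vt i)) = [:: id (vt x); i - x; pre i - pre x]].
Proof.
move=> Hi; rewrite /wk_pos non_vt //= nlamE; case: ifP => L.
  by exists i; rewrite !subnn.
have [|x [h1 h2 _ h3]] := @wk_rec_vt i; last by exists x; rewrite ltnW.
by rewrite Hi andbT lt0n; apply/eqP => e; rewrite e Lam_s in L.
Qed.

Lemma vt0 : vt 0 = gs I. Proof. by []. Qed.

Lemma vt_s i : i <= ell -> (vt i == gs I) = (i == 0).
Proof.
move=> Hi; apply/eqP/eqP => [|-> //]; rewrite -vt0; exact: (vt_inj wpos SP).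
Qed.

Lemma vt_t i : i <= ell -> (vt i == gt I) = (i == ell).
Proof.
move=> Hi; rewrite -(vt_last SP); apply/eqP/eqP => [|-> //]; exact: (vt_inj wpos SP).
Qed.

Lemma wk_item_vt y : y <= ell -> exists2 c, c = wk_item (X0 (vt y)) (rec (vt y)) &
  [/\ nth 0 c 0 = id (vt y), (nth 0 c 1 == 1) = (y == 0), nth 0 c 1 != 0, (nth 0 c 1 == 3) = (y == ell) &
   0 < y -> exists x, [/\ x < y, Lam (vt x), nth 0 c 2 = id (vt x), nth 0 c 3 = y - x &
     nth 0 c 4 = pre y - pre x]].
Proof.
move=> Hy; eexists; first by reflexivity.
rewrite /wk_item /wk_flag [li_is_s _]/= [li_is_t _]/= vt_s // vt_t //.
case: posnP => [y0|y0]; first by rewrite y0 eqxx /=; split=> //; rewrite (ltn_eqF ell0).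
have [|x [h1 h2 h3 h4]] := @wk_rec_vt y; first by rewrite y0.
rewrite (negPf h3) h4; split=> //; try by case: (y == ell).
by move=> _; exists x.
Qed.

Lemma wk_item_off v : (forall i, i <= ell -> v != vt i) -> nth 0 (wk_item (X0 v) (rec v)) 1 = 0.
Proof.
move=> off; have := off 0 (leq0n _); rewrite vt0 => /negPf e.
by rewrite /wk_item /wk_flag [li_is_s _]/= e /= wk_rec_nil //; right.
Qed.

(** * Positions recovered from the first broadcast *)

Section Decode.
Variable G : seq (seq nat).
Hypothesis HG : forall c, c \in G <-> exists u, c \in wk_items (X0 u) (rec u).

Lemma HG' c : c \in G <-> exists2 u, Lam u & c = wk_item (X0 u) (rec u).
Proof.
rewrite HG; split=> -[u]; last by move=> Lu ->; exists u; rewrite /wk_items nlamE Lu inE.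
by rewrite /wk_items nlamE; case: ifP => // Lu; rewrite inE => /eqP ->; exists u.
Qed.

Lemma lookup u : Lam u -> head [::] [seq x <- G | nth 0 x 0 == id u] = wk_item (X0 u) (rec u).
Proof.
move=> Lu; have : wk_item (X0 u) (rec u) \in [seq x <- G | nth 0 x 0 == id u].
  by rewrite mem_filter eqxx /=; apply/HG'; exists u.
case E: [seq c <- _ | _] => [//|c s] _ /=.
have : c \in [seq x <- G | nth 0 x 0 == id u] by rewrite E mem_head.
by rewrite mem_filter => /andP [e /HG' [u' _ ec]]; move: e; rewrite ec /= => /eqP /inj ->.
Qed.

Lemma posn_vt f y : y <= ell -> y < f -> Lam (vt y) -> path_position G f (id (vt y)) = (y, pre y).
Proof.
elim/ltn_ind: y f => y IH [//|f] Hy yf Ly /=; rewrite lookup //.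
have [c -> [_ -> _ _ H]] := wk_item_vt Hy.
case: posnP => [->|y0]; first by rewrite pre0.
have [x [xy Lx -> -> ->]] := H y0; rewrite IH //; [|lia|lia].
have pm : pre x <= pre y by apply: pre_mono; lia.
by congr (_, _); rewrite /= subnKC // ltnW.
Qed.

Lemma ell_n : ell < n.
Proof.
have := max_card (mem (gs I :: gp I)); rewrite (card_uniqP (shortest_uniq wpos SP)) card_ord /=.
by [].
Qed.

Lemma posn_vtn y : y <= ell -> Lam (vt y) -> path_position G n (id (vt y)) = (y, pre y).
Proof. by move=> Hy; apply: posn_vt => //; have := ell_n; lia. Qed.

Lemma posn_end : path_position G n (nth 0 (head [::] [seq x <- G | nth 0 x 1 == 3]) 0) = (ell, pre ell).
Proof.
have [c ec [e1 _ _ e2 _]] := wk_item_vt (leqnn ell); rewrite eqxx in e2.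
have Lt : Lam (vt ell) by rewrite (vt_last SP) Lam_t.
have : c \in [seq x <- G | nth 0 x 1 == 3].
  by rewrite mem_filter e2; apply/HG'; exists (vt ell).
case E: [seq c <- _ | _] => [//|c' s] _ /=.
have : c' \in [seq x <- G | nth 0 x 1 == 3] by rewrite E mem_head.
rewrite mem_filter => /andP [f /HG' [u Lu ec']].
have [[i Hi eu]|off] := pselect (exists2 i, i <= ell & u = vt i); last first.
  have off' i : i <= ell -> u != vt i by move=> Hi; apply/eqP => e; apply: off; exists i.
  by rewrite ec' wk_item_off in f.
have [c2 ec2 [e3 _ _ e4 _]] := wk_item_vt Hi.
rewrite ec' eu -ec2 e4 in f; rewrite ec' eu -ec2 e3 (eqP f) posn_vtn //.
Qed.

Definition vtb (b : bool) i := if b then vt i else vt (ell - i).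
Definition preb (b : bool) i := if b then pre i else suf (ell - i).
Definition sufb (b : bool) i := if b then suf i else pre (ell - i).

Lemma bps_mem y : y \in undup [seq (path_position G n (nth 0 x 0)).1 | x <- G & nth 0 x 1 != 0] <->
  y <= ell /\ Lam (vt y).
Proof.
rewrite mem_undup; split.
  move=> /mapP [c]; rewrite mem_filter => /andP [f /HG' [u Lu ec]] ->.
  have [[i Hi eu]|off] := pselect (exists2 i, i <= ell & u = vt i); last first.
    have off' i : i <= ell -> u != vt i by move=> Hi; apply/eqP => e; apply: off; exists i.
    by rewrite ec wk_item_off in f.
  have [c2 ec2 [e3 _ _ _ _]] := wk_item_vt Hi; subst u.
  by rewrite ec -ec2 e3 posn_vtn.
move=> [Hy Ly]; have [c ec [e1 _ e2 _ _]] := wk_item_vt Hy.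
apply/mapP; exists c; last by rewrite e1 posn_vtn.
by rewrite mem_filter e2; apply/HG'; exists (vt y).
Qed.

Lemma suf_pre i : i <= ell -> suf i = pre ell - pre i.
Proof.
move=> Hi; have := pre_suf (gw I) (gs I) Hi; have := pre_suf (gw I) (gs I) (leqnn ell).
have -> : suf ell = 0 by rewrite /suf drop_size weight_nil.
lia.
Qed.

Lemma pre_tot i : i <= ell -> pre i <= pre ell.
Proof. by move=> Hi; apply: pre_mono; rewrite Hi leqnn. Qed.

Local Notation nu b v := (mk_ninfo b (X0 v) (rec v) G).

Lemma nu_on b i : i <= ell -> [/\ ni_on (nu b (vtb b i)), ni_ix (nu b (vtb b i)) = i,
  ni_pre (nu b (vtb b i)) = preb b i & ni_suf (nu b (vtb b i)) = sufb b i].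
Proof.
move=> Hi; rewrite /mk_ninfo /= posn_end.
have K j : j <= ell -> on_path (X0 (vt j)) /\ exists x, [/\ x <= j, wk_pos (X0 (vt j)) (rec (vt j)) =
   [:: id (vt x); j - x; pre j - pre x] & path_position G n (id (vt x)) = (x, pre x)].
  move=> Hj; split; first exact: non_vt.
  have [x [h1 h2 h3]] := wk_pos_vt Hj; exists x; rewrite posn_vtn //; exact: leq_trans h1 Hj.
case: b; rewrite /vtb /preb /sufb.
  have [-> [x [xi -> ep]]] := K _ Hi; have pm : pre x <= pre i by apply: pre_mono; lia.
  rewrite /= ep /= !subnKC // suf_pre //.
have Hj : ell - i <= ell by lia.
have [-> [x [xi -> ep]]] := K _ Hj; have pm : pre x <= pre (ell - i) by apply: pre_mono; lia.
rewrite /= ep /= !subnKC // suf_pre // subKn //.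
Qed.

Lemma nu_off b v : (forall i, i <= ell -> v != vtb b i) -> ni_on (nu b v) = false.
Proof.
move=> off; apply: non_off => i Hi; case: b off => off; first exact: off.
by have := off (ell - i); rewrite /vtb subKn //; apply; lia.
Qed.

Lemma nu_bd b v : ni_bd (nu b v) = ni_on (nu b v) && Lam v.
Proof. by rewrite /= nlamE. Qed.

Lemma nu_lms b v l : l \in ni_lms (nu b v) <-> exists2 u, Lam u & id u = l.
Proof.
rewrite /= mem_undup; split.
  by move=> /mapP [c /HG' [u Lu ->] ->]; exists u.
by move=> [u Lu <-]; apply/mapP; exists (wk_item (X0 u) (rec u)) => //; apply/HG'; exists u.
Qed.

Lemma nu_bps b v y : y \in ni_bps (nu b v) <-> y <= ell /\ Lam (vtb b y).
Proof.
rewrite /= posn_end; case: b; first exact: bps_mem.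
rewrite mem_undup; split.
  by move=> /mapP [z /bps_mem [Hz Lz] ->] /=; rewrite /vtb subKn //; split=> //; lia.
move=> [Hy Ly]; apply/mapP; exists (ell - y); last by rewrite /= subKn.
by apply/bps_mem; split=> //; lia.
Qed.

Lemma size_lms b v : size (ni_lms (nu b v)) <= #|[set v | Lam v]|.
Proof.
rewrite cardE -(size_map id); apply: uniq_leq_size; first exact: undup_uniq.
move=> l /nu_lms [u Lu <-]; apply: map_f; by rewrite mem_enum inE.
Qed.

Lemma size_bps b v : size (ni_bps (nu b v)) <= #|[set v | Lam v]|.
Proof.
have K : size (ni_bps (nu true v)) <= #|[set v | Lam v]|.
  rewrite cardE -(size_map (fun u => index u (gs I :: gp I))); apply: uniq_leq_size; first exact: undup_uniq.
  move=> y /nu_bps [Hy Ly]; apply/mapP; exists (vt y); first by rewrite mem_enum inE.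
  by apply/esym; apply: index_uniq; rewrite ?(shortest_uniq wpos SP).
case: b => //; apply: leq_trans K; apply: leq_trans (size_undup _) _.
by rewrite size_map.
Qed.
End Decode.

Lemma wk_wf B k v : 1 < n ^ B -> N <= n ^ B -> n <= n ^ B -> pre ell < n ^ B ->
  size (sc_msg 3 (xw v) (prun sc_init (sc_msg 3) (sc_upd N in_onP wk_lnk) I xw k v)) = 5 /\
  all (fun y => y < n ^ B) (sc_msg 3 (xw v) (prun sc_init (sc_msg 3) (sc_upd N in_onP wk_lnk) I xw k v)).
Proof.
move=> h1 h2 h3 h4.
apply: (sc_wf (L := 3) (xi := xw) (lnk := wk_lnk) inj idN vt_adj (fun i u H _ => in_onP_vt u H)
  (fun u _ => in_onP_vt0 u) wk_bd0 wk_off k v h1) => x o tag bx tI Hl nb.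
rewrite wk_sent //=; split=> //; first by move: tI; rewrite inE => /eqP ->; lia.
have := pre_tot Hl; have := ell_n; have := idN (vt x); lia.
Qed.

Lemma item_wf B u c : 3 < n ^ B -> N <= n ^ B -> n <= n ^ B -> pre ell < n ^ B ->
  c \in wk_items (X0 u) (rec u) -> size c = 5 /\ all (fun y => y < n ^ B) c.
Proof.
move=> h1 h2 h3 h4; rewrite /wk_items; case: ifP => // _; rewrite inE => /eqP ->.
have idu := leq_trans (idN u) h2.
split=> //.
have fl : wk_flag (X0 u) (rec u) < n ^ B.
  by apply: leq_ltn_trans h1; rewrite /wk_flag; do 3 case: ifP => // _.
have K : all (fun y => y < n ^ B) [:: nth 0 (wk_rec (rec u)) 0; nth 0 (wk_rec (rec u)) 1; nth 0 (wk_rec (rec u)) 2].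
  have [[y Hy ->]|off] := pselect (exists2 y, 0 < y <= ell & u = vt y).
    have [x [xy _ _ ->]] := wk_rec_vt Hy; rewrite /=.
    have := pre_tot (proj2 (andP Hy)); have := ell_n; have := idN (vt x); lia.
  rewrite wk_rec_nil /=; first by lia.
  have [e|ne] := eqVneq u (vt 0); [by left|right=> i Hi].
  by apply/eqP => e; apply: off; exists i => //; case: i Hi e => // _ e; rewrite e eqxx in ne.
by move: K; rewrite /= idu fl.
Qed.
End Chain.

(** * Both directions and the output *)

Lemma lminP top s : lmin top s \in top :: s.
Proof.
have := lmin_top top s; rewrite leq_eqVlt => /orP [/eqP ->|/lmin_mem]; first exact: mem_head.
by rewrite inE orbC => ->.
Qed.

Section Output.
Variables (n H S INF : nat).
Variables (nb : bool -> ninfo) (Fs Ls : bool -> nat -> nat -> nat) (rt rf G2 : seq (seq nat)).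

(** Kind 0 are arcs between landmarks, kinds 1 and 2 the totals of the forward and of the mirrored
    scan at a boundary. Mirrored totals carry landmark tags only: a short detour with both ends
    outside the segment is found by the forward totals. Capping at [INF] makes a total fit into a
    message. *)
Definition items2 (x : LocalInput * bool) : seq (seq nat) :=
  if is_landmark x then
    [seq [:: 0; li_id x.1; l; landmark_est INF H S (Ls true) l] | l <- ni_lms (nb true)] ++
    (if ni_on (nb true) then
      [seq [:: 1; ni_ix (nb true); tag; minn INF (pm_get INF rt tag)] |
        tag <- [seq l.*2 | l <- ni_lms (nb true)] ++ [seq y.*2.+1 | y <- ni_bps (nb true)]] ++
      [seq [:: 2; ni_ix (nb true); l.*2; minn INF (pm_get INF rf l.*2)] | l <- ni_lms (nb true)]
    else [::])
  else [::].

Definition o_acc tag := pm_acc INF H S (nb true) (Fs true) (Ls true) rt tag.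
(* [o_al l] estimates the cost from s to landmark [l], and [o_be l] from [l] to t, both avoiding the edge. *)
Definition o_al l := lmin (o_acc l.*2) [seq nth 0 x 3 | x <- G2 &
  [&& nth 0 x 0 == 1, nth 0 x 1 <= ni_ix (nb true) & nth 0 x 2 == l.*2]].
Definition o_be l := lmin (pm_get INF rf l.*2) [seq nth 0 x 3 | x <- G2 &
  [&& nth 0 x 0 == 2, ni_ix (nb true) < nth 0 x 1 & nth 0 x 2 == l.*2]].
(** Forward, a detour may leave at [v_i] itself and must rejoin at [i + 1] or later. In mirrored
    positions the edge runs from [ell - i - 1] to [ell - i]: the threshold is the own position of
    [v_i], and its own value must not count, whence [pm_get] instead of [o_acc]. *)
Definition o_near := minn (o_acc (ni_ix (nb true)).+1.*2.+1) (pm_get INF rf (ni_ix (nb false)).*2.+1).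
Definition o_far := lmin INF [seq nth 0 x 3 | x <- G2 &
  [&& nth 0 x 0 == 1, nth 0 x 1 <= ni_ix (nb true), odd (nth 0 x 2) & ni_ix (nb true) < (nth 0 x 2)./2]].
(** Bellman-Ford on the graph of landmarks, with initial values [o_al]. *)
Fixpoint o_D t l := if t is t'.+1 then
    lmin (o_D t' l) [seq o_D t' (nth 0 x 1) + nth 0 x 3 | x <- G2 & (nth 0 x 0 == 0) && (nth 0 x 2 == l)]
  else o_al l.
Definition o_long := lmin INF [seq o_D n l + o_be l | l <- ni_lms (nb true)].
Definition o_val := minn o_near (minn o_far o_long).
End Output.

(** * The forward and the mirrored run *)

Section Directions.
Variables (n N h H S K kq INF : nat).

(** Distances are measured towards landmarks and rejoining vertices, so the forward run uses
    outgoing edges; edges of [P] are given no length. *)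
Definition lenb (b : bool) (i : nat) (f : NbrInfo) : option nat :=
  if b then (if out_onP f then None else omap (fun w => cdiv w (2 ^ i)) (out_w f))
  else (if in_onP f then None else omap (fun w => cdiv w (2 ^ i)) (in_w f)).

Variables (I : inst n) (G : 'I_n -> seq (seq nat)).
Local Notation id := (gid I).
Local Notation vt := (vt (gs I) (gp I)).
Local Notation pre := (pre (gw I) (gs I) (gp I)).
Local Notation suf := (suf (gw I) (gs I) (gp I)).
Local Notation ell := (size (gp I)).
Local Notation Lam := (Lam I).
Local Notation X0 v := (loc I v, glm I v).
Local Notation wrec v := (prun sc_init (sc_msg 3) (sc_upd N (fun f => in_onP f) wk_lnk) I (fun v => wk N (X0 v)) h v).2.
Local Notation vtb := (vtb I).
Local Notation preb := (preb I).
Local Notation sufb := (sufb I).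
Hypothesis inj : injective id.
Hypothesis idN : forall v, id v < N.
Hypothesis wpos : forall u v, gE I u v -> 0 < gw I u v.
Hypothesis SP : shortest_path (gE I) (gw I) (gs I) (gt I) (gp I).
Hypothesis ell0 : 0 < ell.
Hypothesis window : forall x, x + h <= ell -> exists i, x < i <= x + h /\ Lam (vt i).
Hypothesis HG : forall v c, c \in G v <-> exists u, c \in wk_items (X0 u) (wrec u).
Hypothesis cardL : #|[set v | Lam v]| <= K.
Hypothesis preINF : pre ell < INF.
Hypothesis HE : H = (kq.*2 + 1) * h.
Hypothesis kq0 : 0 < kq.

Definition ge (b : bool) : rel 'I_n := fun v u =>
  if b then offP (gE I) (gs I) (gp I) v u else offP (gE I) (gs I) (gp I) u v.
Definition wb (b : bool) (v u : 'I_n) : nat := if b then gw I v u else gw I u v.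

Lemma ge_adj b v u : ge b v u -> adj (gE I) v u.
Proof. by case: b => /andP [e _]; rewrite /adj e ?orbT. Qed.

Lemma ew_pos b i v u : ge b v u -> 0 < rw (wb b) (2 ^ i) v u.
Proof. by case: b => /andP [e _]; apply: cdiv_gt0; rewrite ?expn_gt0 //; apply: wpos. Qed.

Lemma lenP b i v u : adj (gE I) v u ->
  lenb b i (link I v u) = if ge b v u then Some (rw (wb b) (2 ^ i) v u) else None.
Proof.
move=> _; case: b; rewrite /lenb /ge /offP /=.
  by case: (onP _ v u); case: (gE I v u).
by case: (onP _ u v); case: (gE I u v).
Qed.

Definition nu (b : bool) (v : 'I_n) : ninfo := mk_ninfo n N b (X0 v) (wrec v) (G v).
Definition furthest (b : bool) (v : 'I_n) (i z : nat) : nat := if S < i then 0 else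
  (prun fu_init fu_msg (fu_upd N (lenb b i)) I (fun v => kappa INF (nu b v)) H v).2 z.
Definition landmark_dist (b : bool) (v : 'I_n) (i l : nat) : nat := if S < i then 0 else
  (prun (lp_init H) (lp_msg N H) (lp_upd N H (lenb b i)) I (fun v => (is_landmark (X0 v), id v)) (H + K) v).1 l.

Local Notation fr := furthest.
Local Notation lr := landmark_dist.

Lemma fr_sound b v i z : i <= S -> exists q, [/\ path (ge b) v q,
  weight (rw (wb b) (2 ^ i)) v q <= z & fr b v i z = kappa INF (nu b (last v q))].
Proof.
by move=> Hi; rewrite /fr ltnNge Hi; apply: (fu_sound (fun v => kappa INF (nu b v)) inj idN (@lenP b i)).
Qed.

Lemma fr_complete b v i z q : i <= S -> z <= H -> path (ge b) v q ->
  weight (rw (wb b) (2 ^ i)) v q <= z -> kappa INF (nu b (last v q)) <= fr b v i z.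
Proof.
move=> Hi Hz Pq wq; rewrite /fr ltnNge Hi /=.
apply: (fu_complete (fun v => kappa INF (nu b v)) inj idN (@lenP b i) (@ge_adj b) (@ew_pos b i)) => //.
exact: leq_trans Hz.
Qed.

Lemma lr_det b v i l : i <= S ->
  (lr b v i l <= H -> exists q, [/\ path (ge b) v q, Lam (last v q), id (last v q) = l &
      weight (rw (wb b) (2 ^ i)) v q = lr b v i l]) /\
  (forall d, (exists q, [/\ path (ge b) v q, Lam (last v q), id (last v q) = l &
      weight (rw (wb b) (2 ^ i)) v q = d]) -> d <= H -> lr b v i l <= d).
Proof.
move=> Hi; rewrite /lr ltnNge Hi /=.
apply: (source_detection (xi := fun v => (is_landmark (X0 v), id v)) inj idN (fun v => erefl)
  (@lenP b i) (@ge_adj b) (@ew_pos b i)).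
by rewrite leq_add2l.
Qed.

Lemma suf_anti b i j : i <= j <= ell -> sufb b j <= sufb b i.
Proof.
move=> Hij; rewrite /sufb; case: b; last by apply: pre_mono; lia.
rewrite !(suf_pre ell0); try lia.
by apply: leq_sub2l; apply: pre_mono.
Qed.

Lemma suf_INF b i : i <= ell -> sufb b i < INF.
Proof.
move=> Hi; apply: leq_ltn_trans preINF; rewrite /sufb; case: b; last by apply: pre_tot; lia.
by rewrite (suf_pre ell0) //; lia.
Qed.

Definition prb (b : bool) (f : NbrInfo) : bool := if b then in_onP f else out_onP f.

Lemma vtb_adj b i : i < ell -> adj (gE I) (vtb b i.+1) (vtb b i).
Proof.
move=> Hi; case: b; rewrite /vtb; first exact: (vt_adj SP).
have -> : ell - i = (ell - i.+1).+1 by lia.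
by rewrite (adj_sym I) (vt_adj SP) //; lia.
Qed.

Lemma vtb_pr b i u : i < ell -> adj (gE I) (vtb b i.+1) u ->
  prb b (link I (vtb b i.+1) u) = (u == vtb b i).
Proof.
move=> Hi _; case: b; rewrite /vtb; first exact: (in_onP_vt wpos SP).
have -> : ell - i = (ell - i.+1).+1 by lia.
by apply: (out_onP_vt wpos SP); lia.
Qed.

Lemma vtb0_pr b u : adj (gE I) (vtb b 0) u -> ~~ prb b (link I (vtb b 0) u).
Proof.
move=> _; case: b; rewrite /vtb; first exact: (in_onP_vt0 wpos SP).
by rewrite subn0; apply: (out_onP_vtl wpos SP ell0).
Qed.

Lemma vtb_off b v : (forall i, i <= ell -> v != vtb b i) -> forall i, i <= ell -> v != vt i.
Proof.
move=> off i Hi; case: b off => off; first exact: off.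
by have := off (ell - i); rewrite /vtb subKn //; apply; lia.
Qed.

Lemma offb_pr b v : (forall i, i <= ell -> v != vtb b i) ->
  forall u, adj (gE I) v u -> ~~ prb b (link I v u).
Proof. by move=> /vtb_off off u _; have [h1 h2] := onP_off u off; case: (b). Qed.

Lemma Lamb0 b : Lam (vtb b 0).
Proof.
by case: b; rewrite /vtb; [apply: Lam_s|rewrite subn0 (vt_last SP); apply: Lam_t].
Qed.

Lemma windowb b x : x + h <= ell -> exists i, x < i <= x + h /\ Lam (vtb b i).
Proof.
move=> Hx; case: b; first exact: window.
(* Windows are open on the left, so the mirror image has to be shifted by one; where the shift would
   leave the path, the window ends at [s], a landmark. *)
have [e|p] := posnP (ell - x - h).
  exists (x + h); split; last by have -> : vtb false (x + h) = vtb true 0; [rewrite /vtb; congr vt; lia|apply: Lamb0].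
  by have [|i [Hi _]] := @window 0; lia.
have [|i [Hi Li]] := @window (ell - x - h).-1; first by lia.
exists (ell - i); split; first by lia.
by rewrite /vtb subKn //; lia.
Qed.

Local Notation rec b v := (prun sc_init (sc_msg 1) (sc_upd N (prb b) (fun _ x => x)) I
  (fun u0 => pm_static INF H S h (nu b u0) (fr b u0) (lr b u0)) (h + (K + K + h)) v).2.
Definition val b a := start_value INF H S (nu b (vtb b a)) (fr b (vtb b a)) (lr b (vtb b a)).
Definition R b v := pm_get INF (rec b v).
Definition Acc b v := pm_acc INF H S (nu b v) (fr b v) (lr b v) (rec b v).

Lemma nub_on b i : i <= ell -> [/\ ni_on (nu b (vtb b i)), ni_ix (nu b (vtb b i)) = i,
  ni_pre (nu b (vtb b i)) = preb b i & ni_suf (nu b (vtb b i)) = sufb b i].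
Proof. by move=> Hi; apply: (nu_on inj idN wpos SP ell0 window (HG _)). Qed.

Lemma nub_off b v : (forall i, i <= ell -> v != vtb b i) -> ni_on (nu b v) = false.
Proof. by move=> off; apply: (nu_off h inj idN wpos SP ell0 (G v) off). Qed.

Lemma nub_lms b v l : l \in ni_lms (nu b v) <-> exists2 u, Lam u & id u = l.
Proof. exact: (nu_lms (HG v)). Qed.

Lemma nub_bps b v y : y \in ni_bps (nu b v) <-> y <= ell /\ Lam (vtb b y).
Proof. exact: (nu_bps inj idN wpos SP ell0 window (HG v)). Qed.

Lemma dt_sound b v l : landmark_est INF H S (lr b v) l < INF ->
  exists2 u, Lam u /\ id u = l & conn (ge b) (wb b) v u (landmark_est INF H S (lr b v) l).
Proof. by apply: dtv_sound => v' i l' Hi; case: (lr_det b v' l' Hi). Qed.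

Lemma lr_complete b v i l q : i <= S -> path (ge b) v q -> Lam (last v q) ->
  id (last v q) = l -> weight (rw (wb b) (2 ^ i)) v q <= H -> lr b v i l <= weight (rw (wb b) (2 ^ i)) v q.
Proof. by move=> Hi Pq Lq iq wq; have [_] := lr_det b v l Hi; apply=> //; exists q. Qed.

Lemma dt_complete b v q : path (ge b) v q -> Lam (last v q) -> size q <= h -> weight (wb b) v q < 2 ^ S ->
  kq * landmark_est INF H S (lr b v) (id (last v q)) <= kq.+1 * weight (wb b) v q.
Proof. exact: (dtv_complete INF kq0 HE (@lr_complete b)). Qed.

Lemma nub_bd b v : ni_bd (nu b v) = ni_on (nu b v) && Lam v. Proof. by []. Qed.

Lemma lr_sound b v i l : i <= S -> lr b v i l <= H ->
  exists q, [/\ path (ge b) v q, Lam (last v q), id (last v q) = l & weight (rw (wb b) (2 ^ i)) v q = lr b v i l].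
Proof. by move=> Hi; case: (lr_det b v l Hi). Qed.

Lemma val_thr_sound b a y : a <= ell -> val b a y.*2.+1 < INF ->
  exists c d, [/\ y <= c <= ell, conn (ge b) (wb b) (vtb b a) (vtb b c) d &
    preb b a + d + sufb b c <= val b a y.*2.+1].
Proof.
rewrite /val /start_value /= odd_double uphalf_double.
exact: (vthr_sound kq0 HE (@suf_INF b) (Lamb0 b) (@nub_on b) (@nub_off b) (@fr_sound b)).
Qed.

Lemma val_thr_complete b a c y q : a <= ell -> y <= c <= ell -> path (ge b) (vtb b a) q ->
  last (vtb b a) q = vtb b c -> size q <= h -> weight (wb b) (vtb b a) q < 2 ^ S ->
  kq * val b a y.*2.+1 <= kq * (preb b a + sufb b c) + kq.+1 * weight (wb b) (vtb b a) q.
Proof.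
rewrite /val /start_value /= odd_double uphalf_double.
exact: (vthr_complete kq0 HE (@suf_anti b) (@suf_INF b) (Lamb0 b) (@nub_on b) (@nub_off b)
  (@fr_sound b) (@fr_complete b)).
Qed.

Lemma val_lm_sound b a l : a <= ell -> val b a l.*2 < INF ->
  exists u c, [/\ Lam u, id u = l, conn (ge b) (wb b) (vtb b a) u c & preb b a + c <= val b a l.*2].
Proof. exact: (vlm_sound kq0 HE (Lamb0 b) (@nub_on b) (@lr_sound b)). Qed.

Lemma val_lm_complete b a q : a <= ell -> path (ge b) (vtb b a) q -> Lam (last (vtb b a) q) ->
  size q <= h -> weight (wb b) (vtb b a) q < 2 ^ S ->
  kq * val b a (id (last (vtb b a) q)).*2 <= kq * preb b a + kq.+1 * weight (wb b) (vtb b a) q.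
Proof. exact: (vlm_complete INF (fr b) kq0 HE (@nub_on b) (@lr_complete b)). Qed.

Lemma rounds_ok b v : h + size (pm_ents h (nu b v)) <= h + (K + K + h).
Proof.
rewrite leq_add2l /pm_ents !size_cat !size_map size_iota addnA leq_add2r.
apply: leq_add; apply: leq_trans cardL; first exact: (size_lms (HG v)).
exact: (size_bps inj idN wpos SP ell0 window (HG v)).
Qed.

Lemma Rb_sound b y tag : y <= ell -> R b (vtb b y) tag < INF ->
  exists2 a, a < y & R b (vtb b y) tag = val b a tag.
Proof.
exact: (R_sound kq0 inj idN HE (@vtb_adj b) (@vtb_pr b) (@vtb0_pr b) (@offb_pr b) (Lamb0 b)
  (@windowb b) (@nub_on b) (@nub_off b) (@nub_bd b) (@rounds_ok b)).
Qed.

Local Notation bd b i := (ni_bd (nu b (vtb b i))).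

Lemma Rb_complete b x a y tag : bd b x -> (forall i, x < i < y -> ~~ bd b i) -> x <= a < y -> y <= ell ->
  tag \in pm_ents h (nu b (vtb b x)) -> R b (vtb b y) tag <= val b a tag.
Proof.
exact: (R_complete INF S (fr b) (lr b) kq0 inj idN HE (@vtb_adj b) (@vtb_pr b) (Lamb0 b) (@windowb b) (@nub_on b)
  (@nub_bd b) (@rounds_ok b)).
Qed.

Lemma Accb_sound b i tag : i <= ell -> Acc b (vtb b i) tag < INF ->
  exists2 a, a <= i & Acc b (vtb b i) tag = val b a tag.
Proof.
exact: (Acc_sound kq0 inj idN HE (@vtb_adj b) (@vtb_pr b) (@vtb0_pr b) (@offb_pr b) (Lamb0 b)
  (@windowb b) (@nub_on b) (@nub_off b) (@nub_bd b) (@rounds_ok b)).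
Qed.

Lemma Accb_complete b x a i tag : bd b x -> (forall j, x < j <= i -> ~~ bd b j) -> x <= a <= i ->
  i <= ell -> tag \in pm_ents h (nu b (vtb b x)) -> Acc b (vtb b i) tag <= val b a tag.
Proof.
exact: (Acc_complete INF S (fr b) (lr b) kq0 inj idN HE (@vtb_adj b) (@vtb_pr b) (Lamb0 b) (@windowb b) (@nub_on b)
  (@nub_bd b) (@rounds_ok b)).
Qed.

Lemma bestb b p a tag loc : a <= p < ell ->
  (forall x, x <= ell -> bd b x -> tag \in pm_ents h (nu b (vtb b x))) ->
  (forall x, bd b x -> (forall j, x < j <= p -> ~~ bd b j) -> x <= a -> loc <= val b a tag) ->
  loc <= val b a tag \/ exists y, [/\ y <= p, bd b y & R b (vtb b y) tag <= val b a tag].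
Proof.
exact: (best kq0 inj idN HE (@vtb_adj b) (@vtb_pr b) (Lamb0 b) (@windowb b) (@nub_on b)
  (@nub_bd b) (@rounds_ok b)).
Qed.

Lemma segmentb b i : exists x o, [/\ x + o = i, bd b x & forall j, x < j <= i -> ~~ bd b j].
Proof. exact: (segment (Lamb0 b) (@nub_on b) (@nub_bd b)). Qed.

Lemma nearb b x p : p < ell -> bd b x -> x <= p -> (forall j, x < j <= p -> ~~ bd b j) ->
  p.+1.*2.+1 \in pm_ents h (nu b (vtb b x)).
Proof.
move=> Hp bx xp nb.
have e : p = x + (p - x) by lia.
have := seg_short kq0 HE (Lamb0 b) (@windowb b) (@nub_on b) (@nub_bd b) bx (o := p - x).
rewrite -e => /(_ nb Hp) lt.
by apply: (ents_near kq0 HE (Lamb0 b) (@nub_on b)); lia.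
Qed.

Lemma lm_ents b v u : Lam u -> (id u).*2 \in pm_ents h (nu b v).
Proof. exact: (ents_lm h (@nub_lms b)). Qed.

Lemma bp_ents b v z : z <= ell -> Lam (vtb b z) -> z.*2.+1 \in pm_ents h (nu b v).
Proof. exact: (ents_bp h (@nub_bps b)). Qed.

Lemma bdbE b i : i <= ell -> bd b i = Lam (vtb b i).
Proof. exact: (bdE (@nub_on b) (@nub_bd b)). Qed.

Lemma pm_wfb B b k v : 1 < n ^ B -> INF < n ^ B -> N.*2 <= n ^ B -> (ell + h).*2.+1 < n ^ B ->
  let m := sc_msg 1 (pm_static INF H S h (nu b v) (fr b v) (lr b v))
    (prun sc_init (sc_msg 1) (sc_upd N (prb b) (fun _ x => x)) I
      (fun v => pm_static INF H S h (nu b v) (fr b v) (lr b v)) k v) in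
  size m = 3 /\ all (fun y => y < n ^ B) m.
Proof.
exact: (pm_wf S (fr b) (lr b) kq0 inj idN HE (@vtb_adj b) (@vtb_pr b) (@vtb0_pr b) (@offb_pr b) (Lamb0 b)
  (@nub_on b) (@nub_off b) (@nub_bd b) (@nub_lms b) (@nub_bps b)).
Qed.

Local Notation its2 v := (items2 H S INF (fun b => nu b v) (fun b => lr b v) (rec true v) (rec false v) (X0 v)).
Variable G2 : seq (seq nat).
Hypothesis HG2 : forall c, c \in G2 <-> exists u, c \in its2 u.

Lemma ix_t j : j <= ell -> ni_ix (nu true (vt j)) = j.
Proof. by move=> Hj; have [_ -> _ _] := nub_on true Hj. Qed.

Lemma ix_f j : j <= ell -> ni_ix (nu false (vt j)) = ell - j.
Proof.
move=> Hj; have Hj' : ell - j <= ell by lia.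
by have [_ e _ _] := nub_on false Hj'; rewrite /vtb subKn // in e.
Qed.

Lemma on_t v : ni_on (nu true v) -> exists2 y, y <= ell & v = vt y.
Proof.
move=> o; have [//|ne] := pselect (exists2 i, i <= ell & v = vt i).
by rewrite (nub_off (b := true)) // in o => i Hi; apply/eqP => e; apply: ne; exists i.
Qed.

Lemma G2P c : c \in G2 ->
  [\/ exists u l, Lam u /\ c = [:: 0; id u; l; landmark_est INF H S (lr true u) l],
      exists y tag, y <= ell /\ c = [:: 1; y; tag; minn INF (R true (vt y) tag)] |
      exists y l, y <= ell /\ c = [:: 2; y; l.*2; minn INF (R false (vt y) l.*2)]].
Proof.
move=> /HG2 [u]; rewrite /items2 nlamE; case: ifP => // Lu; rewrite mem_cat => /orP [/mapP [l _ ->]|].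
  by apply: Or31; exists u, l.
case: ifP => // /on_t [y Hy ->]; rewrite ix_t // mem_cat => /orP [] /mapP [z _ ->].
  by apply: Or32; exists y, z.
by apply: Or33; exists y, z.
Qed.

Lemma G2_0 u u' : Lam u -> Lam u' -> [:: 0; id u; id u'; landmark_est INF H S (lr true u) (id u')] \in G2.
Proof.
move=> Lu Lu'; apply/HG2; exists u; rewrite /items2 nlamE Lu mem_cat; apply/orP; left.
by apply/mapP; exists (id u') => //; apply/nub_lms; exists u'.
Qed.

Lemma G2_1 y tag : y <= ell -> Lam (vt y) ->
  (exists2 u, Lam u & tag = (id u).*2) \/ (exists2 z, z <= ell /\ Lam (vt z) & tag = z.*2.+1) ->
  [:: 1; y; tag; minn INF (R true (vt y) tag)] \in G2.
Proof.
move=> Hy Ly Ht; apply/HG2; exists (vt y); rewrite /items2 nlamE Ly mem_cat; apply/orP; right.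
have [-> _ _ _] := nub_on true Hy; rewrite ix_t // mem_cat; apply/orP; left.
apply: (map_f (fun tag => [:: 1; y; tag; minn INF (R true (vt y) tag)])).
rewrite mem_cat; apply/orP; case: Ht => [[u Lu ->]|[z Hz ->]]; [left|right].
  by apply: map_f; apply/nub_lms; exists u.
by apply: (map_f (fun y => y.*2.+1)); apply/(nub_bps true).
Qed.

Lemma G2_2 y u : y <= ell -> Lam (vt y) -> Lam u ->
  [:: 2; y; (id u).*2; minn INF (R false (vt y) (id u).*2)] \in G2.
Proof.
move=> Hy Ly Lu; apply/HG2; exists (vt y); rewrite /items2 nlamE Ly mem_cat; apply/orP; right.
have [-> _ _ _] := nub_on true Hy; rewrite ix_t // mem_cat; apply/orP; right.
apply: (map_f (fun l => [:: 2; y; l.*2; minn INF (R false (vt y) l.*2)])).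
by apply/nub_lms; exists u.
Qed.

Variable i : nat.
Hypothesis Hi : i < ell.
Local Notation w := (gw I).
Local Notation off := (offP (gE I) (gs I) (gp I)).
Local Notation nb := (fun b => nu b (vt i)).
Local Notation Fi := (fun b => fr b (vt i)).
Local Notation Li := (fun b => lr b (vt i)).
Local Notation rt := (rec true (vt i)).
Local Notation rf := (rec false (vt i)).
Local Notation al := (o_al H S INF nb Fi Li rt G2).
Local Notation be := (o_be INF nb rf G2).
Local Notation DD := (o_D H S INF nb Fi Li rt G2).
Local Notation near := (o_near H S INF nb Fi Li rt rf).
Local Notation far := (o_far INF nb G2).
Local Notation long := (o_long n H S INF nb Fi Li rt rf G2).

Lemma ix_ti : ni_ix (nu true (vt i)) = i. Proof. by apply: ix_t; apply: ltnW. Qed.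
Lemma ix_fi : ni_ix (nu false (vt i)) = ell - i. Proof. by apply: ix_f; apply: ltnW. Qed.

Lemma vt_f j : j <= ell -> vt j = vtb false (ell - j).
Proof. by move=> Hj; rewrite /vtb subKn. Qed.

Lemma conn_rev u v c : conn (ge false) (wb false) u v c -> conn off w v u c.
Proof.
move=> [q [Pq Lq Wq]].
have [q' [P' L' _ W' _]] := rev_walk (e' := off) (w' := w) (fun x y H => conj H erefl) Pq.
by exists q'; rewrite -Lq; split=> //; rewrite W'.
Qed.

Lemma accE tag : o_acc H S INF nb Fi Li rt tag = Acc true (vt i) tag. Proof. by []. Qed.

(** The certificate behind an estimate: [P] up to some vertex not beyond the edge, then a walk off
    [P] to the landmark. *)
Definition leads l (x : nat) : Prop := exists a u c,
  [/\ a <= i, Lam u, id u = l, conn off w (vt a) u c & pre a + c <= x].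

Lemma al_sound l : al l < INF -> leads l (al l).
Proof.
have V a : a <= i -> val true a l.*2 < INF -> leads l (val true a l.*2).
  move=> ai lt; have Ha : a <= ell by lia.
  by have [u [c [Lu iu C le]]] := val_lm_sound Ha lt; exists a, u, c.
have := lminP (o_acc H S INF nb Fi Li rt l.*2) [seq nth 0 x 3 | x <- G2 &
  [&& nth 0 x 0 == 1, nth 0 x 1 <= ni_ix (nu true (vt i)) & nth 0 x 2 == l.*2]].
rewrite -/(al l) inE => /orP [/eqP ->|].
  by rewrite accE => lt; have [a ai E] := Accb_sound (b := true) (ltnW Hi) lt; rewrite E in lt *; apply: V.
move=> /mapP [c]; rewrite mem_filter ix_ti => /andP [/and3P [c0 c1 c2] cG] ->.
case: (G2P cG) => [[u [l' [_ ec]]]|[y [tag [Hy ec]]]|[y [l' [_ ec]]]]; rewrite ec //= in c0 c1 c2 *.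
rewrite gtn_min ltnn /= => lt; rewrite (minn_idPr (ltnW lt)); rewrite (eqP c2) in lt *.
have [a ay E] := Rb_sound (b := true) Hy lt; rewrite /= in E; rewrite E in lt *.
by apply: V lt; lia.
Qed.

Lemma be_sound l : be l < INF -> exists b u c,
  [/\ i < b <= ell, Lam u /\ id u = l, conn off w u (vt b) c & c + suf b <= be l].
Proof.
have V a : a < ell - i -> val false a l.*2 < INF -> exists b u c,
  [/\ i < b <= ell, Lam u /\ id u = l, conn off w u (vt b) c & c + suf b <= val false a l.*2].
  move=> ai lt; have Ha : a <= ell by lia.
  have [u [c [Lu iu /conn_rev C le]]] := val_lm_sound Ha lt; exists (ell - a), u, c.
  by rewrite addnC; split=> //; lia.
have := lminP (pm_get INF rf l.*2) [seq nth 0 x 3 | x <- G2 &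
  [&& nth 0 x 0 == 2, ni_ix (nu true (vt i)) < nth 0 x 1 & nth 0 x 2 == l.*2]].
rewrite -/(be l) inE => /orP [/eqP ->|].
  rewrite -[pm_get _ _ _]/(R false (vt i) l.*2) (vt_f (ltnW Hi)) => lt.
  by have [|a ai E] := Rb_sound (b := false) _ lt; [lia|rewrite E in lt *; apply: V].
move=> /mapP [c]; rewrite mem_filter ix_ti => /andP [/and3P [c0 c1 c2] cG] ->.
case: (G2P cG) => [[u [l' [_ ec]]]|[y [tag [_ ec]]]|[y [l' [Hy ec]]]]; rewrite ec //= in c0 c1 c2 *.
rewrite gtn_min ltnn /= => lt; rewrite (minn_idPr (ltnW lt)); rewrite (eqP c2) (vt_f Hy) in lt *.
have [|a ay E] := Rb_sound (b := false) _ lt; first by lia.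
by rewrite E in lt *; apply: V lt; lia.
Qed.

Lemma DD_sound t l : DD t l < INF -> leads l (DD t l).
Proof.
elim: t l => [|t IH] l; first exact: al_sound.
have := lminP (DD t l) [seq DD t (nth 0 x 1) + nth 0 x 3 | x <- G2 & (nth 0 x 0 == 0) && (nth 0 x 2 == l)].
rewrite -/(DD t.+1 l) inE => /orP [/eqP -> /IH //|/mapP [c]].
rewrite mem_filter => /andP [/andP [c0 c2] cG] ->.
case: (G2P cG) => [[u [l' [Lu ec]]]|[y [tag [_ ec]]]|[y [l' [Hy ec]]]]; rewrite ec //= in c0 c2 *.
rewrite (eqP c2) => lt.
have [|u' [Lu' iu'] C] := @dt_sound true u l; first by lia.
have [|a [u2 [c' [ai Lu2 /inj e C' le]]]] := IH (id u); first by lia.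
subst u2; exists a, u', (c' + landmark_est INF H S (lr true u) l); split=> //; first exact: conn_trans C' C.
by rewrite addnA leq_add2r.
Qed.

Lemma out_sound : o_val n H S INF nb Fi Li rt rf G2 < INF ->
  conn (Eminus (gE I) (vt i) (vt i.+1)) w (gs I) (gt I) (o_val n H S INF nb Fi Li rt rf G2).
Proof.
have D a b c x : a <= i < b -> b <= ell -> conn off w (vt a) (vt b) c -> pre a + c + suf b <= x ->
    conn (Eminus (gE I) (vt i) (vt i.+1)) w (gs I) (gt I) x.
  move=> ab Hb C le; apply: conn_le le _; exact: (detour_sound wpos SP).
have V a y : a <= i -> i < y -> val true a y.*2.+1 < INF ->
    conn (Eminus (gE I) (vt i) (vt i.+1)) w (gs I) (gt I) (val true a y.*2.+1).
  move=> ai iy lt; have Ha : a <= ell by lia.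
  have [b [c [yb C le]]] := val_thr_sound Ha lt.
  by apply: (D a b c) => //; lia.
rewrite /o_val /minn; case: ifP => [_|_]; last case: ifP => [_|_].
- rewrite /o_near /minn; case: ifP => _.
    rewrite accE ix_ti => lt; have [a ai E] := Accb_sound (b := true) (ltnW Hi) lt.
    by rewrite E in lt *; apply: V.
  have -> : pm_get INF rf = R false (vtb false (ell - i)) by rewrite -(vt_f (ltnW Hi)).
  rewrite ix_fi => lt.
  have [|a ai E] := Rb_sound (b := false) _ lt; first by lia.
  rewrite E in lt *; have Ha : a <= ell by lia.
  have [b [c [yb /conn_rev C le]]] := val_thr_sound Ha lt.
  apply: (D (ell - b) (ell - a) c) => //; try lia.
  by move: le; rewrite /preb /sufb; lia.
- move=> lt; have := lmin_mem lt; rewrite -/far => /mapP [c].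
  rewrite mem_filter ix_ti => /andP [/and4P [c0 c1 c2 c3] cG] E; rewrite E in lt *.
  case: (G2P cG) => [[u [l' [_ ec]]]|[y [tag [Hy ec]]]|[y [l' [_ ec]]]]; rewrite ec //= in c0 c1 c2 c3 lt *.
  have et : tag = tag./2.*2.+1 by rewrite -{1}(odd_double_half tag) c2.
  move: lt; rewrite gtn_min ltnn /= => lt; rewrite (minn_idPr (ltnW lt)).
  have [a ay Ea] := Rb_sound (b := true) Hy lt; rewrite /= et in Ea; rewrite et Ea in lt *.
  by apply: V lt; lia.
move=> lt; have := lmin_mem lt; rewrite -/long => /mapP [l _ E]; rewrite E in lt *.
have [|a [u [c [ai Lu iu C le]]]] := @DD_sound n l; first by lia.
have [|b [u' [c' [Hb [Lu' iu'] C' le']]]] := @be_sound l; first by lia.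
have eu : u' = u by apply: inj; rewrite iu iu'.
subst u'; apply: (D a b (c + c')); [lia|lia|exact: conn_trans C C'|lia].
Qed.

Definition hits (q : seq 'I_n) : Prop :=
  forall q1 q2 q3, q = q1 ++ q2 ++ q3 -> size q2 = h -> has Lam q2.

Lemma rev_off u q : path off u q -> exists q', [/\ path (ge false) (last u q) q', last (last u q) q' = u,
  size q' = size q & weight (wb false) (last u q) q' = weight w u q].
Proof.
move=> Pq; have [q' [P' L' S' W' _]] := rev_walk (e' := ge false) (w' := wb false) (fun x y H => conj H erefl) Pq.
by exists q'.
Qed.

Lemma al_complete a q : a <= i -> path off (vt a) q -> Lam (last (vt a) q) -> size q <= h ->
  weight w (vt a) q < 2 ^ S ->
  kq * al (id (last (vt a) q)) <= kq * pre a + kq.+1 * weight w (vt a) q.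
Proof.
move=> ai Pq Lq sq wS; have Ha : a <= ell by lia.
have C := val_lm_complete (b := true) Ha Pq Lq sq wS; apply: leq_trans C.
rewrite leq_mul2l; apply/orP; right.
have [|||le0|[y [yi by_ le]]] := @bestb true i a (id (last (vt a) q)).*2 (Acc true (vt i) (id (last (vt a) q)).*2).
- by rewrite ai.
- by move=> x _ _; apply: lm_ents.
- move=> x bx nb xa; apply: (Accb_complete bx nb); [lia|exact: ltnW|exact: lm_ents].
- by apply: leq_trans (lmin_top _ _) _; rewrite accE.
apply: leq_trans le; have Hy : y <= ell by lia.
apply: leq_trans (geq_minr INF _); apply: lmin_le; apply/mapP.
exists [:: 1; y; (id (last (vt a) q)).*2; minn INF (R true (vt y) (id (last (vt a) q)).*2)] => //.
rewrite mem_filter ix_ti /= yi eqxx /=; apply: G2_1 => //; first by rewrite -[vt y]/(vtb true y) -bdbE.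
by left; exists (last (vt a) q).
Qed.

Lemma be_complete b u q : i < b <= ell -> path off u q -> last u q = vt b -> Lam u -> size q <= h ->
  weight w u q < 2 ^ S -> kq * be (id u) <= kq * suf b + kq.+1 * weight w u q.
Proof.
move=> Hb Pq Lq Lu sq wS; have [q' [P' L' S' W']] := rev_off Pq.
have Hb' : ell - b <= ell by lia.
rewrite Lq vt_f in P' L' W'; last by lia.
have := val_lm_complete (b := false) Hb' P'; rewrite L' S' W' => /(_ Lu sq wS).
rewrite /preb subKn; last by lia.
apply: leq_trans; rewrite leq_mul2l; apply/orP; right.
(* [(ell - i).-1] is the mirrored position of [v_(i+1)], the last one at which a mirrored detour may
   leave. *)
have [|||le0|[y [yi by_ le]]] := @bestb false (ell - i).-1 (ell - b) (id u).*2 (R false (vt i) (id u).*2).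
- by lia.
- by move=> x _ _; apply: lm_ents.
- move=> x bx nb xa; rewrite (vt_f (ltnW Hi)); apply: (Rb_complete bx); [|lia|lia|exact: lm_ents].
  by move=> j Hj; apply: nb; lia.
- exact: leq_trans (lmin_top _ _) _.
apply: leq_trans le; have Hy : ell - y <= ell by lia.
apply: leq_trans (geq_minr INF _); apply: lmin_le; apply/mapP.
exists [:: 2; ell - y; (id u).*2; minn INF (R false (vt (ell - y)) (id u).*2)] => //.
rewrite mem_filter ix_ti /= eqxx andbT; apply/andP; split; first by lia.
by apply: G2_2 => //; rewrite -[vt (ell - y)]/(vtb false y) -bdbE //; lia.
Qed.

Lemma DD_mono t t' l : t <= t' -> DD t' l <= DD t l.
Proof.
move=> /subnKC <-; elim: (t' - t) => [|k IH]; first by rewrite addn0.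
by rewrite addnS; apply: leq_trans IH; apply: lmin_top.
Qed.

(** Cuts [q] at a landmark among its first [h] vertices; the remainder is still hit everywhere, so
    the cut can be repeated. *)
Lemma first_hit q : hits q -> h < size q -> exists r x r',
  [/\ q = rcons r x ++ r', Lam x, size (rcons r x) <= h & hits r'].
Proof.
move=> Hq lt; have hs : has Lam (take h q).
  by apply: (Hq [::] _ (drop h q)); rewrite ?cat_take_drop // size_take lt.
have [x xI Lx] := hasP hs.
have [p1 [p2 E]] : exists p1 p2, take h q = p1 ++ x :: p2.
  by case/splitPr: xI => p1 p2; exists p1, p2.
have Eq : q = rcons p1 x ++ (p2 ++ drop h q) by rewrite cat_rcons -cat_cons catA -E cat_take_drop.
exists p1, x, (p2 ++ drop h q); split=> //.
  have : size (take h q) <= h by rewrite size_take lt.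
  by rewrite E size_cat size_rcons /= addnS; lia.
move=> q1 q2 q3 e; apply: (Hq (rcons p1 x ++ q1) q2 q3).
by rewrite Eq e -!catA.
Qed.

(** All pieces between landmarks are estimated within the same factor, so their sum is as well. Each
    piece has at least one hop, so the number [t] of landmark arcs used never exceeds [n]. *)
Lemma long_complete b q u t C : i < b <= ell -> Lam u -> path off u q -> last u q = vt b ->
  t + size q <= n -> kq * DD t (id u) <= C -> hits q -> weight w u q < 2 ^ S ->
  exists2 u', Lam u' & kq * (DD n (id u') + be (id u')) <= C + kq.+1 * weight w u q + kq * suf b.
Proof.
move=> Hb; have [m] := ubnP (size q); elim: m q u t C => [//|m IH] q u t C qm Lu Pq Lq tn DC Hq wS.
have [sq|lt] := leqP (size q) h.
  exists u => //; have := be_complete Hb Pq Lq Lu sq wS.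
  have : kq * DD n (id u) <= kq * DD t (id u) by rewrite leq_mul2l DD_mono ?orbT //; lia.
  rewrite mulnDr; lia.
have [r [x [r' [E Lx sr Hr]]]] := first_hit Hq lt; rewrite E in qm Pq Lq tn wS *.
move: Pq Lq wS; rewrite cat_path last_cat weight_cat last_rcons => /andP [P1 P2] Lq wS.
rewrite size_cat size_rcons in qm tn.
have := @dt_complete true u (rcons r x) P1; rewrite last_rcons => /(_ Lx sr) /(_ (leq_ltn_trans (leq_addr _ _) wS)) dc.
have [||||u' Lu' le] := IH r' x t.+1 (C + kq.+1 * weight w u (rcons r x)) _ Lx P2 Lq _ _ Hr; try lia.
  apply: leq_trans (leq_add DC dc); rewrite -mulnDr leq_mul2l; apply/orP; right.
  apply: lmin_le; apply/mapP; exists [:: 0; id u; id x; landmark_est INF H S (lr true u) (id x)] => //.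
  by rewrite mem_filter /= eqxx; apply: G2_0.
by exists u' => //; rewrite mulnDr; lia.
Qed.

Lemma out_complete a b q : a <= i < b -> b <= ell -> path off (vt a) q -> last (vt a) q = vt b ->
  hits q -> size q < n -> weight w (vt a) q < 2 ^ S ->
  kq * o_val n H S INF nb Fi Li rt rf G2 <= kq * (pre a + suf b) + kq.+1 * weight w (vt a) q.
Proof.
move=> /andP [ai ib] Hb Pq Lq Hq qn wS; have Ha : a <= ell by lia.
set X := kq * (pre a + suf b) + _.
have M x : kq * x <= X -> o_val n H S INF nb Fi Li rt rf G2 <= x ->
    kq * o_val n H S INF nb Fi Li rt rf G2 <= X.
  by move=> le1 le2; apply: leq_trans le1; rewrite leq_mul2l le2 orbT.
have [sq|lt] := leqP (size q) h; last first.
  have [r [x [r' [E Lx sr Hr]]]] := first_hit Hq lt; rewrite E in Pq Lq qn wS @X M *.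
  move: Pq Lq wS @X M; rewrite cat_path last_cat weight_cat last_rcons => /andP [P1 P2] Lq wS X M.
  rewrite size_cat size_rcons in qn.
  have := al_complete ai P1; rewrite last_rcons => /(_ Lx sr) /(_ (leq_ltn_trans (leq_addr _ _) wS)) ac.
  have Hib : i < b <= ell by rewrite ib.
  have [||u' Lu' le] := long_complete (t := 0) Hib Lx P2 Lq _ ac Hr; try lia.
  apply: (M (DD n (id u') + be (id u'))); first by apply: leq_trans le _; rewrite /X !mulnDr; lia.
  apply: leq_trans (geq_minr _ _) _; apply: leq_trans (geq_minr _ _) _.
  by apply: lmin_le; apply: (map_f (fun l => DD n l + be l)); apply/(nub_lms true); exists u'.
have [x [o [e bx nbx]]] := segmentb true i.
(* [x] opens the segment of the edge; if [x <= a], the detour leaves inside it. *)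
have [xa|ax] := leqP x a.
  have C : i < b <= ell -> kq * val true a i.+1.*2.+1 <= X.
    by move=> Hib; apply: (@val_thr_complete true a b i.+1 q).
  apply: (M (val true a i.+1.*2.+1)); first by apply: C; lia.
  apply: leq_trans (geq_minl _ _) _; apply: leq_trans (geq_minl _ _) _.
  rewrite accE ix_ti; apply: (Accb_complete bx nbx); [lia|lia|].
  by apply: (nearb (b := true)) => //; lia.
have [x' [o' [e' bx' nbx']]] := segmentb false (ell - i).-1.
have [q' [P' L' S' W']] := rev_off Pq; rewrite Lq vt_f // in P' L' W'.
(* The mirrored case: the detour rejoins inside the segment that [x'] opens when the path is read
   from [t]. *)
have [xb|bx2] := leqP x' (ell - b).
  have Hb' : ell - b <= ell by lia.
  have C : kq * val false (ell - b) (ell - i).*2.+1 <= X.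
    have := @val_thr_complete false (ell - b) (ell - a) (ell - i) q' Hb' _ P' (etrans L' (vt_f Ha)).
    rewrite W' S' /preb /sufb !subKn // [suf b + _]addnC; apply=> //; lia.
  apply: (M _ C).
  apply: leq_trans (geq_minl _ _) _; apply: leq_trans (geq_minr _ _) _.
  have -> : pm_get INF rf = R false (vtb false (ell - i)) by rewrite -(vt_f (ltnW Hi)).
  rewrite ix_fi; apply: (Rb_complete bx'); [|lia|lia|].
    by move=> j Hj; apply: nbx'; lia.
  have -> : ell - i = (ell - i).-1.+1 by lia.
  by apply: (nearb (b := false)) => //; lia.
have Lz : Lam (vt (ell - x')) by rewrite -[vt _]/(vtb false x') -bdbE //; lia.
have C : ell - x' <= b <= ell -> kq * val true a (ell - x').*2.+1 <= X.
  by move=> Hib; apply: (@val_thr_complete true a b (ell - x') q).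
apply: (M (val true a (ell - x').*2.+1)); first by apply: C; lia.
apply: leq_trans (geq_minr _ _) _; apply: leq_trans (geq_minl _ _) _.
(* The successor makes the first alternative absurd; its premise is vacuous because the boundary [x]
   separates [a] from the edge. *)
have [|||le0|[y [yi by_ le]]] := @bestb true i a (ell - x').*2.+1 (val true a (ell - x').*2.+1).+1.
- by rewrite ai.
- by move=> z _ _; apply: bp_ents => //; lia.
- move=> z _ nbz za; have : ~~ ni_bd (nu true (vtb true x)) by apply: nbz; lia.
  by rewrite bx.
- by rewrite ltnn in le0.
have Hy : y <= ell by lia.
apply: leq_trans le; apply: leq_trans (geq_minr INF _); apply: lmin_le; apply/mapP.
exists [:: 1; y; (ell - x').*2.+1; minn INF (R true (vt y) (ell - x').*2.+1)] => //.
rewrite mem_filter ix_ti /= yi odd_double uphalf_double /=; apply/andP; split; first by lia.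
apply: G2_1 => //; first by rewrite -[vt y]/(vtb true y) -bdbE.
by right; exists (ell - x') => //; split=> //; lia.
Qed.
End Directions.

(** * The schedule *)

(** The hypothesis is polymorphic in the accumulated value [val'], so that phase [c] can carry along
    the results of the phases before it. *)
Lemma comp_seq n (Q : inst n -> Prop) B X Y (y0 : Y) d (y : nat -> inst n -> 'I_n -> Y) T
    (val : inst n -> 'I_n -> X) m :
  (forall c T' X' (val' : inst n -> 'I_n -> X') (pj : X' -> X), c < m ->
     (forall I v, pj (val' I v) = val I v) -> computable Q B T' val' ->
     computable Q B (T' + d) (fun I v => (val' I v, y c I v))) ->
  computable Q B T val ->
  computable Q B (T + m * d) (fun I v => (val I v, fun c => if c < m then y c I v else y0)).
Proof.
move=> Hy C.
suff P k : k <= m ->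
    computable Q B (T + k * d) (fun I v => (val I v, fun c => if c < k then y c I v else y0)) by exact: P.
elim: k => [_|k IH Hk].
  by rewrite mul0n addn0; apply: (comp_map (g := fun x => (x, fun=> y0)) C).
rewrite mulSn [d + _]addnC addnA.
have C' := Hy k _ _ (fun I v => (val I v, fun c => if c < k then y c I v else y0)) fst Hk
  (fun _ _ => erefl) (IH (ltnW Hk)).
apply: (comp_map (g := fun x => (x.1.1, fun c => if c < k then x.1.2 c else if c == k then x.2 else y0)) C').
move=> I QI v /=.
congr (_, _); apply: funext => c; rewrite ltnS.
by case: (ltngtP c k) => [||->].
Qed.

Section Schedule.
Variables (n N h H S K kq INF B dia : nat).

(** The assumptions on the input together with two properties of a good sample, [r_window] and
    [r_card]. [dia] need only bound the diameter: it will be twice the eccentricity of [s]. *)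
Record regular (I : inst n) : Prop := Regular {
  r_inj : injective (gid I);
  r_idN : forall v, gid I v < N;
  r_wpos : forall u v, gE I u v -> 0 < gw I u v;
  r_SP : shortest_path (gE I) (gw I) (gs I) (gt I) (gp I);
  r_ell0 : 0 < size (gp I);
  r_window : forall x, x + h <= size (gp I) ->
    exists i, x < i <= x + h /\ Lam I (vt (gs I) (gp I) i);
  r_card : #|[set v | Lam I v]| <= K;
  r_pre : pre (gw I) (gs I) (gp I) (size (gp I)) < INF;
  r_diam : forall u v, within (gE I) dia u v }.

Hypothesis HE : H = (kq.*2 + 1) * h.
Hypothesis kq0 : 0 < kq.
Hypothesis B1 : 3 < n ^ B.
Hypothesis B2 : N.*2 <= n ^ B.
Hypothesis B3 : H < n ^ B.
Hypothesis B4 : n.+1 * INF <= n ^ B.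
Hypothesis B5 : (n + h).*2.+1 < n ^ B.
Hypothesis INF0 : 0 < INF.

Local Notation comp := (computable regular B).
Local Notation X0 I v := (loc I v, glm I v).
Definition wrec (I : inst n) v := (prun sc_init (sc_msg 3) (sc_upd N (fun f => in_onP f) wk_lnk) I
  (fun v => wk N (X0 I v)) h v).2.

Lemma bounds : [/\ 1 < n ^ B, N <= n ^ B, n <= n ^ B & INF < n ^ B].
Proof.
have n0 : 0 < n.
  by rewrite lt0n; apply/eqP => e; move: B1; rewrite e; case: (B) => [//|b]; rewrite exp0n.
split; [lia|have := B2; lia|have := B5; lia|].
have : 2 * INF <= n.+1 * INF by rewrite leq_mul2r ltnS n0 orbT.
lia.
Qed.

Lemma walk_computable : comp (h * 5) (fun I v => (X0 I v, wrec I v)).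
Proof.
have [b1 b2 b3 b4] := bounds.
have := comp_phase (L := 5) (K := h) (init := sc_init) (m := sc_msg 3)
  (upd := sc_upd N (fun f => in_onP f) wk_lnk) (proj := wk N) (comp_local regular B).
rewrite add0n => C; apply: (comp_map (g := fun x => (x.1, x.2.2)) (C _)) => // I QI k v _ s.
apply: (wk_wf (r_inj QI) (r_idN QI) (r_wpos QI) (r_SP QI) (r_ell0 QI)) => //.
exact: ltn_trans (r_pre QI) b4.
Qed.

Definition G1 (I : inst n) v := (prun fl_init (fl_msg 5) (fl_upd N) I
  (fun u => wk_items (X0 I u) (wrec I u)) (K + dia).+1 v).1.

Lemma flood1P I : regular I -> forall v c, c \in G1 I v <-> exists u, c \in wk_items (X0 I u) (wrec I u).
Proof.
move=> QI v c; rewrite /G1.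
apply: (flood 5 (r_inj QI) (r_idN QI) (KK := K) (dia := dia) v
  (U := [seq wk_item (X0 I u) (wrec I u) | u <- enum [set v | Lam I v]])) => //; last exact: r_diam QI.
  move=> u x; rewrite /wk_items nlamE; case: ifP => // Lu; rewrite inE => /eqP ->.
  by apply: (map_f (fun u => wk_item (X0 I u) (wrec I u))); rewrite mem_enum inE.
by rewrite size_map -cardE; apply: r_card QI.
Qed.

Definition T1 := h * 5 + (K + dia).+1 * 6.
Local Notation nu I := (nu N h I (G1 I)).

Lemma chain_computable : comp T1 (fun I v => (X0 I v, fun b => nu I b v)).
Proof.
have [b1 b2 b3 b4] := bounds.
have C := comp_phase (L := 6) (K := (K + dia).+1) (init := fl_init) (m := fl_msg 5) (upd := fl_upd N)
  (proj := fun x => wk_items x.1 x.2) walk_computable.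
apply: (comp_map (g := fun x => (x.1.1, fun b => mk_ninfo n N b x.1.1 x.1.2 x.2.1)) (C _)) => // I QI k v _ s.
apply: (fl_wf (r_inj QI) (r_idN QI)) => // u x.
apply: (item_wf (r_inj QI) (r_idN QI) (r_wpos QI) (r_SP QI) (r_ell0 QI) (r_window QI)) => //.
exact: ltn_trans (r_pre QI) b4.
Qed.

Definition val2 (I : inst n) v := (X0 I v, fun b => nu I b v).

(** The phase number encodes the direction by its parity and the scale by its half. *)
Definition fres c (I : inst n) v := (prun fu_init fu_msg (fu_upd N (lenb (odd c) c./2)) I
  (fun v => kappa INF (nu I (odd c) v)) H v).2.
Definition lres c (I : inst n) v := (prun (lp_init H) (lp_msg N H) (lp_upd N H (lenb (odd c) c./2)) I
  (fun v => (is_landmark (X0 I v), gid I v)) (H + K) v).1.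

(** [B4] is tailored to the keys: their quotient by [INF] is at most [n]. *)
Lemma kappa_lt I b v : regular I -> kappa INF (nu I b v) < n ^ B.
Proof.
move=> QI; have [b1 b2 b3 b4] := bounds; rewrite /kappa; case: ifP => o; last by lia.
have [[i Hi ->]|ne] := pselect (exists2 i, i <= size (gp I) & v = vtb I b i); last first.
  rewrite (nub_off h (G1 I) (r_inj QI) (r_idN QI) (r_wpos QI) (r_SP QI) (r_ell0 QI)) // in o => i Hi.
  by apply/eqP => e; apply: ne; exists i.
have [_ -> _ ->] := nub_on (r_inj QI) (r_idN QI) (r_wpos QI) (r_SP QI) (r_ell0 QI) (r_window QI) (flood1P QI) b Hi.
have sI := suf_INF (r_ell0 QI) (r_card QI) (r_pre QI) HE kq0 b Hi.
apply: leq_trans B4; have := ell_n (r_wpos QI) (r_SP QI) => li.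
apply: (@leq_trans (i.+2 * INF)); last by rewrite leq_mul2r; apply/orP; right; lia.
by rewrite [leqRHS]mulSnr ltn_add2l.
Qed.

Definition T2 := T1 + S.+1.*2 * (H + (H + K) * 3).

Lemma tables_computable : comp T2 (fun I v => (val2 I v, fun c =>
  if c < S.+1.*2 then (fres c I v, lres c I v) else (fun=> 0, fun=> 0))).
Proof.
have [b1 b2 b3 b4] := bounds.
apply: comp_seq chain_computable => c T' X' val' pj _ E C.
have e1 I : (fun v => kappa INF ((pj (val' I v)).2 (odd c))) = fun v => kappa INF (nu I (odd c) v).
  by apply: funext => v; rewrite E.
have e2 I : (fun v => (is_landmark (pj (val' I v)).1, li_id (pj (val' I v)).1.1)) =
    fun v => (is_landmark (X0 I v), gid I v) by apply: funext => v; rewrite E.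
have C1 : comp (T' + H) (fun I v => (val' I v, fres c I v)).
  have := comp_phase (L := 1) (K := H) (init := fu_init) (m := fu_msg)
    (upd := fu_upd N (lenb (odd c) c./2)) (proj := fun x => kappa INF ((pj x).2 (odd c))) C.
  rewrite muln1 => C0.
  apply: (comp_map (g := fun x => (x.1, x.2.2)) (C0 _)) => [|I QI v /=]; last by rewrite e1.
  move=> I QI k v _; split=> //; rewrite /= andbT e1.
  have [q [_ _ ->]] := fu_sound (fun v => kappa INF (nu I (odd c) v)) (r_inj QI) (r_idN QI)
    (@lenP _ I (odd c) c./2) k v (prun fu_init fu_msg (fu_upd N (lenb (odd c) c./2)) I
      (fun v => kappa INF (nu I (odd c) v)) k v).1.
  exact: kappa_lt.
have := comp_phase (L := 3) (K := H + K) (init := lp_init H) (m := lp_msg N H)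
  (upd := lp_upd N H (lenb (odd c) c./2)) (proj := fun x => (is_landmark (pj x.1).1, li_id (pj x.1).1.1)) C1.
rewrite -addnA => C2.
apply: (comp_map (g := fun x => (x.1.1, (x.1.2, x.2.1))) (C2 _)) => [|I QI v /=]; last by rewrite e2.
move=> I QI k v _ /=; rewrite e2 E.
by apply: (lp_wf _ I (fun v => (is_landmark (X0 I v), gid I v))).
Qed.

Local Notation fr I := (furthest N h H S INF I (G1 I)).
Local Notation lr I := (landmark_dist N H S K I).

Lemma tables_computable' : comp T2 (fun I v => (val2 I v, fun b => fr I b v, fun b => lr I b v)).
Proof.
apply: (comp_map (g := fun x => (x.1, fun (b : bool) i => (x.2 (b + i.*2)).1, fun (b : bool) i => (x.2 (b + i.*2)).2))
  tables_computable) => I QI v.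
have e (b : bool) i : [/\ odd (b + i.*2) = b, (b + i.*2)./2 = i & (b + i.*2 < S.+1.*2) = ~~ (S < i)].
  by split; [rewrite oddD odd_double addbF oddb|rewrite half_bit_double|case: b; lia].
congr (_, _, _); apply: funext => b; apply: funext => i; apply: funext => z /=.
  by have [e1 e2 ->] := e b i; rewrite /furthest /fres e1 e2; case: ltnP.
by have [e1 e2 ->] := e b i; rewrite /landmark_dist /lres e1 e2; case: ltnP.
Qed.

Definition pmrec (b : bool) (I : inst n) v :=
  (prun sc_init (sc_msg 1) (sc_upd N (prb b) (fun _ x => x)) I
    (fun u0 => pm_static INF H S h (nu I b u0) (fr I b u0) (lr I b u0)) (h + (K + K + h)) v).2.

Lemma scan_computable X T (val : inst n -> 'I_n -> X) (pj : X -> sc_static) b :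
  (forall I v, pj (val I v) = pm_static INF H S h (nu I b v) (fr I b v) (lr I b v)) ->
  comp T val -> comp (T + (h + (K + K + h)) * 3) (fun I v => (val I v, pmrec b I v)).
Proof.
move=> E C; have [b1 b2 b3 b4] := bounds.
have e I : (fun u => pj (val I u)) = fun u => pm_static INF H S h (nu I b u) (fr I b u) (lr I b u).
  by apply: funext => u; rewrite E.
have C0 := comp_phase (L := 3) (K := h + (K + K + h)) (init := sc_init) (m := sc_msg 1)
  (upd := sc_upd N (prb b) (fun _ x => x)) (proj := pj) C.
apply: (comp_map (g := fun x => (x.1, x.2.2)) (C0 _)) => [|I QI v /=]; last by rewrite e.
move=> I QI k v _ s; rewrite /s e E.
apply: (pm_wfb S (r_inj QI) (r_idN QI) (r_wpos QI) (r_SP QI) (r_ell0 QI) (r_window QI) (flood1P QI)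
  (r_card QI) (r_pre QI) HE kq0) => //.
apply: leq_ltn_trans B5; rewrite ltnS leq_double leq_add2r ltnW //.
exact: (ell_n (r_wpos QI) (r_SP QI)).
Qed.

Local Notation its2 I v := (items2 H S INF (fun b => nu I b v) (fun b => lr I b v)
  (pmrec true I v) (pmrec false I v) (X0 I v)).

Definition G2 (I : inst n) v := (prun fl_init (fl_msg 4) (fl_upd N) I (fun u => its2 I u)
  (4 * K * K + dia).+1 v).1.

(** Each landmark owns at most [4 * K] items: [K] arcs, [2 * K] forward totals (landmark and
    boundary tags) and [K] mirrored ones. *)
Lemma flood2P I : regular I -> forall v c, c \in G2 I v <-> exists u, c \in its2 I u.
Proof.
move=> QI v c; rewrite /G2.
apply: (flood 4 (r_inj QI) (r_idN QI) (KK := 4 * K * K) (dia := dia) v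
  (U := flatten [seq its2 I u | u <- enum [set v | Lam I v]])) => //; last exact: r_diam QI.
  move=> u x Hx; apply/flatten_mapP; exists u => //; rewrite mem_enum inE.
  by move: Hx; rewrite /items2 nlamE; case: ifP.
have cL := r_card QI.
have sz u : size (its2 I u) <= 4 * K.
  rewrite /items2; case: ifP => // _; rewrite size_cat size_map.
  have sl := size_lms (flood1P QI u) true u.
  have sb := size_bps (r_inj QI) (r_idN QI) (r_wpos QI) (r_SP QI) (r_ell0 QI) (r_window QI) (flood1P QI u) true u.
  have {}sl : size (ni_lms (nu I true u)) <= K by apply: leq_trans sl cL.
  have {}sb : size (ni_bps (nu I true u)) <= K by apply: leq_trans sb cL.
  case: ifP => _; rewrite ?size_cat ?size_map ?size_cat ?size_map ?[size [::]]/=;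
    move: sl sb; move: (size (ni_lms _)) (size (ni_bps _)) => x y; lia.
rewrite size_flatten /shape -map_comp sumnE big_map.
apply: (@leq_trans (\sum_(u <- enum [set v | Lam I v]) 4 * K)); first by apply: leq_sum => u _; apply: sz.
by rewrite big_const_seq count_predT iter_addn_0 -cardE leq_mul2l cL orbT.
Qed.

Definition T4 := T2 + (h + (K + K + h)) * 3 + (h + (K + K + h)) * 3 + (4 * K * K + dia).+1 * 5.

Definition oval (I : inst n) v := o_val n H S INF (fun b => nu I b v) (fun b => fr I b v)
  (fun b => lr I b v) (pmrec true I v) (pmrec false I v) (G2 I v).

Lemma its2_wf I u c : regular I -> c \in its2 I u -> size c = 4 /\ all (fun y => y < n ^ B) c.
Proof.
move=> QI; have [b1 b2 b3 b4] := bounds.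
have lm l : l \in ni_lms (nu I true u) -> l < N.
  by move/(nub_lms (flood1P QI)) => [u' _ <-]; apply: r_idN.
have li := ell_n (r_wpos QI) (r_SP QI).
rewrite /items2; case: ifP => // _; rewrite mem_cat => /orP [/mapP [l /lm Hl ->]|].
  have := r_idN QI u; have : landmark_est INF H S (lr I true u) l <= INF by apply: lmin_top.
  by split=> //=; lia.
case: ifP => // o.
have ix : ni_ix (nu I true u) < n ^ B.
  have [i Hi e] := on_t (r_inj QI) (r_idN QI) (r_wpos QI) (r_SP QI) (r_ell0 QI) o.
  have [_ e2 _ _] := nub_on (r_inj QI) (r_idN QI) (r_wpos QI) (r_SP QI) (r_ell0 QI) (r_window QI) (flood1P QI) true Hi.
  by rewrite e e2; lia.
have mI x : minn INF x < n ^ B by apply: leq_ltn_trans b4; apply: geq_minl.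
rewrite mem_cat => /orP [] /mapP [tag Ht ->]; split=> //=; rewrite ix mI !andbT /=.
  apply/andP; split; first by lia.
  move: Ht; rewrite mem_cat => /orP [] /mapP [z Hz ->]; first by have := lm _ Hz; lia.
  have [z1 _] := (nub_bps (r_inj QI) (r_idN QI) (r_wpos QI) (r_SP QI) (r_ell0 QI) (r_window QI) (flood1P QI) true u z).1 Hz.
  by apply: leq_ltn_trans B5; rewrite ltnS leq_double; lia.
by have := lm _ Ht; lia.
Qed.

Lemma oval_computable : comp T4 oval.
Proof.
have [b1 b2 b3 b4] := bounds.
pose V3 I v := (val2 I v, fun b => fr I b v, fun b => lr I b v).
have C1 := @scan_computable _ _ V3 (fun x => pm_static INF H S h (x.1.1.2 true) (x.1.2 true) (x.2 true)) true
  (fun I v => erefl) tables_computable'.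
have C2 := @scan_computable _ _ (fun I v => (V3 I v, pmrec true I v)) (fun x => pm_static INF H S h (x.1.1.1.2 false) (x.1.1.2 false) (x.1.2 false)) false
  (fun I v => erefl) C1.
have C3 := comp_phase (L := 5) (K := (4 * K * K + dia).+1) (init := fl_init) (m := fl_msg 4) (upd := fl_upd N)
  (proj := fun x => items2 H S INF x.1.1.1.1.2 x.1.1.2 x.1.2 x.2 x.1.1.1.1.1) C2.
apply: (comp_map (g := fun x => o_val n H S INF x.1.1.1.1.1.2 x.1.1.1.1.2 x.1.1.1.2 x.1.1.2 x.1.2 x.2.1) (C3 _)).
  move=> I QI k v _ s; apply: (fl_wf (r_inj QI) (r_idN QI)) => // u x.
  exact: its2_wf.
by move=> I QI v.
Qed.

Lemma oval_sound I i : regular I -> i < size (gp I) ->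
  let v := vt (gs I) (gp I) in oval I (v i) < INF ->
  conn (Eminus (gE I) (v i) (v i.+1)) (gw I) (gs I) (gt I) (oval I (v i)).
Proof.
move=> QI Hi v; exact: (out_sound (r_inj QI) (r_idN QI) (r_wpos QI) (r_SP QI) (r_ell0 QI) (r_window QI)
  (flood1P QI) (r_card QI) (r_pre QI) HE kq0 (flood2P QI (v i)) Hi).
Qed.

Lemma oval_complete I i a b q : regular I -> i < size (gp I) ->
  let v := vt (gs I) (gp I) in a <= i < b -> b <= size (gp I) ->
  path (offP (gE I) (gs I) (gp I)) (v a) q -> last (v a) q = v b -> hits h I q -> size q < n ->
  weight (gw I) (v a) q < 2 ^ S ->
  kq * oval I (v i) <= kq * (pre (gw I) (gs I) (gp I) a + suf (gw I) (gs I) (gp I) b) +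
    kq.+1 * weight (gw I) (v a) q.
Proof.
move=> QI Hi v; exact: (out_complete (r_inj QI) (r_idN QI) (r_wpos QI) (r_SP QI) (r_ell0 QI) (r_window QI)
  (flood1P QI) (r_card QI) (r_pre QI) HE kq0 (flood2P QI (v i)) Hi).
Qed.
End Schedule.

(** * Waiting for the eccentricity *)

Lemma find_iota (p : pred nat) k L : (forall t, t < k -> ~~ p t) -> p k -> k < L -> find p (iota 0 L) = k.
Proof.
move=> Hn Hk lt; have -> : L = k + (L - k).-1.+1 by lia.
rewrite iotaD find_cat ifF; first by rewrite /= add0n Hk size_iota addn0.
apply/negbTE; apply/hasPn => t; rewrite mem_iota => Ht; apply: Hn; lia.
Qed.

Lemma find_iota_none (p : pred nat) L : (forall t, t < L -> ~~ p t) -> find p (iota 0 L) = L.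
Proof.
move=> Hn; rewrite hasNfind ?size_iota //; apply/hasPn => t; rewrite mem_iota => Ht; apply: Hn; lia.
Qed.

(* The eccentricity of [s] is computed first; it terminates everywhere in the same round,
   which starts the protocol [pis e] designed for that eccentricity. *)
Section TwoStage.
Variables (n N B : nat).
Variables (pis : nat -> View -> nat) (outs : nat -> View -> nat) (Ts : nat -> nat) (INF : nat).
Hypothesis nB : n < n ^ B.

Definition ec_view (V : View) : ec_state := sview ec_init (ec_upd N) (fun x => li_is_s x.1) V.
Definition pi0 (V : View) : nat := head 0 (ec_msg (li_is_s V.1.1) (ec_view V)).
(** If no decision has been made yet, the search fails and returns one more than the size of the
    history, which [found] detects. *)
Definition start (V : View) : nat :=
  find (fun t => ec_dec (ec_view (V.1, take t V.2))) (iota 0 (size V.2).+1).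
Definition found (V : View) : bool := start V <= size V.2.
Definition ecc_of (V : View) : nat := (ec_view (V.1, take (start V) V.2)).2.
Definition later (V : View) : View := (V.1, drop (start V) V.2).
Definition pi2 (V : View) : nat := if found V then pis (ecc_of V) (later V) else pi0 V.
Definition halt2 (V : View) : bool := found V && (start V + Ts (ecc_of V) <= size V.2).
Definition out2 (V : View) : option nat :=
  let x := outs (ecc_of V) (later V) in if x < INF then Some x else None.

Variables (I : inst n) (D : nat).
Hypothesis inj : injective (gid I).
Hypothesis idN : forall v, gid I v < N.
Hypothesis diam : forall u v, within (gE I) D u v.
Local Notation e := (ecc diam).
Local Notation t0 := (3 * e + 3).
Local Notation ec := (prun ec_init ec_msg (ec_upd N) I (fun v => v == gs I)).

Lemma ec_viewP k v : ec_view (view pi0 I B k v) = ec k v.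
Proof.
have := sviewP (B := B) (m := ec_msg) (init := ec_init) (upd := ec_upd N) (y := fun x => li_is_s x.1) (I := I).
by apply=> k' v'; apply: (ec_wf inj idN diam).
Qed.

Lemma view_eta pi k v : ((view pi I B k v).1, (view pi I B k v).2) = view pi I B k v.
Proof. by rewrite -surjective_pairing. Qed.

Lemma not_yet t v : t < t0 -> ec_dec (ec t v) = false.
Proof. by have [H _] := ecc_dec inj idN diam v; apply: H. Qed.

Lemma stage1 T v : T <= t0 -> view pi2 I B T v = view pi0 I B T v.
Proof.
move=> HT; apply: (view_ext (pi := pi0) (T := t0)) => // T'' u lt.
rewrite /pi2 /found /start find_iota_none ?ltnn // => t; rewrite view_size ltnS => tT.
rewrite view_take // view_fst -(view_fst pi0 I B t u) view_eta ec_viewP not_yet //.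
exact: leq_ltn_trans lt.
Qed.

Lemma start_early T v : T < t0 -> found (view pi2 I B T v) = false.
Proof.
move=> HT; rewrite stage1 1?ltnW // /found /start find_iota_none ?ltnn // => t; rewrite view_size ltnS => tT.
rewrite view_take // view_fst -(view_fst pi0 I B t v) view_eta ec_viewP not_yet //.
exact: leq_ltn_trans HT.
Qed.

Lemma prefix T t v : t <= T -> t <= t0 ->
  ec_view ((view pi2 I B T v).1, take t (view pi2 I B T v).2) = ec t v.
Proof.
move=> tT tt; rewrite view_take // view_fst -(view_fst pi2 I B t v) view_eta stage1 //.
exact: ec_viewP.
Qed.

Lemma start_late T v : t0 <= T -> start (view pi2 I B T v) = t0.
Proof.
move=> HT; rewrite /start; apply: find_iota; last by rewrite view_size ltnS.
  by move=> t lt; rewrite prefix ?not_yet // ltnW // (leq_trans lt).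
by rewrite prefix //; have [_ []] := ecc_dec inj idN diam v.
Qed.

Lemma ecc_late T v : t0 <= T -> ecc_of (view pi2 I B T v) = e.
Proof.
move=> HT; rewrite /ecc_of start_late // prefix //.
by have [_ []] := ecc_dec inj idN diam v.
Qed.

Lemma found_late T v : t0 <= T -> found (view pi2 I B T v).
Proof. by move=> HT; rewrite /found start_late // view_size. Qed.

(** All vertices switch in the same round, so from then on the truncated histories evolve exactly as
    under [pis e]. *)
Lemma stage2 k v : later (view pi2 I B (t0 + k) v) = view (pis e) I B k v.
Proof.
elim: k v => [|k IH] v.
  rewrite /later start_late ?leq_addr // addn0 view_fst drop_oversize ?view_size //.
have L T u : t0 <= T -> later (view pi2 I B T u) = ((loc I u, glm I u), drop t0 (view pi2 I B T u).2).
  by move=> HT; rewrite /later start_late // view_fst.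
have M u : pi2 (view pi2 I B (t0 + k) u) = pis e (view (pis e) I B k u).
  by rewrite /pi2 found_late ?leq_addr // ecc_late ?leq_addr // IH.
rewrite L ?leq_addr // (addnS t0 k) !viewS -IH L ?leq_addr //= drop_rcons ?view_size ?leq_addr //.
congr (_, rcons _ _); apply: funext => j; case: pickP => // u _; by rewrite M.
Qed.

Lemma halt2P T v : halt2 (view pi2 I B T v) = (t0 + Ts e <= T).
Proof.
have [lt|le] := ltnP T t0; first by rewrite /halt2 start_early //; apply/esym/negbTE; lia.
by rewrite /halt2 found_late // start_late // ecc_late // view_size.
Qed.

Lemma out2P k v : out2 (view pi2 I B (t0 + k) v) =
  let x := outs e (view (pis e) I B k v) in if x < INF then Some x else None.
Proof. by rewrite /out2 ecc_late ?leq_addr // stage2. Qed.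
End TwoStage.

(** * Sizes and running time *)

Lemma cbrt_sqP n : 0 < n -> n ^ 2 <= cbrt_sq n ^ 3 /\ cbrt_sq n <= n.
Proof.
move=> n0; rewrite /cbrt_sq; set p := fun m => _; set s := iota _ _.
have ns : n \in s by rewrite mem_iota add0n ltnS leq_pmulr.
have pn : p n by rewrite /p leq_pexp2l.
have hs : has p s by apply/hasP; exists n.
have lt : find p s < size s by rewrite -has_find.
have nthE k : k < size s -> nth 0 s k = k by rewrite size_iota => H; rewrite nth_iota.
split; first by have := nth_find 0 hs; rewrite nthE.
rewrite leqNgt; apply/negP => H.
by have := before_find 0 H; rewrite nthE ?pn // (ltn_trans H).
Qed.

Section Sizes.
Variables (n d cw kq : nat).
Hypothesis n2 : 1 < n.
Local Notation m := (cbrt_sq n).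
Local Notation lg := (up_log 2 n).
(** The sizes required by [hitting] for [a = up_log 2 m]; fair bits only give probabilities that are
    powers of 1/2, so [m] is rounded up to [2 ^ a]. The final 2 in [landmark_bound] accounts for [s]
    and [t]. *)
Definition hop_bound := (d + 4) * 2 ^ up_log 2 m * lg.
Definition length_bound := (kq.*2 + 1) * hop_bound.
Definition landmark_bound := 2 * (n %/ 2 ^ up_log 2 m + 1) + d.+1 * lg + 2.

Lemma m_gt1 : 1 < m.
Proof.
have [H _] := cbrt_sqP (ltnW n2); rewrite ltnNge; apply/negP => le.
have : n ^ 2 <= 1 by apply: leq_trans H _; rewrite -(exp1n 3) leq_exp2r.
by rewrite leqNgt -{1}(exp1n 2) ltn_exp2r // n2.
Qed.

Lemma M_bounds : m <= 2 ^ up_log 2 m <= 2 * m.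
Proof.
rewrite up_logP //=; have /andP [lt _] := up_log_bounds (isT : 1 < 2) m_gt1.
have a0 : 0 < up_log 2 m by rewrite up_log_gt0 m_gt1.
by rewrite -(prednK a0) expnS leq_mul2l /= ltnW.
Qed.

Lemma lg_gt0 : 0 < lg. Proof. by rewrite up_log_gt0 n2. Qed.

Lemma lg_le : lg <= n.
Proof.
rewrite -(leq_exp2l (m := 2)) // -[lg](prednK lg_gt0).
have /andP [lt _] := up_log_bounds (isT : 1 < 2) n2.
apply: (@leq_trans (2 * n)); first by rewrite expnS leq_mul2l /= ltnW.
apply: (@leq_trans (2 * 2 ^ n.-1)); last by rewrite -expnS prednK // ltnW.
by rewrite leq_mul2l /= -{1}(prednK (ltnW n2)) ltn_expl.
Qed.

Lemma h_time : hop_bound <= (d + 4) * 2 * m * lg.+1.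
Proof.
rewrite /hop_bound -!mulnA leq_mul2l; apply/orP; right; rewrite mulnA.
by apply: leq_mul => //; case/andP: M_bounds.
Qed.

(** Up to logarithms there are [n / m] landmarks, and [n ^ 2 <= m ^ 3] gives [(n / m) ^ 2 <= m];
    this is the origin of the exponent 2/3. *)
Lemma K_time : landmark_bound * landmark_bound <= 4 * (d + 5) ^ 2 * m * lg.+1 ^ 2.
Proof.
have [c3 _] := cbrt_sqP (ltnW n2); have m1 := m_gt1.
set u := n %/ m + 1.
have uu : u * u <= 4 * m.
  have nm : (n %/ m) * (n %/ m) <= m.
    have : (n %/ m * m) ^ 2 <= m ^ 3 by apply: leq_trans c3; rewrite leq_exp2r // leq_trunc_div.
    rewrite !expnS !expn0 !muln1; set z := n %/ m => le.
    have : (z * z) * (m * m) <= m * (m * m) by lia.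
    by rewrite leq_pmul2r // muln_gt0 ltnW.
  rewrite /u; move: nm; set z := n %/ m => nm; nia.
have Ku : landmark_bound <= (d + 5) * u * lg.+1.
  have le : n %/ 2 ^ up_log 2 m <= n %/ m.
    by apply: leq_div2l; [lia|case/andP: M_bounds].
  have u1 : 0 < u by rewrite /u addn1.
  have : landmark_bound <= 2 * u + d.+1 * lg + 2 by rewrite /landmark_bound /u; lia.
  move: (lg) u1 => l; move: u {uu} => u u1; nia.
apply: leq_trans (leq_mul Ku Ku) _.
have -> : (d + 5) * u * lg.+1 * ((d + 5) * u * lg.+1) = (d + 5) ^ 2 * lg.+1 ^ 2 * (u * u) by rewrite !expnS !expn0; lia.
have -> : 4 * (d + 5) ^ 2 * m * lg.+1 ^ 2 = (d + 5) ^ 2 * lg.+1 ^ 2 * (4 * m) by rewrite !expnS !expn0; lia.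
by rewrite leq_mul2l uu orbT.
Qed.

Lemma pow_n k : k <= n ^ k.
Proof. by apply: ltnW; apply: ltn_expl. Qed.

Lemma h_pow : hop_bound <= n ^ (d + 7).
Proof.
have [_ mn] := cbrt_sqP (ltnW n2); have /andP [_ M2] := M_bounds.
have -> : n ^ (d + 7) = n ^ (d + 4) * n ^ 2 * n by rewrite -!expnD -expnSr; congr (_ ^ _); lia.
rewrite /hop_bound; apply: leq_mul lg_le; apply: leq_mul; first exact: pow_n.
by apply: leq_trans M2 _; rewrite expnS expn1; apply: leq_mul.
Qed.

Lemma H_pow : length_bound <= n ^ (kq.*2 + d + 8).
Proof.
have -> : n ^ (kq.*2 + d + 8) = n ^ (kq.*2 + 1) * n ^ (d + 7) by rewrite -expnD; congr (_ ^ _); lia.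
by apply: leq_mul h_pow; apply: pow_n.
Qed.
End Sizes.

(** The three logarithms stem from [S * K]: one from the number of scales, two from bounding [K] by
    [K * K]. *)
Lemma time_bound h H S K e X l A cS cK A' : 0 < X -> 0 < l -> h <= A * X * l -> H <= A' * X * l ->
  K * K <= cK * X * l ^ 2 -> S.+1 <= cS * l -> e <= X ->
  3 * e + 3 + T4 h H S K (2 * e) <=
    (17 * A + 18 * cK + 39 + 8 * (cS * A') + 6 * (cS * cK) + 20 * cK) * X * l ^ 3.
Proof.
move=> X0 l0 hh hH hK hS he.
have K1 : K <= K * K by case: (K) => // k; rewrite leq_pmulr.
set Y := X * l ^ 3; have XY : X * l ^ 2 <= Y by rewrite leq_mul2l leq_pexp2l ?orbT.
have XY1 : X * l <= Y by rewrite -{1}(expn1 l) leq_mul2l leq_pexp2l ?orbT.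
have XY0 : X <= Y by rewrite leq_pmulr // expn_gt0 l0.
have h1 : h <= A * Y by apply: leq_trans hh _; rewrite -mulnA leq_mul2l XY1 orbT.
have k1 : K * K <= cK * Y by apply: leq_trans hK _; rewrite -mulnA leq_mul2l XY orbT.
have u1 : S.+1 * H <= cS * A' * Y.
  apply: leq_trans (leq_mul hS hH) _.
  have -> : cS * l * (A' * X * l) = cS * A' * (X * l ^ 2) by rewrite !expnS expn0; lia.
  by rewrite leq_mul2l XY orbT.
have v1 : S.+1 * K <= cS * cK * Y.
  apply: leq_trans (leq_mul hS (leq_trans K1 hK)) _.
  have -> : cS * l * (cK * X * l ^ 2) = cS * cK * Y by rewrite /Y !expnS expn0; lia.
  exact: leqnn.
rewrite -mulnA -/Y /T4 /T2 /T1.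
have -> : S.+1.*2 * (H + (H + K) * 3) = 8 * (S.+1 * H) + 6 * (S.+1 * K) by rewrite -mul2n; lia.
move: (S.+1 * H) (S.+1 * K) u1 v1 => u v u1 v1.
rewrite !mulnDl -!mulnA; rewrite -!mulnA in u1 v1.
move: (A * Y) (cK * Y) (cS * (A' * Y)) (cS * (cK * Y)) h1 k1 u1 v1 => a b c f h1 k1 u1 v1.
lia.
Qed.

Import Order.TTheory GRing.Theory Num.Theory.

(** * Correctness of the sampled instance *)

Lemma weight_le n (e : rel 'I_n) (w : 'I_n -> 'I_n -> nat) W u q :
  (forall x y, e x y -> w x y <= W) -> path e u q -> weight w u q <= size q * W.
Proof.
move=> H; elim: q u => [|x q IH] u; first by rewrite weight_nil.
by rewrite /= weight_cons mulSn => /andP [ux /IH le]; apply: leq_add le; apply: H.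
Qed.

Definition windows n (h : nat) (s : seq 'I_n) : seq {set 'I_n} :=
  [seq [set x in take h (drop j s)] | j <- iota 0 (size s) & j + h <= size s].

Lemma windows_card n h (s : seq 'I_n) Q : uniq s -> Q \in windows h s -> #|Q| = h.
Proof.
move=> U /mapP [j]; rewrite mem_filter => /andP [le _] ->.
rewrite cardsE (card_uniqP _) ?take_uniq ?drop_uniq //.
by rewrite size_takel // size_drop leq_subRL ?le // (leq_trans (leq_addr _ _) le).
Qed.

Lemma windows_mem n h (s q1 q2 q3 : seq 'I_n) : 0 < h -> s = q1 ++ q2 ++ q3 -> size q2 = h ->
  [set x in q2] \in windows h s.
Proof.
move=> h0 E S; apply/mapP; exists (size q1).
  by rewrite mem_filter mem_iota E !size_cat S; lia.
by rewrite E drop_size_cat // -S take_size_cat.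
Qed.

Section Instances.
Variables (d cw cid kq : nat).
Hypothesis kq0 : 0 < kq.

(** [2 ^ scale_bound n] is at least [n ^ cw.+1], which exceeds the weight of every simple path. *)
Definition scale_bound n := up_log 2 n * cw.+1.
(** If a replacement path exists, the estimate is at most [6 * n ^ cw.+1], which is below
    [n ^ (cw + 4)] as [n ^ 3 >= 8]. *)
Definition infty n := n ^ (cw + 4).
Definition p_B := cid + cw + d + kq.*2 + 20.
Definition round_bound n dia := T4 (hop_bound n d) (length_bound n d kq) (scale_bound n) (landmark_bound n d) dia.

Lemma p_bounds n : 1 < n -> [/\ 3 < n ^ p_B, (n ^ cid).*2 <= n ^ p_B, length_bound n d kq < n ^ p_B,
  n.+1 * infty n <= n ^ p_B & (n + hop_bound n d).*2.+1 < n ^ p_B].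
Proof.
move=> n2; have n0 := ltnW n2.
have le2 x : x.*2 <= n * x by rewrite -mul2n leq_mul2r n2 orbT.
have pw a b : a <= b -> n ^ a <= n ^ b by move=> H; rewrite leq_pexp2l.
have p0 k : 0 < n ^ k by rewrite expn_gt0 n0.
split.
- by apply: (@leq_trans (2 ^ 2)) => //; apply: (@leq_trans (n ^ 2)); [rewrite leq_exp2r|apply: pw; rewrite /p_B; lia].
- by apply: leq_trans (le2 _) _; rewrite -expnS; apply: pw; rewrite /p_B; lia.
- apply: leq_ltn_trans (H_pow d kq n2) _; rewrite ltn_exp2l // /p_B; lia.
- apply: (@leq_trans (n ^ 2 * n ^ (cw + 4))); last by rewrite -expnD; apply: pw; rewrite /p_B; lia.
  by rewrite leq_mul2r; apply/orP; right; rewrite !expnS expn0; nia.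
have hp := h_pow d n2; have n1 : n <= n ^ (d + 7) by rewrite -{1}(expn1 n) pw //; lia.
have : (n + hop_bound n d).*2.+1 <= (n ^ (d + 7).+2).*2.
  have := le2 (n ^ (d + 7)); have := le2 (n ^ (d + 7).+1); rewrite -!expnS; have := p0 (d + 7); lia.
have := le2 (n ^ (d + 7).+2); rewrite -expnS => h1 h2.
apply: leq_ltn_trans (leq_trans h2 h1) _; rewrite ltn_exp2l // /p_B; lia.
Qed.

(** * Fixed detours and correctness for a good sample *)

Section OneInstance.
Variables (n : nat) (E : rel 'I_n) (w : 'I_n -> 'I_n -> nat) (id : 'I_n -> nat) (s t : 'I_n) (p : seq 'I_n) (D : nat).
Hypothesis n2 : 1 < n.
Hypothesis wE : forall u v, E u v -> 0 < w u v <= n ^ cw.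
Hypothesis inj : injective id.
Hypothesis idN : forall v, id v < n ^ cid.
Hypothesis diam : forall u v, within E D u v.
Hypothesis SP : shortest_path E w s t p.
Local Notation h := (hop_bound n d).
Local Notation S := (scale_bound n).
Local Notation vt := (vt s p).

Lemma wpos u v : E u v -> 0 < w u v. Proof. by move=> /wE /andP []. Qed.
Lemma wle u v : E u v -> w u v <= n ^ cw. Proof. by move=> /wE /andP []. Qed.

Lemma uniq_weight u q : uniq (u :: q) -> path E u q -> size q < n /\ weight w u q <= n ^ cw.+1 /\ weight w u q < 2 ^ S.
Proof.
move=> U P; have sq : size q < n.
  have := max_card (mem (u :: q)); by rewrite (card_uniqP U) card_ord.
have W := weight_le wle P.
have lt : weight w u q < n ^ cw.+1.
  apply: leq_ltn_trans W _; rewrite expnS ltn_pmul2r ?expn_gt0 ?(ltnW n2) //.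
split=> //; split; first exact: ltnW.
by apply: leq_trans lt _; rewrite /scale_bound expnM leq_exp2r // up_logP.
Qed.

Definition detour i (x : nat * nat * nat * seq 'I_n) : Prop :=
  i < size p -> no_rpath E s t (vt i) (vt i.+1) \/
  let: (L, a, b, q) := x in [/\ is_rdist E w s t (vt i) (vt i.+1) L, (a <= i < b) && (b <= size p),
    path (offP E s p) (vt a) q /\ last (vt a) q = vt b, uniq (vt a :: q) &
    pre w s p a + weight w (vt a) q + suf w s p b <= L].

(** One detour per edge is fixed before the landmarks are drawn: the sets to be hit must not depend
    on the sample. *)
Lemma detours : exists f, forall i, detour i (f i).
Proof.
have H i : exists x, detour i x.
  have [lt|ge] := ltnP i (size p); last by exists (0, 0, 0, [::]); rewrite /detour ltnNge ge.
  have [H|[L [a [b [q H]]]]] := replacement wpos SP lt; first by exists (0, 0, 0, [::]) => _; left.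
  by exists (L, a, b, q) => _; right.
by have [f Hf] := choice H; exists f.
Qed.


(** The test on [uniq] gives every set exactly [h] elements, even where [f] returns a mere
    default. *)
Definition family (f : nat -> nat * nat * nat * seq 'I_n) : seq {set 'I_n} :=
  windows h p ++ flatten [seq (if uniq (f i).2 then windows h (f i).2 else [::]) | i <- iota 0 (size p)].

Lemma size_windows k (q : seq 'I_n) : size (windows k q) <= size q.
Proof. by rewrite size_map size_filter; apply: leq_trans (count_size _ _) _; rewrite size_iota. Qed.

Lemma uniq_size (q : seq 'I_n) : uniq q -> size q <= n.
Proof. by move=> U; have := max_card (mem q); rewrite (card_uniqP U) card_ord. Qed.

Lemma p_uniq : uniq (s :: p). Proof. exact: (shortest_uniq wpos SP). Qed.

Lemma family_size f : size (family f) <= n ^ 2 + n.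
Proof.
have sp : size p <= n by apply: uniq_size; have := p_uniq => /= /andP [].
rewrite size_cat addnC; apply: leq_add; last exact: leq_trans (size_windows _ _) sp.
rewrite size_flatten /shape -map_comp sumnE big_map.
apply: (@leq_trans (\sum_(i <- iota 0 (size p)) n)).
  apply: leq_sum => i _ /=; case: ifP => [U|//].
  exact: leq_trans (size_windows _ _) (uniq_size U).
by rewrite big_const_seq count_predT iter_addn_0 size_iota expnS expn1 leq_mul2l sp orbT.
Qed.

Lemma family_card f Q : Q \in family f -> #|Q| = h.
Proof.
rewrite mem_cat => /orP [|/flatten_mapP [i _]].
  by apply: windows_card; have := p_uniq => /= /andP [].
by case: ifP => // U; apply: windows_card.
Qed.

Lemma h_gt0 : 0 < h.
Proof. by rewrite /hop_bound !muln_gt0 expn_gt0 lg_gt0 // addn4. Qed.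

Section Sampled.
Variable f : nat -> nat * nat * nat * seq 'I_n.
Hypothesis fP : forall i, detour i (f i).
Variable lm : 'I_n -> bool.
Hypothesis lmK : #|[set v | lm v]| + 2 <= landmark_bound n d.
Hypothesis lmF : forall Q, Q \in family f -> exists2 v, v \in Q & lm v.
Hypothesis p0 : 0 < size p.
Let I := Inst E w id s t p lm.

Lemma sampled_window x : x + h <= size p -> exists i, x < i <= x + h /\ Lam I (vt i).
Proof.
move=> Hx; have [|v vQ lv] := @lmF [set z in take h (drop x p)].
  rewrite mem_cat; apply/orP; left; apply: (windows_mem (q1 := take x p) (q3 := drop h (drop x p)) h_gt0).
    by rewrite !cat_take_drop.
  by rewrite size_takel // size_drop; have := h_gt0; lia.
move: vQ; rewrite inE => /(nthP s) [k]; rewrite size_takel; last by rewrite size_drop leq_subRL ?Hx // (leq_trans (leq_addr _ _) Hx).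
move=> kh; rewrite nth_take // nth_drop => ev.
exists (x + k).+1; split; first by lia.
by rewrite /Lam /vt /= ev lv.
Qed.

Lemma sampled_card : #|[set v | Lam I v]| <= landmark_bound n d.
Proof.
apply: leq_trans lmK.
have -> : [set v | Lam I v] = [set v | lm v] :|: [set s; t].
  by apply/setP => v; rewrite !inE /Lam orbA.
apply: leq_trans (leq_card_setU _ _) _; rewrite leq_add2l.
by apply: leq_trans (leq_card_setU _ _) _; rewrite !cards1.
Qed.

Lemma sampled_pre : pre w s p (size p) < infty n.
Proof.
have [P _ _] := SP; rewrite /pre take_size; have [_ [le _]] := uniq_weight p_uniq P.
by apply: leq_ltn_trans le _; rewrite /infty ltn_exp2l //; lia.
Qed.

Lemma sampled_regular dia : (forall u v, within E dia u v) ->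
  regular (n ^ cid) h (landmark_bound n d) (infty n) dia I.
Proof.
by move=> W; split=> //; [apply: wpos|apply: sampled_window|apply: sampled_card|apply: sampled_pre].
Qed.

Local Notation ov dia := (oval (n ^ cid) h (length_bound n d kq) S (landmark_bound n d) (infty n) dia I).

Lemma oval_correct dia i (R : realType) (eps : R) : (1 <= kq%:R * eps)%R ->
  (forall u v, within E dia u v) -> i < size p ->
  correct_out eps E w s t (vt i) (vt i.+1)
    (if ov dia (vt i) < infty n then Some (ov dia (vt i)) else None).
Proof.
move=> keps W Hi; have reg := sampled_regular W; have [b1 b2 b3 b4 b5] := p_bounds n2.
have INF0 : 0 < infty n by rewrite expn_gt0 ltnW.
have HE : length_bound n d kq = (kq.*2 + 1) * h by [].
set x := ov dia (vt i).
(* Completeness is used twice: for the approximation, and for the finiteness of the estimate, so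
   that [None] is output only when there is no replacement path. *)
have up : no_rpath E s t (vt i) (vt i.+1) \/ exists L, is_rdist E w s t (vt i) (vt i.+1) L /\
    kq * x <= kq.+1 * L /\ x < infty n.
  have [H|] := fP Hi; first by left.
  case Ef: (f i) => [[[L a] b] q] [rd /andP [ab Hb] [Pq Lq] U le]; right; exists L; split=> //.
  have PE : path E (vt a) q by apply: sub_path Pq => u v /andP [].
  have [sq [w1 w2]] := uniq_weight U PE.
  have Uq : uniq q by move: U => /= /andP [].
  have hq : hits h I q.
    move=> q1 q2 q3 Eq S2; have [|v vQ lv] := @lmF [set z in q2].
      rewrite mem_cat; apply/orP; right; apply/flatten_mapP; exists i; first by rewrite mem_iota.
      by rewrite Ef Uq; apply: (windows_mem h_gt0 Eq S2).
    by apply/hasP; exists v; [rewrite inE in vQ|rewrite /Lam /= lv].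
  have c := oval_complete HE kq0 b1 b2 b3 b4 b5 INF0 reg Hi ab Hb Pq Lq hq sq w2.
  rewrite -/x in c.
  have c2 : kq * x <= kq.+1 * (pre w s p a + weight w (vt a) q + suf w s p b).
    apply: leq_trans c _; have le3 y1 y2 y3 : kq * (y1 + y3) + kq.+1 * y2 <= kq.+1 * (y1 + y2 + y3).
      by rewrite !mulnDr !mulSn; lia.
    exact: le3.
  split; first by apply: leq_trans c2 _; rewrite leq_mul2l le orbT.
  have [P _ _] := SP; have [_ [tot _]] := uniq_weight p_uniq P.
  have pa : pre w s p a <= n ^ cw.+1.
    have Ha : a <= size p by case/andP: ab => ai ib; apply: leq_trans Hb; apply: leq_trans ai (ltnW ib).
    by apply: leq_trans tot; rewrite -(@pre_suf _ w s p a) //; apply: leq_addr.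
  have sb : suf w s p b <= n ^ cw.+1.
    by apply: leq_trans tot; rewrite -(@pre_suf _ w s p b) //; apply: leq_addl.
  have : kq * x < kq * infty n; last by rewrite ltn_pmul2l.
  apply: leq_ltn_trans c2 _.
  apply: (@leq_ltn_trans (kq.*2 * (3 * n ^ cw.+1))); first by apply: leq_mul; lia.
  have -> : infty n = n ^ cw.+1 * n ^ 3 by rewrite -expnD /infty; congr (_ ^ _); lia.
  have z8 : 8 <= n ^ 3 by apply: (@leq_trans (2 ^ 3)) => //; rewrite leq_exp2r.
  have : 0 < n ^ cw.+1 by rewrite expn_gt0 ltnW.
  move: (n ^ cw.+1) (n ^ 3) z8 => y z z8 y0.
  have ky : 0 < kq * y by rewrite muln_gt0 kq0.
  have : 8 * (kq * y) <= z * (kq * y) by rewrite leq_mul2r z8 orbT.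
  by rewrite -mul2n; lia.
rewrite /correct_out; case: ifP => lt; last first.
  by case: up => // -[L [_ [_ lt']]]; rewrite lt' in lt.
have C := oval_sound HE kq0 b1 b2 b3 b4 b5 INF0 reg Hi lt.
case: C => q [Pq Lq Wq].
case: up => [H|[L [rd [le _]]]]; first by case: (H q Pq Lq).
exists L; split=> //; first by case: rd => _ /(_ q Pq Lq) le2; apply: leq_trans le2 Wq.
have k0 : (0 < kq%:R :> R)%R by rewrite ltr0n.
have le' : (kq%:R * x%:R <= kq%:R * L%:R + L%:R :> R)%R.
  by rewrite -!natrM -natrD ler_nat addnC -mulSn.
rewrite -(ler_pM2l k0) mulrDl mul1r mulrDr; apply: le_trans le' _.
rewrite lerD2l mulrA; apply: ler_peMl => //; exact: ler0n.
Qed.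
End Sampled.
End OneInstance.
End Instances.

(** * The theorem *)

Section Algorithm.
Variables (d cw cid kq : nat).
Hypothesis kq0 : 0 < kq.
Local Notation B := (p_B d cw cid kq).
Local Notation Ts n e := (round_bound d cw kq n (2 * e)).

(** [computable] only asserts existence; choice provides one protocol per size and eccentricity, the
    same for all instances, as a single algorithm requires. *)
Lemma protocols : exists pis : nat -> nat -> (View -> nat) * (View -> nat), forall n e, 1 < n ->
  forall I : inst n, regular (n ^ cid) (hop_bound n d) (landmark_bound n d) (infty cw n) (2 * e) I -> forall v,
  (pis n e).2 (view (pis n e).1 I B (Ts n e) v) =
  oval (n ^ cid) (hop_bound n d) (length_bound n d kq) (scale_bound cw n) (landmark_bound n d) (infty cw n) (2 * e) I v.
Proof.
have ex (c : nat * nat) : exists po : (View -> nat) * (View -> nat), 1 < c.1 ->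
  forall I : inst c.1, regular (c.1 ^ cid) (hop_bound c.1 d) (landmark_bound c.1 d) (infty cw c.1) (2 * c.2) I -> forall v,
  po.2 (view po.1 I B (Ts c.1 c.2) v) =
  oval (c.1 ^ cid) (hop_bound c.1 d) (length_bound c.1 d kq) (scale_bound cw c.1) (landmark_bound c.1 d) (infty cw c.1) (2 * c.2) I v.
  case: c => n e /=; have [n2|n1] := ltnP 1 n; last by exists (fun=> 0, fun=> 0).
  have [b1 b2 b3 b4 b5] := p_bounds d cw cid kq0 n2.
  have INF0 : 0 < infty cw n by rewrite expn_gt0 ltnW.
  have HE : length_bound n d kq = (kq.*2 + 1) * hop_bound n d by [].
  have [pi [out H]] := oval_computable (scale_bound cw n) (landmark_bound n d) (2 * e) HE kq0 b1 b2 b3 b4 b5 INF0.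
  by exists (pi, out) => _ I reg v; apply: H.
have [g Hg] := choice ex.
by exists (fun n e => g (n, e)) => n e n2; apply: (Hg (n, e)).
Qed.

Definition rbits n := up_log 2 (cbrt_sq n).

Definition algorithm (pis : nat -> nat -> (View -> nat) * (View -> nat)) : Alg := {|
  a_St := fun=> View;
  a_rbits := rbits;
  a_init := fun n li b => (li, selected b, [::]);
  a_msg := fun n V _ => pi2 (n ^ cid) (fun e => (pis n e).1) V;
  a_upd := fun n V m => (V.1, rcons V.2 m);
  a_halted := fun n V => (n <= 1) || halt2 (n ^ cid) (fun e => Ts n e) V;
  a_out := fun n V _ => out2 (n ^ cid) (fun e => (pis n e).2) (infty cw n) V |}.

Lemma runE pis n (E : rel 'I_n) w id s t p (r : {ffun 'I_n -> (rbits n).-tuple bool}) :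
  run (A := algorithm pis) B E id (local E w id s t (s :: p)) r =
  view (pi2 (n ^ cid) (fun e => (pis n e).1)) (Inst E w id s t p (fun v => selected (r v))) B.
Proof. by apply: funext; elim=> [//|T IH] /=; rewrite IH. Qed.
End Algorithm.

Theorem theorem1p3 (R : realType) (eps : R) :
  (0 < eps < 1)%R ->
  forall cw cid d : nat,
  exists (A : Alg) (B C k : nat),
  forall n (E : rel 'I_n) (w : 'I_n -> 'I_n -> nat) (id : 'I_n -> nat)
         (s t : 'I_n) (p : seq 'I_n) (D : nat),
    (forall v, ~~ E v v) ->
    (forall u v, E u v -> 0 < w u v <= n ^ cw) ->
    injective id -> (forall v, id v < n ^ cid) ->
    is_diameter E D ->
    shortest_path E w s t p ->
    exists Good : {set {ffun 'I_n -> (a_rbits A n).-tuple bool}},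
      #|~: Good| * n ^ d <= #|{ffun 'I_n -> (a_rbits A n).-tuple bool}| /\
      forall r, r \in Good ->
        success eps B E w id s t p (C * (cbrt_sq n + D) * (up_log 2 n).+1 ^ k) r.
Proof.
move=> /andP [eps0 _] cw cid d.
(* With [1 / kq <= eps] the factor [(kq + 1) / kq] of the estimates is at most [1 + eps]. *)
have [kq kq0 keps] : exists2 kq, 0 < kq & (1 <= kq%:R * eps)%R.
  have ub : (eps^-1 < (Num.bound eps^-1)%:R)%R by apply: archi_boundP; rewrite invr_ge0 ltW.
  exists (Num.bound eps^-1); first by rewrite -(ltr0n R); apply: lt_trans ub; rewrite invr_gt0.
  by rewrite -ler_pdivrMr // div1r ltW.
have [pis pisP] := protocols d cw cid kq0.
pose A := (d + 4) * 2; pose cK := 4 * (d + 5) ^ 2; pose cS := cw.+1; pose A' := (kq.*2 + 1) * A.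
exists (algorithm d cw cid kq pis), (p_B d cw cid kq),
  (17 * A + 18 * cK + 39 + 8 * (cS * A') + 6 * (cS * cK) + 20 * cK), 3.
move=> n E w id s t p D irr wE inj idN [diam _] SP.
(* On a single vertex without loops [p] is empty, and the algorithm may halt at once. *)
have [n2|n1] := ltnP 1 n; last first.
  exists setT; split; first by rewrite setCT cards0.
  move=> r _ v; exists 0; split=> //=; first by rewrite n1.
  have -> : p = [::].
    case: (p) SP => // x q [/= /andP [sx _] _ _].
    have e : s = x by apply: ord_inj; have := ltn_ord s; have := ltn_ord x; lia.
    by move: sx; rewrite -e (negPf (irr s)).
  by [].
have [f fP] := detours wE SP.
have a0 : 0 < up_log 2 (cbrt_sq n) by rewrite up_log_gt0 m_gt1.
have [Good [G1 G2]] := hitting (d := d) n2 a0 (family_size d wE SP f) (fun Q => @family_card d cw n E w s t p wE SP f Q).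
exists Good; split=> // r rG; have [card hit] := G2 r rG.
set I := Inst E w id s t p (fun v => selected (r v)).
have diamI : forall u v, within (gE I) D u v by [].
pose e := ecc diamI.
have eD : e <= D := ecc_D diamI.
have nB : n < n ^ p_B d cw cid kq by rewrite -{1}(expn1 n) ltn_exp2l // /p_B; lia.
have X0 : 0 < cbrt_sq n + D by have := m_gt1 n2; lia.
rewrite /success (runE d cw cid kq pis E w id s t p r) -/I => v.
(* The eccentricity stage followed by the main protocol, with [2 * e] as a bound on the diameter
   that every vertex knows. *)
exists (3 * e + 3 + round_bound d cw kq n (2 * e)); split.
- apply: time_bound => //; try exact: (leq_trans eD (leq_addl _ _)).
  + apply: leq_trans (h_time d n2) _; rewrite leq_mul2r; apply/orP; right.
    by rewrite leq_mul2l leq_addr orbT.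
  + rewrite /length_bound -!mulnA leq_mul2l; apply/orP; right; apply: leq_trans (h_time d n2) _.
    by rewrite -!mulnA leq_mul2l; apply/orP; right; rewrite leq_mul2l leq_mul2r leq_addr !orbT.
  + apply: leq_trans (K_time d n2) _; rewrite leq_mul2r; apply/orP; right.
    by rewrite leq_mul2l leq_addr orbT.
  + by rewrite /scale_bound /cS; lia.
- by rewrite /= (halt2P _ _ nB (I := I) inj idN diamI) leqnn orbT.
- move=> T; rewrite /= (halt2P _ _ nB (I := I) inj idN diamI) -/e => lt.
  by rewrite leqNgt n2 /= -ltnNge.
move=> u /onPP [i Hi [-> ->]].
rewrite /= (out2P _ _ _ nB (I := I) inj idN diamI) -/e.
have W : forall u v, within E (2 * e) u v := within_ecc diamI.
have lmK : #|[set v | selected (r v)]| + 2 <= landmark_bound n d by rewrite leq_add2r.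
have p0 : 0 < size p by lia.
rewrite pisP //; first exact: (oval_correct kq0 n2 wE inj idN SP fP lmK hit p0 keps W Hi).
exact: (sampled_regular kq0 n2 wE inj idN SP lmK hit p0 W).
Qed.
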